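(* Let $G_1, \dots, G_l \leq \mathrm{Homeo}(\mathfrak{C})$ (with $l \geq 1$) be finitely generated simple vigorous groups. Let $k \geq 2$ and let $m_1, \dots, m_k \geq 2$ be integers, where $\{m_1, m_2\} \neq \{2\}$ if $k = 2$. Then the direct product $G_1 \times \cdots \times G_l$ has a minimal generating set $\{\alpha_1, \dots, \alpha_k\}$ of size $k$ where $|\alpha_i| = m_i$ for all $1 \leq i \leq k$.
   Context: $\mathfrak{C}$ denotes Cantor space and $\mathrm{Homeo}(\mathfrak{C})$ its group of homeomorphisms, acting on the right. A group $G \leq \mathrm{Homeo}(\mathfrak{C})$ is vigorous if for every clopen subset $A$ of $\mathfrak{C}$ and all proper nonempty clopen subsets $B$ and $C$ of $A$ there exists $\gamma \in G$ such that $B\gamma \subseteq C$ and $\gamma$ fixes $\mathfrak{C} \setminus A$ pointwise. A generating set $X$ of a group is minimal if no proper subset of $X$ generates the group. $|\alpha|$ denotes the order of an element $\alpha$. *)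

(* Defs.v *)
From HB Require Import structures.
From mathcomp Require Import all_boot.
From mathcomp Require Import boolp classical_sets cardinality.
From mathcomp Require Import topology cantor.

Set Implicit Arguments.
Unset Strict Implicit.
Unset Printing Implicit Defensive.

Local Open Scope classical_set_scope.
Local Open Scope group_scope.

Section Homeo.
Variable T : topologicalType.

Record homeo : Type := Homeo {
  homeo_fun :> T -> T;
  homeo_inv : T -> T;
  homeoK : cancel homeo_fun homeo_inv;
  homeo_invK : cancel homeo_inv homeo_fun;
  homeo_cts : continuous homeo_fun;
  homeo_inv_cts : continuous homeo_inv }.

Lemma homeoP (f g : homeo) : (f : T -> T) = g -> f = g.
Proof.
case: f g => [f f' fK f'K cf cf'] [g g' gK g'K cg cg'] /= fg.
have fg' : f' = g'.
  by apply/funext => x; rewrite -[in LHS](g'K x) -fg fK.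
by subst g g'; congr Homeo; exact: Prop_irrelevance.
Qed.

HB.instance Definition _ := gen_eqMixin homeo.
HB.instance Definition _ := gen_choiceMixin homeo.

Lemma idfun_continuous : continuous (idfun : T -> T).
Proof. by move=> x. Qed.

Definition homeo_one : homeo :=
  @Homeo idfun idfun (fun=> erefl) (fun=> erefl)
    idfun_continuous idfun_continuous.

Definition homeo_inverse (f : homeo) : homeo :=
  Homeo (@homeo_invK f) (@homeoK f) (@homeo_inv_cts f) (@homeo_cts f).

Lemma comp_continuous (f g : T -> T) :
  continuous f -> continuous g -> continuous (g \o f).
Proof. by move=> cf cg x; apply: continuous_comp; [exact: cf|exact: cg]. Qed.

(* Homeomorphisms act on the right: f * g is "first f, then g". *)
Definition homeo_mul (f g : homeo) : homeo :=
  @Homeo (g \o f) (homeo_inv f \o homeo_inv g)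
    (can_comp (@homeoK g) (@homeoK f))
    (can_comp (@homeo_invK f) (@homeo_invK g))
    (comp_continuous (@homeo_cts f) (@homeo_cts g))
    (comp_continuous (@homeo_inv_cts g) (@homeo_inv_cts f)).

Lemma homeo_mulA : associative homeo_mul.
Proof. by move=> f g h; apply: homeoP. Qed.

Lemma homeo_mul1 : left_id homeo_one homeo_mul.
Proof. by move=> f; apply: homeoP. Qed.

Lemma homeo_mulr1 : right_id homeo_one homeo_mul.
Proof. by move=> f; apply: homeoP. Qed.

Lemma homeo_mulV : left_inverse homeo_one homeo_inverse homeo_mul.
Proof. by move=> f; apply: homeoP; apply/funext => x /=; rewrite homeo_invK. Qed.

Lemma homeo_mulrV : right_inverse homeo_one homeo_inverse homeo_mul.
Proof. by move=> f; apply: homeoP; apply/funext => x /=; rewrite homeoK. Qed.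

HB.instance Definition _ := isGroup.Build homeo
  homeo_mulA homeo_mul1 homeo_mulr1 homeo_mulV homeo_mulrV.

End Homeo.

Section Groups.
Variable gT : groupType.
Implicit Types (G N : set gT) (X Y : set gT) (x : gT).

Definition subgroup G : Prop := group_closed [in G].

Definition generated X : set gT := smallest subgroup X.

Definition finitely_generated G : Prop :=
  exists2 X, finite_set X & generated X = G.

Definition normal_in N G : Prop :=
  [/\ subgroup N, N `<=` G & forall x y, N x -> G y -> N (x ^ y)].

Definition simple_group G : Prop :=
  G <> [set 1] /\ forall N, normal_in N G -> N = [set 1] \/ N = G.

Definition minimal_generating_set G X : Prop :=
  generated X = G /\ forall Y, Y `<` X -> generated Y <> G.

(* The order of x is finite and equal to n. *)
Definition has_order x (n : nat) : Prop :=
  [/\ (0 < n)%N, x ^+ n = 1 & forall j : nat, (0 < j < n)%N -> x ^+ j <> 1].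

Definition direct_product (I : finType) (G : I -> set gT) :
    set {ffun I -> gT} :=
  [set f | forall i, G i (f i)].

End Groups.

Definition vigorous (G : set (homeo cantor_space)) : Prop :=
  forall A : set cantor_space, clopen A ->
  forall B C : set cantor_space,
    clopen B -> B !=set0 -> B `<` A ->
    clopen C -> C !=set0 -> C `<` A ->
  exists2 g : homeo cantor_space, G g &
    g @` B `<=` C /\ (forall x, ~ A x -> g x = x).

(* Main.v *)
(* Let F be the full group of G, i.e. the homeomorphisms that locally agree with
   elements of G. Simplicity makes every germ of G the germ of an element fixing
   a nonempty clopen set, so an element of F can be copied on a clopen set by an
   element of G that moves only that set, its image and a small clopen set
   elsewhere. Commutators of elements of F supported in a proper clopen set thus
   lie in G, and they generate it. In particular G contains many even
   permutations of disjoint copies of a clopen set, hence many torsion elements,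
   and is generated by its elements of any given exponent n >= 2.

   Let m >= 3 and n >= 2. Take disjoint copies X, aX, ..., a^(m-1)X, permuted
   cyclically by a, of a row of q copies ("tokens") of the whole space. Let b map
   X to aX by a s^-1, where s shifts the row by one token and s^q is an element
   rho of infinite order on each token; let b act on a^2 X by elements c_j of
   exponent n on the j-th token, and exchange part of the token 0 of a^2 X with
   the rest R of the space. Then w = a b^-1 acts on X as s, and if rho is inverse
   to c_1 ... c_(q-1) the other orbits of w are bounded, so a power of w is
   supported on X and acts there by a power of rho. If the j with c_j <> 1 are
   sparse, its commutators with conjugates of a^2 b a^-2 isolate one token, where
   they generate a copy of G as soon as the c_j generate G. Its translates cover
   the space, so a and b generate G. When all the m_i are 2, a is the product of
   two involutions; further generators exchange new clopen sets with part of R.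

   The gaps between the j with c_j <> 1 can be made to exceed any power of w that
   is supported on X in the previous factors; a commutator of that power with its
   conjugate by a is then trivial in the previous factors but not in the present
   one, and simplicity of the factors yields the whole product. *)

Require Import Defs.
From mathcomp Require Import all_boot zify finmap.
From mathcomp Require Import boolp classical_sets cardinality.
From mathcomp Require Import topology cantor.

Set Implicit Arguments.
Unset Strict Implicit.
Unset Printing Implicit Defensive.

Local Open Scope classical_set_scope.
Local Open Scope group_scope.

(** * Subgroups and homeomorphisms *)

(** Two obstacles shape the construction. The first is parity: a homeomorphism exchanging two
    disjoint clopen sets along an element of [G] lies in the full group, but only commutators are
    known to lie in [G]. Exchanges are therefore paired: the number q of tokens is even, so that
    exchanging two rows is a product of two disjoint exchanges, and an n-cycle of clopen sets is
    accompanied by a second one on other copies. The second is minimality. A vigorous group leaves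
    no nonempty set invariant that misses a nonempty clopen set, so it suffices to find, for each
    generator, such a set invariant under all the others; in a product, one factor is enough for
    this. An order of at least 3 gives a three separate rows: X and aX, between which b differs from
    a by the shift, and a^2 X, which carries the c_j. If all the m_i are 2, a is given order 3 as a
    product of two involutions, so that b is a third generator; this is where k = 2 is excluded. *)

Notation C := cantor_space.

Section Subgroups.
Variable gT : groupType.
Implicit Types (G H X : set gT) (x y : gT).

Lemma subgroupP G :
  subgroup G <-> G 1 /\ forall x y, G x -> G y -> G (x * y^-1).
Proof.
split=> [[G1 Gd]|[G1 Gd]]; split; rewrite ?inE //.
- by move: G1; rewrite inE.
- by move=> x y Gx Gy; have := Gd x y; rewrite !inE; exact.
- by move=> x y; rewrite !inE; exact: Gd.
Qed.

Lemma sg1 G : subgroup G -> G 1.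
Proof. by case/subgroupP. Qed.

Lemma sgV G x : subgroup G -> G x -> G x^-1.
Proof. by case/subgroupP=> G1 Gd Gx; rewrite -[x^-1]mul1g; exact: Gd. Qed.

Lemma sgM G x y : subgroup G -> G x -> G y -> G (x * y).
Proof.
move=> sG Gx Gy; have [_ Gd] := (subgroupP G).1 sG.
by rewrite -[y]invgK; apply: Gd => //; exact: sgV.
Qed.

Lemma sgX G x n : subgroup G -> G x -> G (x ^+ n).
Proof.
by move=> sG Gx; elim: n => [|n IH]; rewrite ?expg0 ?expgS; [exact: sg1|exact: sgM].
Qed.

Lemma sgJ G x y : subgroup G -> G x -> G y -> G (x ^ y).
Proof. by move=> sG Gx Gy; do 2?apply: sgM => //; exact: sgV. Qed.

Lemma sgR G x y : subgroup G -> G x -> G y -> G [~ x, y].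
Proof. by move=> sG Gx Gy; apply: sgM => //; [exact: sgV|exact: sgJ]. Qed.

Lemma subgroup_mk G : G 1 -> (forall x y, G x -> G y -> G (x * y)) ->
  (forall x, G x -> G x^-1) -> subgroup G.
Proof. by move=> G1 GM GV; apply/subgroupP; split=> // x y Gx /GV; exact: GM. Qed.

Lemma generated_subgroup X : subgroup (generated X).
Proof.
apply: subgroup_mk.
- by move=> G [sG _]; exact: sg1.
- by move=> x y Xx Xy G GX; apply: sgM; [exact: GX.1|exact: Xx|exact: Xy].
- by move=> x Xx G GX; apply: sgV; [exact: GX.1|exact: Xx].
Qed.

Lemma sub_generated X : X `<=` generated X.
Proof. by move=> x Xx G [_]; exact. Qed.

Lemma generated_min X G : subgroup G -> X `<=` G -> generated X `<=` G.
Proof. by move=> sG XG x; apply; split. Qed.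

Lemma simple_normalE G N : simple_group G -> normal_in N G ->
  (exists2 x, N x & x <> 1) -> N = G.
Proof.
move=> [_ sG] nN [x Nx x1]; case: (sG _ nN) => // N1.
by move: Nx; rewrite N1.
Qed.

End Subgroups.

Section HomeoBasics.
Implicit Types (f g h : homeo C) (U V W L : set C) (x y : C).

Lemma homeo_ext f g : (forall x, f x = g x) -> f = g.
Proof. by move=> fg; apply: homeoP; apply/funext. Qed.

Lemma hmulE f g x : (f * g) x = g (f x). Proof. by []. Qed.
Lemma hone x : (1 : homeo C) x = x. Proof. by []. Qed.
Lemma hinvK f x : f^-1 (f x) = x. Proof. exact: homeoK. Qed.
Lemma hKinv f x : f (f^-1 x) = x. Proof. exact: homeo_invK. Qed.

Lemma hinj f x y : f x = f y -> x = y.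
Proof. by move=> fxy; rewrite -[x](hinvK f) fxy hinvK. Qed.

Lemma hconjE f g x : (f ^ g) x = g (f (g^-1 x)). Proof. by []. Qed.
Lemma hconj f g x : (f ^ g) (g x) = g (f x).
Proof. by rewrite hconjE hinvK. Qed.
Lemma hcommE f g x : [~ f, g] x = g (f (g^-1 (f^-1 x))). Proof. by []. Qed.

Lemma hinv_eq f x y : f x = y -> f^-1 y = x.
Proof. by move=> <-; rewrite hinvK. Qed.

Lemma hmove f : f <> 1 -> exists x, f x <> x.
Proof.
move=> f1; apply: contrapT => nx; apply: f1; apply: homeo_ext => x.
by apply: contrapT => fx; apply: nx; exists x.
Qed.

Lemma hexpS f n x : (f ^+ n.+1) x = f ((f ^+ n) x).
Proof. by rewrite expgSr. Qed.

Lemma hexpSr f n x : (f ^+ n.+1) x = (f ^+ n) (f x).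
Proof. by rewrite expgS. Qed.

Lemma hexpD f n p x : (f ^+ (n + p)) x = (f ^+ p) ((f ^+ n) x).
Proof. by rewrite expgnDr. Qed.

Definition im f U : set C := [set x | U (f^-1 x)].

Lemma imE f U x : im f U (f x) = U x.
Proof. by rewrite -[in RHS](hinvK f x). Qed.

Lemma im_clopen f U : clopen U -> clopen (im f U).
Proof. by move=> cU; apply: (preimage_clopen cU); exact: (@homeo_cts _ f^-1). Qed.

Lemma imM f g U : im (f * g) U = im g (im f U).
Proof. by rewrite /im invgM. Qed.

Lemma im1 U : im 1 U = U.
Proof. by []. Qed.

Lemma imP f U x : im f U x -> exists2 y, U y & x = f y.
Proof. by exists (f^-1 x); rewrite ?hKinv. Qed.

Lemma im_neq0 f U : U !=set0 -> im f U !=set0.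
Proof. by case=> x Ux; exists (f x); rewrite imE. Qed.

Lemma imS f U V : U `<=` V -> im f U `<=` im f V.
Proof. by move=> UV x; exact: UV. Qed.

Lemma imU f U V : im f (U `|` V) = im f U `|` im f V.
Proof. by []. Qed.

Lemma imK f U : im f^-1 (im f U) = U.
Proof. by rewrite -imM mulgV. Qed.

Definition supp f L := forall x, ~ L x -> f x = x.

Lemma supp1 L : supp 1 L.
Proof. by []. Qed.

Lemma suppW f L L' : supp f L -> L `<=` L' -> supp f L'.
Proof. by move=> sf LL x Lx; apply: sf => /LL. Qed.

Lemma suppM f g L : supp f L -> supp g L -> supp (f * g) L.
Proof. by move=> sf sg x Lx; rewrite hmulE sf // sg. Qed.

Lemma suppV f L : supp f L -> supp f^-1 L.
Proof. by move=> sf x Lx; apply: hinv_eq; exact: sf. Qed.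

Lemma supp_stable f L x : supp f L -> L (f x) <-> L x.
Proof.
move=> sf; split=> [Lfx|Lx]; apply: contrapT => nL.
  by move: Lfx; rewrite (sf _ nL).
by have /hinj fx := sf _ nL; apply: nL; rewrite fx.
Qed.

Lemma suppJ f g L : supp f L -> supp (f ^ g) (im g L).
Proof. by move=> sf x Lx; rewrite hconjE sf // hKinv. Qed.

Lemma suppX f L n : supp f L -> supp (f ^+ n) L.
Proof. by move=> sf; elim: n => [|n IH] //; rewrite expgS; exact: suppM. Qed.

Lemma suppR f g L : supp f L -> supp g L -> supp [~ f, g] L.
Proof.
by move=> sf sg; rewrite commgEl conjgE; do 3?apply: suppM => //; exact: suppV.
Qed.

Lemma supp_im f L : supp f L -> im f L = L.
Proof.
move=> sf; apply/seteqP; split=> x; rewrite /im /=.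
  by move=> /(supp_stable _ (suppV sf)).
by move=> Lx; apply/(supp_stable _ (suppV sf)).
Qed.

Lemma supp_commute f g L L' : supp f L -> supp g L' -> L `&` L' `<=` set0 ->
  commute f g.
Proof.
move=> sf sg LL; apply: homeo_ext => x; rewrite !hmulE.
have [Lx|nLx] := pselect (L x).
  have Lfx : L (f x) by apply/supp_stable.
  rewrite (sg x) => [|L'x]; last exact: (LL x).
  by rewrite (sg (f x)) // => L'x; apply: (LL (f x)).
rewrite (sf x) //; have [L'x|nL'x] := pselect (L' x); last by rewrite sg // sf.
by rewrite (sf (g x)) // => Lgx; apply: (LL (g x)); split=> //; apply/supp_stable.
Qed.

Lemma clopenD U V : clopen U -> clopen V -> clopen (U `&` ~` V).
Proof. by move=> cU cV; apply: clopenI => //; exact: clopenC. Qed.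

Lemma clopen_split U : clopen U -> U !=set0 -> exists V1 V2,
  [/\ clopen V1, clopen V2, V1 !=set0, V2 !=set0 &
   V1 `|` V2 = U /\ V1 `&` V2 = set0].
Proof.
move=> cU U0; have [x [y [Ux Uy xy]]] := perfectTP_ex.1 cantor_perfect U cU.1 U0.
have [V [cV Vx Vy]] := cantor_zero_dimensional xy.
exists (U `&` V), (U `&` ~` V); split.
- exact: clopenI.
- exact: clopenD.
- by exists x.
- by exists y.
split; first by rewrite -setIUr setUCr setIT.
by rewrite setIACA setICr setI0.
Qed.

Lemma clopen_shrink U : clopen U -> U !=set0 ->
  exists V, [/\ clopen V, V !=set0 & V `<` U].
Proof.
move=> cU U0; have [V [V' [cV _ V0 [y V'y] [VU VI]]]] := clopen_split cU U0.
exists V; split=> //; split; first by rewrite -VU; exact: subsetUl.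
move=> /(_ y) UV; have : (V `&` V') y by split=> //; apply: UV; rewrite -VU; right.
by rewrite VI.
Qed.

Lemma clopen_avoid1 U x : clopen U -> U !=set0 ->
  exists V, [/\ clopen V, V !=set0, V `<=` U & ~ V x].
Proof.
move=> cU U0; have [V [V' [cV cV' V0 V'0 [VU VI]]]] := clopen_split cU U0.
have [Vx|nVx] := pselect (V x); [exists V'|exists V]; split=> //.
- by rewrite -VU; exact: subsetUr.
- by move=> V'x; have : (V `&` V') x by []; rewrite VI.
- by rewrite -VU; exact: subsetUl.
Qed.

Lemma clopen_nbhd x y : x <> y -> exists U, [/\ clopen U, U x & ~ U y].
Proof.
by move=> /eqP xy; have [V [cV Vx Vy]] := cantor_zero_dimensional xy; exists V.
Qed.

(** Induction by compactness: finitely many of the local neighbourhoods cover [U], and cutting a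
    clopen set along them one at a time leaves a disjoint union of small pieces. *)
Lemma clopen_ind (P : set C -> Prop) U : clopen U -> P set0 ->
  (forall V W, clopen V -> clopen W -> V `<=` U -> W `<=` U ->
     V `&` W = set0 -> P V -> P W -> P (V `|` W)) ->
  (forall x, U x -> exists V, [/\ clopen V, V x &
     forall W, clopen W -> W `<=` V -> W `<=` U -> P W]) ->
  P U.
Proof.
move=> cU P0 PU Ploc.
have cpU : compact U.
  by apply: (subclosed_compact cU.2 cantor_space_compact).
have /choice [V HV] : forall x, exists V, U x ->
    [/\ clopen V, V x & forall W, clopen W -> W `<=` V -> W `<=` U -> P W].
  move=> x; have [Ux|nUx] := pselect (U x); last by exists set0.
  by have [V ?] := Ploc x Ux; exists V.
move: cpU; rewrite compact_cover => /(_ C U V) [].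
- by move=> x /HV [[]].
- by move=> x Ux; exists x => //; case: (HV x Ux).
move=> D DU UV.
have DU' : forall x, x \in enum_fset D -> U x.
  by move=> x /DU; rewrite inE.
have UV' : forall x, U x -> exists2 y, y \in enum_fset D & V y x.
  by move=> x /UV [y yD Vy]; exists y.
move: (enum_fset D) DU' UV' => s {D DU UV} sU Us.
suff H : forall W, clopen W -> W `<=` U ->
    (forall x, W x -> exists2 y, y \in s & V y x) -> P W by exact: H.
elim: s sU {Us} => [|y s IH] sU W cW WU Ws.
  rewrite (_ : W = set0) //; apply/seteqP; split=> // x /Ws [] //.
have [cVy Vyy PVy] := HV y (sU y (mem_head _ _)).
rewrite -[W](setIT W) -(setUCr (V y)) setIUr; apply: PU.
- exact: clopenI.
- exact: clopenD.
- by move=> x [] /WU.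
- by move=> x [] /WU.
- by rewrite setIACA setICr setI0.
- apply: PVy; [exact: clopenI|by move=> x []|by move=> x [/WU]].
apply: IH; [by move=> x xs; apply: sU; rewrite inE xs orbT|exact: clopenD|by move=> x [/WU]|].
move=> x [/Ws[z]]; rewrite inE => /orP[/eqP ->|zs] Vz nV //.
by exists z.
Qed.

End HomeoBasics.

(** * The full group *)

Section FullGroup.
Variable G : set (homeo C).
Hypothesis sG : subgroup G.
Hypothesis simG : simple_group G.
Hypothesis vigG : vigorous G.
Implicit Types (f g h k : homeo C) (U V W L E : set C) (x y : C).

Lemma vig A B D : clopen A -> clopen B -> B !=set0 -> B `<` A ->
  clopen D -> D !=set0 -> D `<` A ->
  exists g, [/\ G g, forall x, B x -> D (g x) & supp g A].
Proof.
move=> cA cB B0 BA cD D0 DA; have [g Gg [gB sg]] := vigG cA cB B0 BA cD D0 DA.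
by exists g; split=> // x Bx; apply: gB; exists x.
Qed.

Lemma proper_pick U V x : U `<=` V -> V x -> ~ U x -> U `<` V.
Proof. by move=> UV Vx nUx; split=> // /(_ x Vx). Qed.

Lemma properWS U V W : U `<` V -> V `<=` W -> U `<` W.
Proof.
by move=> [UV VU] VW; split; [exact: subset_trans VW|move=> /(subset_trans VW)].
Qed.

Lemma vig_disj B D : clopen B -> B !=set0 -> clopen D -> D !=set0 ->
  B `&` D = set0 ->
  exists g, [/\ G g, forall x, B x -> D (g x) & supp g (B `|` D)].
Proof.
move=> cB B0 cD D0 BD; have [x Bx] := B0; have [y Dy] := D0.
have nBD z : B z -> D z -> False by move=> Bz Dz; rewrite -[False]/(set0 z) -BD.
apply: vig => //; first exact: clopenU.
- by apply: (@proper_pick _ _ y); [move=> z; left|right|move=> /nBD; apply].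
- by apply: (@proper_pick _ _ x); [move=> z; right|left|exact: nBD].
Qed.

Lemma G_nontrivial A : clopen A -> A !=set0 ->
  exists g, [/\ G g, g <> 1 & supp g A].
Proof.
move=> cA A0; have [V1 [V2 [c1 c2 V10 V20 [VA VI]]]] := clopen_split cA A0.
have [g [Gg gV sg]] := vig_disj c1 V10 c2 V20 VI.
exists g; split=> //; last by rewrite -VA.
move=> g1; case: V10 => x V1x; have : (V1 `&` V2) x.
  by split=> //; move: (gV x V1x); rewrite g1.
by rewrite VI.
Qed.

Definition fixes k W := forall x, W x -> k x = x.

Lemma fixes_image k W V x : fixes k W -> W `&` V = set0 -> im k V x -> ~ W x.
Proof.
move=> kW WV /imP[y Vy ->] Wky; have /hinj kyy := kW _ Wky.
have : (W `&` V) y by split=> //; rewrite -kyy.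
by rewrite WV.
Qed.

(** The fixed set of [k] is relocated into a prescribed [E] by conjugating with an element supported
    on [W] and [E]. Both are disjoint from [V] and from its image, so the conjugate still agrees
    with [k] on [V]. *)
Lemma move_fix k W V E : G k -> clopen W -> W !=set0 -> fixes k W ->
  clopen V -> W `&` V = set0 -> clopen E -> E !=set0 ->
  E `&` V = set0 -> E `&` im k V = set0 ->
  exists k' W', [/\ G k', clopen W', W' !=set0, W' `<=` E &
    fixes k' W' /\ forall x, V x -> k' x = k x].
Proof.
move=> Gk cW W0 kW cV WV cE E0 EV EkV.
have [B [cB B0 BW]] := clopen_shrink cW W0.
have [D [cD D0 DE]] := clopen_shrink cE E0.
have [d [Gd dB sd]] : exists d, [/\ G d, forall x, B x -> D (d x) & supp d (W `|` E)].
  apply: vig => //; first exact: clopenU.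
  - by apply: (properWS BW); exact: subsetUl.
  - by apply: (properWS DE); exact: subsetUr.
exists (k ^ d), (im d B); split.
- exact: sgJ.
- exact: im_clopen.
- exact: im_neq0.
- by move=> _ /imP[x Bx ->]; apply: DE.1; exact: dB.
split=> [_ /imP[x Bx ->]|x Vx]; first by rewrite hconj kW //; exact: BW.1.
have nWEx : ~ (W `|` E) x.
  by case=> [Wx|Ex]; [rewrite -[False]/(set0 x) -WV|rewrite -[False]/(set0 x) -EV].
rewrite hconjE (suppV sd) // sd //; case=> [|Ekx].
  by apply: (fixes_image kW WV); rewrite imE.
by rewrite -[False]/(set0 (k x)) -EkV; split=> //; rewrite imE.
Qed.

(* Simplicity enters here: the elements of G all of whose germs are germs of
   elements of G fixing a nonempty clopen set pointwise form a normal
   subgroup. *)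
Lemma germ_small g x : G g -> exists k W U,
  [/\ G k, clopen W /\ W !=set0, fixes k W, clopen U /\ U x &
      W `&` U = set0 /\ forall y, U y -> k y = g y].
Proof.
pose N := [set g | G g /\ forall x, exists k W,
  [/\ G k, clopen W, W !=set0, fixes k W &
      exists U, [/\ clopen U, U x & forall y, U y -> k y = g y]]].
suff NG : N = G.
  move=> Gg; have : N g by rewrite NG.
  case=> _ /(_ x)[k [W [Gk cW W0 kW [U [cU Ux kU]]]]].
  have [W' [cW' W'0 W'W nW'x]] := clopen_avoid1 x cW W0.
  exists k, W', (U `&` ~` W'); split=> //.
  - by move=> y /W'W; exact: kW.
  - by split=> //; exact: clopenD.
  by split=> [|y [/kU]//]; rewrite setIC -setIA setICl setI0.
have [g0 [Gg0 g01 [Wf [cWf Wf0 gWf]]]] :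
    exists g, [/\ G g, g <> 1 & exists W, [/\ clopen W, W !=set0 & fixes g W]].
  have [V1 [V2 [c1 c2 V10 V20 [VA VI]]]] :=
    clopen_split clopenT (ex_intro setT point I).
  have [g0 [Gg g1 sg]] := G_nontrivial c1 V10.
  exists g0; split=> //; exists V2; split=> // y V2y; apply: sg => V1y.
  by rewrite -[False]/(set0 y) -VI.
apply: (simple_normalE simG); last first.
  exists g0 => //; split=> // y.
  by exists g0, Wf; split=> //; exists setT; split=> //; exact: clopenT.
split; first 2 last.
- move=> h d [Gh Nh] Gd; split; first exact: sgJ.
  move=> y; have [k [W [Gk cW W0 kW [U [cU Ux kU]]]]] := Nh (d^-1 y).
  exists (k ^ d), (im d W); split.
  + exact: sgJ.
  + exact: im_clopen.
  + exact: im_neq0.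
  + by move=> _ /imP[z Wz ->]; rewrite hconj kW.
  + exists (im d U); split=> // [|z Uz]; first exact: im_clopen.
    by rewrite !hconjE kU.
- apply: subgroup_mk.
  + split; first exact: sg1.
    by move=> y; exists 1, setT; split=> //; [exact: sg1|exact: clopenT|exists y|exists setT; split=> //; exact: clopenT].
  + move=> g1' g2 [Gg1 Ng1] [Gg2 Ng2]; split; first exact: sgM.
    move=> y; have [k1 [W1 [Gk1 cW1 W10 kW1 [U1 [cU1 U1x kU1]]]]] := Ng1 y.
    have [k2 [W2 [Gk2 cW2 W20 kW2 [U2 [cU2 U2x kU2]]]]] := Ng2 (g1' y).
    (* For a product, the fixed set of the first factor is moved inside that of the second. As [W1']
       avoids y, and [W2''] avoids both y and [k1 y], a neighbourhood [V] of y can be kept clear of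
       them. *)
    have [W1' [cW1' W1'0 W1W nW1]] := clopen_avoid1 y cW1 W10.
    have [W2' [cW2' W2'0 W2W nW2]] := clopen_avoid1 y cW2 W20.
    have [W2'' [cW2'' W2''0 W2W' nW2']] := clopen_avoid1 (k1 y) cW2' W2'0.
    pose V := U1 `&` im k1^-1 U2 `&` ~` W1' `&` ~` W2'' `&` im k1^-1 (~` W2'').
    have imk z W : im k1^-1 W z = W (k1 z) by rewrite -[in LHS](hinvK k1 z) imE.
    have cV : clopen V.
      apply: clopenI; last by apply: im_clopen; exact: clopenC.
      do 2 (apply: clopenD => //).
      by apply: clopenI => //; exact: im_clopen.
    have Vy : V y.
      rewrite /V /= !imk; split=> //; split; last by move=> /W2W'.
      by split=> //; split=> //; rewrite kU1.
    have [k [W' [Gk cW' W'0 W'W [kW' kV]]]] :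
       exists k' W', [/\ G k', clopen W', W' !=set0, W' `<=` W2'' &
          fixes k' W' /\ forall x, V x -> k' x = k1 x].
      apply: (@move_fix _ W1') => //.
      * by move=> z /W1W; exact: kW1.
      * by apply/seteqP; split=> // z [W1z [[[_]]]].
      * by apply/seteqP; split=> // z [W2z [[_]]].
      * apply/seteqP; split=> // z [W2z /imP[z' [_ +] zE]].
        by rewrite imk -zE.
    exists (k * k2), W'; split=> //; first exact: sgM.
      by move=> z W'z; rewrite hmulE kW' // kW2 //; apply: W2W; apply: W2W'; exact: W'W.
    exists V; split=> // z Vz; rewrite !hmulE kV //.
    case: Vz => [[[[U1z +] _] _] _]; rewrite imk => U2z.
    by rewrite kU2 // kU1.
  + move=> h [Gh Nh]; split; first exact: sgV.
    move=> y; have [k [W [Gk cW W0 kW [U [cU Ux kU]]]]] := Nh (h^-1 y).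
    exists k^-1, W; split=> //; first exact: sgV.
      by move=> z Wz; apply: hinv_eq; exact: kW.
    exists (im k U); split=> //.
    * exact: im_clopen.
    * by rewrite -[y](hKinv h) -kU // imE.
    * move=> _ /imP[z Uz ->]; rewrite hinvK kU //.
      by rewrite hinvK.
- by move=> h [].
Qed.

(** The element [h] is the product of a conjugate of [d] and of [d^-1], which keeps its support
    small although that of [k] is not controlled. On [V] it equals [k], because [d] sends the image
    of [V] into [W], where [k^-1] does nothing. *)
Lemma fix_trick k W V : G k -> clopen W -> W !=set0 -> fixes k W ->
  clopen V -> W `&` V = set0 ->
  exists h, [/\ G h, forall x, V x -> h x = k x &
    supp h (V `|` im k V `|` W)].
Proof.
move=> Gk cW W0 kW cV WV.
have [V0|/set0P V0] := eqVneq V set0.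
  by exists 1; split=> //; [exact: sg1|rewrite V0].
have [|d [Gd dV sd]] := vig_disj (im_clopen k cV) (im_neq0 k V0) cW W0.
  by apply/seteqP; split=> // x [/(fixes_image kW WV) + Wx].
exists (k * d * k^-1 * d^-1); split.
- by do !apply: sgM => //; exact: sgV.
- move=> x Vx; rewrite !hmulE.
  have kdx : k^-1 (d (k x)) = d (k x).
    by apply: hinv_eq; rewrite kW //; apply: dV; rewrite imE.
  by rewrite kdx hinvK.
- move=> x nx; rewrite !hmulE (sd (k x)); last first.
    case=> [kVx|Wkx]; first by apply: nx; left; left; rewrite imE in kVx.
    by have /hinj kx := kW _ Wkx; apply: nx; right; rewrite -kx.
  rewrite hinvK (suppV sd) //.
  by case=> [kVx|Wx]; apply: nx; [left; right|right].
Qed.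

Definition full f := forall x, exists g U,
  [/\ G g, clopen U, U x & forall y, U y -> f y = g y].

Lemma G_full g : G g -> full g.
Proof. by move=> Gg x; exists g, setT; split=> //; exact: clopenT. Qed.

Lemma full_subgroup : subgroup full.
Proof.
apply: subgroup_mk.
- by apply: G_full; exact: sg1.
- move=> f g Ff Fg x; have [k [U [Gk cU Ux fU]]] := Ff x.
  have [k' [U' [Gk' cU' U'x fU']]] := Fg (f x).
  exists (k * k'), (U `&` im f^-1 U'); split=> //.
  + exact: sgM.
  + by apply: clopenI => //; exact: im_clopen.
  + by move=> y [Uy U'y]; rewrite !hmulE -fU // fU'.
- move=> f Ff x; have [k [U [Gk cU Ux fU]]] := Ff (f^-1 x).
  exists k^-1, (im f U); split=> //.
  + exact: sgV.
  + exact: im_clopen.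
  + by move=> _ /imP[y Uy ->]; rewrite hinvK fU // hinvK.
Qed.

(** The spare set [E] is arbitrary so that, when two pieces are combined, each can be given its own
    half of it. *)
Let approx f V := forall E, clopen E -> E !=set0 -> E `&` V = set0 ->
  E `&` im f V = set0 -> exists k, [/\ G k, forall x, V x -> k x = f x &
    supp k (V `|` im f V `|` E)].

Let approx_local f x : full f -> exists U, [/\ clopen U, U x &
   forall V, clopen V -> V `<=` U -> approx f V].
Proof.
move=> Ff; have [g [U0 [Gg cU0 U0x fU0]]] := Ff x.
have [k [W [U [Gk [cW W0] kW [cU Ux] [WU kU]]]]] := germ_small x Gg.
exists (U0 `&` U); split=> //; first exact: clopenI.
move=> V cV VU E cE E0 EV EfV.
have kV y : V y -> k y = f y by move=> /VU[U0y Uy]; rewrite kU // fU0.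
have fkV : im f V = im k V.
  by apply/seteqP; split=> _ /imP[y Vy ->]; [rewrite -kV|rewrite kV] => //; rewrite imE.
have WV : W `&` V = set0.
  by apply/seteqP; split=> // y [Wy /VU[_ Uy]]; rewrite -WU.
rewrite fkV in EfV.
have [k' [W' [Gk' cW' W'0 W'E [kW' kV']]]] := move_fix Gk cW W0 kW cV WV cE E0 EV EfV.
have [|h [Gh hV sh]] := fix_trick Gk' cW' W'0 kW' cV.
  by apply/seteqP; split=> // y [/W'E Ey Vy]; rewrite -EV.
exists h; split=> //.
- by move=> y Vy; rewrite hV // kV' // kV.
- apply: (suppW sh) => y [[Vy|/imP[z Vz ->]]|/W'E Ey]; [by left; left|left; right|by right].
  by rewrite kV' // kV // imE.
Qed.

(** Disjointness of [U] from its image lets the copies on two pieces be multiplied: neither copy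
    disturbs the piece of the other or its image. *)
Let approx_disj f U : full f -> clopen U -> U `&` im f U = set0 -> approx f U.
Proof.
move=> Ff cU UfU.
have nUf y z : U y -> U z -> f y <> z.
  by move=> Uy Uz fyz; rewrite -[False]/(set0 z) -UfU; split=> //; rewrite -fyz imE.
apply: (clopen_ind cU).
- by move=> E _ _ _ _; exists 1; split=> //; exact: sg1.
- move=> V W cV cW VU WU VW aV aW E cE E0 EVW EfVW.
  have [E1 [E2 [c1 c2 E10 E20 [EE EI]]]] := clopen_split cE E0.
  have nE y : E y -> (V `|` W) y -> False by move=> ? ?; rewrite -[False]/(set0 y) -EVW.
  have nfE y : E y -> im f (V `|` W) y -> False by move=> ? ?; rewrite -[False]/(set0 y) -EfVW.
  have nEE y : E1 y -> E2 y -> False by move=> ? ?; rewrite -[False]/(set0 y) -EI.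
  have nVW y : V y -> W y -> False by move=> ? ?; rewrite -[False]/(set0 y) -VW.
  have E1E y : E1 y -> E y by rewrite -EE; left.
  have E2E y : E2 y -> E y by rewrite -EE; right.
  have [||k1 [Gk1 kV1 sk1]] := aV E1 c1 E10.
  + by apply/seteqP; split=> // y [/E1E Ey Vy]; apply: (nE y) => //; left.
  + by apply/seteqP; split=> // y [/E1E Ey Vy]; apply: (nfE y) => //; left.
  have [||k2 [Gk2 kV2 sk2]] := aW E2 c2 E20.
  + by apply/seteqP; split=> // y [/E2E Ey Vy]; apply: (nE y) => //; right.
  + by apply/seteqP; split=> // y [/E2E Ey Vy]; apply: (nfE y) => //; right.
  exists (k1 * k2); split; first exact: sgM.
  + move=> x [Vx|Wx]; rewrite hmulE.
      rewrite kV1 // sk2 // => -[[Wfx|Wfx]|/E2E Ex].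
      * by apply: (@nUf x (f x)) => //; [exact: VU|exact: WU].
      * by rewrite imE in Wfx; exact: (nVW x).
      * by apply: (nfE (f x)) => //; rewrite imE; left.
    rewrite (sk1 x) ?kV2 // => -[[Vx|/imP[y Vy xE]]|/E1E Ex].
    * exact: (nVW x).
    * by apply: (@nUf y x) => //; [exact: VU|exact: WU].
    * by apply: (nE x) => //; right.
  + apply: suppM; [apply: (suppW sk1)|apply: (suppW sk2)].
      by move=> y [[Vy|Vy]|/E1E Ey]; [left; left; left|left; right; left|right].
    by move=> y [[Vy|Vy]|/E2E Ey]; [left; left; right|left; right; right|right].
- move=> x Ux; have [V [cV Vx aV]] := approx_local x Ff.
  by exists V; split=> // W cW WV _; exact: aV.
Qed.

(** To reduce to [approx_disj] when [U] meets its image, pass through [E]: push [U] into one half of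
    [E], then copy the element leading from there to the image of [U], with the other half as spare
    room. *)
Lemma full_approx f U E : full f -> clopen U -> clopen E -> E !=set0 ->
  E `&` U = set0 -> E `&` im f U = set0 ->
  exists k, [/\ G k, forall x, U x -> k x = f x & supp k (U `|` im f U `|` E)].
Proof.
move=> Ff cU cE E0 EU EfU.
have [U0|/set0P U0] := eqVneq U set0.
  by exists 1; split=> //; [exact: sg1|rewrite U0].
have [E1 [E2 [c1 c2 E10 E20 [EE EI]]]] := clopen_split cE E0.
have nEE y : E1 y -> E2 y -> False by move=> ? ?; rewrite -[False]/(set0 y) -EI.
have E1E y : E1 y -> E y by rewrite -EE; left.
have E2E y : E2 y -> E y by rewrite -EE; right.
have [|v [Gv vU sv]] := vig_disj cU U0 c1 E10.
  by apply/seteqP; split=> // y [Uy /E1E Ey]; rewrite -EU.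
pose f2 := v^-1 * f.
have Ff2 : full f2.
  by apply: (sgM full_subgroup) => //; apply: G_full; exact: sgV.
have f2U : im f2 (im v U) = im f U by rewrite -imM /f2 mulVKg.
have [//|||k [Gk kU sk]] := approx_disj Ff2 (im_clopen v cU) _ c2 E20.
- rewrite f2U; apply/seteqP; split=> // _ [/imP[x Ux ->] fUx].
  by rewrite -EfU; split=> //; apply: E1E; exact: vU.
- by apply/seteqP; split=> // _ [/[swap]/imP[x Ux ->]]; apply: nEE; exact: vU.
- by rewrite f2U; apply/seteqP; split=> // x [/E2E Ex fUx]; rewrite -EfU.
exists (v * k); split; first exact: sgM.
- by move=> x Ux; rewrite hmulE kU ?imE // /f2 hmulE hinvK.
- apply: suppM; [apply: (suppW sv) => x [Ux|/E1E Ex]; [by left; left|by right]|].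
  apply: (suppW sk); rewrite f2U => x [[/imP[y Uy ->]|fUx]|/E2E Ex].
  + by right; apply: E1E; exact: vU.
  + by left; right.
  + by right.
Qed.

(** Copy [f] and [g] by elements of [G] whose excess supports [E1] and [E2] are disjoint parts of
    the complement of [L]. The copies preserve [L], and outside [L] their supports are disjoint and
    so contribute nothing to the commutator. *)
Lemma full_comm f g L : full f -> full g -> clopen L -> (~` L) !=set0 ->
  supp f L -> supp g L -> G [~ f, g].
Proof.
move=> Ff Fg cL L0 sf sg.
have [E1 [E2 [c1 c2 E10 E20 [EE EI]]]] := clopen_split (clopenC setT cL) L0.
have nEE y : E1 y -> E2 y -> False by move=> ? ?; rewrite -[False]/(set0 y) -EI.
have E1L y : E1 y -> ~ L y by move=> E1y; rewrite -[~ _]/((~` L) y) -EE; left.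
have E2L y : E2 y -> ~ L y by move=> E2y; rewrite -[~ _]/((~` L) y) -EE; right.
have aux h E : full h -> supp h L -> clopen E -> E !=set0 -> (forall y, E y -> ~ L y) ->
    exists k, [/\ G k, forall x, L x -> k x = h x & supp k (L `|` E)].
  move=> Fh sh cE E0 EL; have [||k [Gk kL sk]] := full_approx Fh cL cE E0.
  - by apply/seteqP; split=> // y [/EL].
  - by rewrite (supp_im sh); apply/seteqP; split=> // y [/EL].
  exists k; split=> //; apply: (suppW sk); rewrite (supp_im sh).
  by move=> y [[]|]; [left|left|right].
have [k1 [Gk1 kL1 sk1]] := aux f E1 Ff sf c1 E10 E1L.
have [k2 [Gk2 kL2 sk2]] := aux g E2 Fg sg c2 E20 E2L.
suff -> : [~ f, g] = [~ k1, k2] by exact: sgR.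
apply: homeo_ext => x.
have kV k h : (forall x, L x -> k x = h x) -> supp h L -> forall x, L x -> k^-1 x = h^-1 x.
  move=> kh sh y Ly; apply: hinv_eq; rewrite kh ?hKinv //.
  by apply/(supp_stable _ (suppV sh)).
have [Lx|nLx] := pselect (L x).
  have Lf := supp_stable _ (suppV sf); have Lg := supp_stable _ (suppV sg).
  have L1 : L (f^-1 x) by apply/Lf.
  have L2 : L (g^-1 (f^-1 x)) by apply/Lg.
  have L3 : L (f (g^-1 (f^-1 x))) by apply/(supp_stable _ sf).
  by rewrite !hcommE (kV _ _ kL1 sf) // (kV _ _ kL2 sg) // (kL1 _ L2) kL2.
rewrite (suppR sf sg) // commgEl hmulE; symmetry.
have LE1 z : L z -> k1 z = f z by exact: kL1.
rewrite hconjE; have [E1x|nE1x] := pselect (E1 x).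
  have nE2 z : E1 z -> ~ (L `|` E2) z by move=> E1z [/(E1L z E1z)|/(nEE z E1z)].
  have E1k z : ~ L z -> E1 z -> E1 (k1^-1 z).
    move=> nLz E1z; have : (L `|` E1) (k1^-1 z).
      by apply/(supp_stable _ (suppV sk1)); right.
    case=> // Lz'; case: nLz; rewrite -[z](hKinv k1) kL1 //.
    exact/(supp_stable _ sf).
  by rewrite (suppV sk2) ?hKinv ?sk2 //; apply: nE2 => //; exact: E1k.
have nx1 : ~ (L `|` E1) x by case.
rewrite (suppV sk1) //.
have nx2 : ~ (L `|` E1) (k2^-1 x).
  have [E2x|nE2x] := pselect (E2 x); last by rewrite (suppV sk2) // => -[].
  have : (L `|` E2) (k2^-1 x) by apply/(supp_stable _ (suppV sk2)); right.
  case=> [Lz|E2z].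
    case: nLx; rewrite -[x](hKinv k2) kL2 //.
    exact/(supp_stable _ sg).
  by case=> [/(E2L _ E2z)|/nEE]; last exact.
by rewrite sk1 // hKinv.
Qed.

End FullGroup.

(** * Cycles of clopen sets *)

Lemma disE (U V : set C) x : U `&` V = set0 -> U x -> V x -> False.
Proof. by move=> UV Ux Vx; rewrite -[False]/(set0 x) -UV. Qed.

Lemma disE2 (U V : set C) x : U `&` V = set0 -> V x -> U x -> False.
Proof. by move=> UV Vx Ux; exact: disE UV Ux Vx. Qed.

Lemma disI (U V : set C) : (forall x, U x -> V x -> False) -> U `&` V = set0.
Proof. by move=> UV; apply/seteqP; split=> // x [/UV]. Qed.

Lemma disS (U U' V V' : set C) : U' `&` V' = set0 -> U `<=` U' -> V `<=` V' ->
  U `&` V = set0.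
Proof. by move=> UV UU VV; apply: disI => x /UU ? /VV; exact: disE UV _. Qed.

Lemma dis_im f (U V : set C) : U `&` V = set0 -> im f U `&` im f V = set0.
Proof. by move=> UV; apply: disI => _ /imP[x Ux ->]; rewrite imE; exact: disE UV _. Qed.

Lemma local_homeo (f f' : C -> C) : cancel f f' -> cancel f' f ->
  (forall x, exists (g : homeo C) (U : set C),
    [/\ clopen U, U x & forall y, U y -> f y = g y]) ->
  exists h : homeo C, forall x, h x = f x.
Proof.
move=> fK f'K floc.
have cf : continuous f.
  move=> x; have [g [U [cU Ux fU]]] := floc x.
  move=> A; rewrite /= fU // => /(@homeo_cts _ g x) gA.
  have nU : nbhs x U by apply: open_nbhs_nbhs; split=> //; exact: cU.1.
  by apply: filterS2 nU gA => y Uy /=; rewrite fU.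
have cf' : continuous f'.
  move=> x; have [g [U [cU Ux fU]]] := floc (f' x).
  have gx : g^-1 x = f' x by apply: hinv_eq; rewrite -fU // f'K.
  move=> A /=; rewrite -gx => /(@homeo_cts _ g^-1 x) gA.
  have nU : nbhs x (im g U).
    apply: open_nbhs_nbhs; split; first exact: (im_clopen g cU).1.
    by rewrite -[x](hKinv g) imE gx.
  apply: filterS2 nU gA => _ /imP[y Uy ->]; rewrite /= /preimage /=.
  by rewrite -{2}fU // fK => Agy; rewrite -[y](hinvK g).
by exists (Homeo fK f'K cf cf').
Qed.

(** Take the successive differences of a strictly decreasing chain of clopen sets. *)
Lemma spots Q : clopen Q -> Q !=set0 -> exists S : nat -> set C,
  (forall i, [/\ clopen (S i), S i !=set0 & S i `<=` Q]) /\
  (forall i j, i != j -> S i `&` S j = set0).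
Proof.
move=> cQ Q0.
have /choice [V HV] : forall U : set C, exists V : set C, clopen U -> U !=set0 ->
    [/\ clopen V, V !=set0 & V `<` U].
  move=> U; have [cU|] := pselect (clopen U); last by exists set0.
  have [U0|] := pselect (U !=set0); last by exists set0.
  by have [V ?] := clopen_shrink cU U0; exists V.
pose T n := iter n V Q.
have HT n : clopen (T n) /\ T n !=set0.
  by elim: n => [|n [cT T0]] //; have [] := HV _ cT T0.
have TS n : T n.+1 `<` T n by have [cT T0] := HT n; have [] := HV _ cT T0.
have TD n d : T (n + d)%N `<=` T n.
  elim: d => [|d IH]; first by rewrite addn0.
  by rewrite addnS; apply: subset_trans IH; exact: (TS _).1.
exists (fun i => T i `&` ~` T i.+1); split=> [i|].
  have [c1 _] := HT i; have [c2 _] := HT i.+1.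
  split; first exact: clopenD.
    have [_ nT] := TS i; apply: contrapT => H; apply: nT => x Tx.
    by apply: contrapT => nx; apply: H; exists x.
  by move=> x [Tx _]; exact: (TD 0%N i).
suff H i j : (i < j)%N -> (T i `&` ~` T i.+1) `&` (T j `&` ~` T j.+1) = set0.
  by move=> i j; rewrite neq_ltn => /orP[/H//|/H]; rewrite setIC.
move=> ij; apply: disI => x [_ nT] [Tj _]; apply: nT.
by move: Tj; rewrite -(subnKC ij); exact: TD.
Qed.

Definition is_swap (U : set C) (g s : homeo C) :=
  [/\ forall x, U x -> s x = g x, forall x, U x -> s (g x) = x &
      supp s (U `|` im g U)].

Lemma is_swap_uniq U U' g g' s s' : is_swap U g s -> is_swap U' g' s' ->
  U = U' -> (forall x, U x -> g x = g' x) -> s = s'.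
Proof.
move=> [s1 s2 s3] [s1' s2' s3'] UU; subst U' => gg.
apply: homeo_ext => x; have [Ux|nUx] := pselect (U x); first by rewrite s1 // s1' // gg.
have [/imP[y Uy ->]|ngx] := pselect (im g U x); first by rewrite s2 // gg // s2'.
rewrite s3 ?s3' //; last by case.
case=> // /imP[y Uy xE]; apply: ngx; rewrite xE -gg // imE //.
Qed.

Lemma is_swapJ U g s h : is_swap U g s -> is_swap (im h U) (g ^ h) (s ^ h).
Proof.
move=> [s1 s2 s3]; split.
- by move=> _ /imP[x Ux ->]; rewrite !hconj s1.
- by move=> _ /imP[x Ux ->]; rewrite !hconj s2.
- have -> : im (g ^ h) (im h U) = im h (im g U).
    by rewrite -!imM; congr (im _ U); rewrite conjgE mulVKg.
  by rewrite -imU; exact: suppJ.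
Qed.

Lemma is_swap_inv U g s : is_swap U g s -> s^-1 = s.
Proof.
move=> [s1 s2 s3]; apply: homeo_ext => x; apply: hinv_eq.
have [Ux|nUx] := pselect (U x); first by rewrite (s1 x Ux) s2.
have [/imP[y Uy ->]|ngx] := pselect (im g U x); first by rewrite (s2 y Uy) s1.
have sx : s x = x by apply: s3; case.
by rewrite !sx.
Qed.

Definition tokens (gam : nat -> homeo C) (U : set C) (m : nat) : set C :=
  [set x | exists i, (i < m)%N /\ im (gam i) U x].

Definition is_cyc (gam : nat -> homeo C) (U : set C) (m : nat) (c : homeo C) :=
  [/\ forall i x, (i.+1 < m)%N -> U x -> c (gam i x) = gam i.+1 x,
      forall x, U x -> c (gam m.-1 x) = x & supp c (tokens gam U m)].

Section Cycles.
Variables (gam : nat -> homeo C) (U : set C).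
Hypothesis gam0 : gam 0%N = 1.

Lemma cyc_pow m c i x : is_cyc gam U m c -> (i < m)%N -> U x ->
  (c ^+ i) x = gam i x.
Proof.
move=> [c1 _ _] + Ux; elim: i => [|i IH] im; first by rewrite gam0.
by rewrite hexpS IH ?c1 //; exact: ltnW.
Qed.

Lemma cyc_powm m c : (0 < m)%N -> is_cyc gam U m c -> c ^+ m = 1.
Proof.
move=> m0 cc; apply: homeo_ext => x; rewrite hone.
have [c1 c2 c3] := cc.
have cm y : U y -> (c ^+ m) y = y.
  by move=> Uy; rewrite -(prednK m0) hexpS (cyc_pow cc) ?c2 // prednK.
have [[i [im /imP[y Uy ->]]]|nx] := pselect (tokens gam U m x).
  by rewrite -(cyc_pow cc) // -hexpD addnC hexpD cm.
by rewrite (suppX m c3).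
Qed.

Lemma cyc1 : is_cyc gam U 1 1.
Proof. by split=> // x Ux; rewrite gam0. Qed.

(** As the left factor acts first, multiplying by the exchange of copy 0 with copy m+1 inserts the
    new copy between the last one and copy 0. *)
Lemma cyc_step m c s :
  (forall i j, (i < m.+2)%N -> (j < m.+2)%N -> i != j ->
     im (gam i) U `&` im (gam j) U = set0) ->
  is_cyc gam U m.+1 c -> is_swap U (gam m.+1) s -> is_cyc gam U m.+2 (c * s).
Proof.
move=> dis [c1 c2 c3] [s1 s2 s3].
have g0U : im (gam 0%N) U = U by rewrite gam0.
have sfix i x : (0 < i <= m)%N -> U x -> s (gam i x) = gam i x.
  move=> /andP[i0 lim] Ux; apply: s3 => -[Ugx|].
    have D : U `&` im (gam i) U = set0 by rewrite -{1}g0U; apply: dis => //; lia.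
    by apply: (disE D Ugx); rewrite imE.
  by apply: (disE (dis i m.+1 _ _ _)); rewrite ?imE //; lia.
split=> [i x im Ux|x Ux|]; rewrite ?hmulE.
- have [im'|im'] := ltnP i.+1 m.+1.
    by rewrite c1 // sfix.
  have -> : i = m by lia.
  by rewrite c2 // s1.
- rewrite (c3 (gam m.+1 x)) ?s2 //= => -[i [im]].
  by apply: (disE (dis m.+1 i _ _ _)); rewrite ?imE //; lia.
- apply: suppM.
    by apply: (suppW c3) => x [i [im gx]]; exists i; split=> //; exact: ltnW.
  apply: (suppW s3) => x [Ux|gx]; last by exists m.+1.
  by exists 0%N; rewrite gam0.
Qed.

Lemma cyc_ex (S : set (homeo C)) m : subgroup S -> (0 < m)%N ->
  (forall i j, (i < m)%N -> (j < m)%N -> i != j ->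
     im (gam i) U `&` im (gam j) U = set0) ->
  (forall i, (0 < i < m)%N -> exists2 s, S s & is_swap U (gam i) s) ->
  exists2 c, S c & is_cyc gam U m c.
Proof.
move=> sS; elim: m => // -[|m] IH _ dis Ssw.
  by exists 1; [exact: sg1|exact: cyc1].
have [//|i j im jm|i /andP[i0 im]|c Sc cc] := IH.
- by apply: dis; exact: ltnW.
- by apply: Ssw; rewrite i0 ltnW.
have [s Ss ss] : exists2 s, S s & is_swap U (gam m.+1) s by apply: Ssw; rewrite ltnSn.
by exists (c * s); [exact: sgM|exact: cyc_step].
Qed.

End Cycles.

(** * Swaps of clopen sets and the products of them that lie in the group *)

Section Swaps.
Variable G : set (homeo C).
Hypothesis sG : subgroup G.
Hypothesis simG : simple_group G.
Hypothesis vigG : vigorous G.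
Implicit Types (f g h k s : homeo C) (A B U V W L E K Z : set C) (x y : C).

Let full := full G.
Let sF : subgroup full := full_subgroup sG.

Lemma swap_ex U g : full g -> clopen U -> U `&` im g U = set0 ->
  exists2 s, full s & is_swap U g s.
Proof.
move=> Fg cU UgU.
pose f x := if `[< U x >] then g x else if `[< im g U x >] then g^-1 x else x.
have fU x : U x -> f x = g x by move=> Ux; rewrite /f asboolT.
have fgU x : im g U x -> f x = g^-1 x.
  by move=> gUx; rewrite /f asboolF ?asboolT // => /(disE UgU); exact.
have fn x : ~ (U `|` im g U) x -> f x = x.
  by move=> nx; rewrite /f !asboolF // => ?; apply: nx; [right|left].
have fK : cancel f f.
  move=> x; have [Ux|nUx] := pselect (U x).
    by rewrite (fU x) // fgU ?imE // hinvK.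
  have [gUx|ngUx] := pselect (im g U x).
    by rewrite (fgU x) // fU ?hKinv.
  by rewrite !(fn x) //; case.
have floc x : exists g U, [/\ G g, clopen U, U x & forall y, U y -> f y = g y].
  have [Ux|nUx] := pselect (U x).
    have [k [V [Gk cV Vx gk]]] := Fg x.
    exists k, (V `&` U); split=> //; first exact: clopenI.
    by move=> y [Vy Uy]; rewrite fU // gk.
  have [gUx|ngUx] := pselect (im g U x).
    have [k [V [Gk cV Vx gk]]] := sgV sF Fg x.
    exists k, (V `&` im g U); split=> //; first by apply: clopenI => //; exact: im_clopen.
    by move=> y [Vy Uy]; rewrite fgU // gk.
  exists 1, (~` (U `|` im g U)); split.
  - exact: sg1.
  - by apply: (clopenC setT); apply: clopenU => //; exact: im_clopen.
  - by case.
  - by move=> y; exact: fn.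
have [x|s sf] := local_homeo fK fK.
  by have [k [V [? ? ? ?]]] := floc x; exists k, V.
exists s.
  move=> x; have [k [V [Gk cV Vx gk]]] := floc x; exists k, V; split=> // y Vy.
  by rewrite sf gk.
split=> x; rewrite ?sf.
- exact: fU.
- by move=> Ux; rewrite fgU ?imE // hinvK.
- exact: fn.
Qed.

(* The product of two disjoint transpositions is a commutator, since
   conjugation exchanges them. *)
Lemma double_swap U al be ga s s' : full al -> full be -> full ga -> clopen U ->
  U `&` im al U = set0 -> U `&` im be U = set0 -> U `&` im ga U = set0 ->
  im al U `&` im be U = set0 -> im al U `&` im ga U = set0 ->
  im be U `&` im ga U = set0 ->
  ~` (U `|` im al U `|` im be U `|` im ga U) !=set0 ->
  full s -> is_swap U al s -> is_swap (im be U) (be^-1 * ga) s' -> G (s * s').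
Proof.
move=> Fa Fb Fg cU d1a d1b d1g dab dag dbg L0 Fs ss ss'.
have cI := im_clopen.
have [p1 Fp1 [p11 p12 p13]] := swap_ex Fb cU d1b.
have iag : im (al^-1 * ga) (im al U) = im ga U by rewrite -imM mulVKg.
have Fag : full (al^-1 * ga) by apply: (sgM sF) => //; exact: (sgV sF).
have [|p2 Fp2 [p21 p22 p23]] := swap_ex Fag (cI al _ cU); first by rewrite iag.
rewrite iag in p23.
pose p := p1 * p2.
have pU x : U x -> p x = be x.
  move=> Ux; rewrite hmulE p11 // p23 // => -[ax|gx].
    by apply: (disE dab ax); rewrite imE.
  by apply: (disE2 dbg gx); rewrite imE.
have paU x : U x -> p (al x) = ga x.
  move=> Ux; rewrite hmulE p13; first by rewrite p21 ?imE // hmulE hinvK.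
  case=> [ax|bx]; first by apply: (disE d1a ax); rewrite imE.
  by apply: (disE2 dab bx); rewrite imE.
suff -> : s' = s ^ p.
  rewrite -{1}(is_swap_inv ss) -commgEl.
  pose L := U `|` im al U `|` im be U `|` im ga U.
  apply: (@full_comm G sG simG vigG s p L) => //.
  - exact: (sgM sF).
  - by do !apply: clopenU => //; exact: cI.
  - by case: ss => _ _ h; apply: (suppW h) => x [?|?]; left; left; [left|right].
  - apply: suppM; [apply: (suppW p13)|apply: (suppW p23)] => x [?|?].
    + by left; left; left.
    + by left; right.
    + by left; left; right.
    + by right.
apply: (is_swap_uniq ss' (is_swapJ p ss)).
  by apply/seteqP; split=> _ /imP[y Uy ->]; [rewrite -pU|rewrite pU] => //; rewrite imE.
move=> _ /imP[y Uy ->]; rewrite hmulE hinvK.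
by rewrite -(pU y) // hconj paU.
Qed.

(** Exchanging a set made of two copies exchanges the two halves separately, hence is a product of
    two disjoint swaps. *)
Lemma even_swap U g k s : full g -> full k -> clopen U -> U `&` im g U = set0 ->
  (U `|` im g U) `&` im k (U `|` im g U) = set0 ->
  ~` ((U `|` im g U) `|` im k (U `|` im g U)) !=set0 ->
  is_swap (U `|` im g U) k s -> G s.
Proof.
move=> Fg Fk cU UgU; rewrite imU => XkX L0 sX.
have d1 : U `&` im k U = set0 by apply: (disS XkX) => ?; left.
have d2 : im g U `&` im k (im g U) = set0 by apply: (disS XkX) => ?; right.
have d3 : U `&` im k (im g U) = set0 by apply: (disS XkX) => ?; [left|right].
have d4 : im g U `&` im k U = set0 by apply: (disS XkX) => ?; [right|left].
have d5 : im k U `&` im k (im g U) = set0 by exact: dis_im.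
have [s1 Fs1 ss1] := swap_ex Fk cU d1.
have [s2 Fs2 ss2] := swap_ex Fk (im_clopen g cU) d2.
suff -> : s = s1 * s2.
  apply: (@double_swap U k g (g * k)) => //; rewrite ?imM ?mulKg //.
  - exact: (sgM sF).
  - by rewrite setIC.
  - case: L0 => x nx; exists x => -[[[Ux|Ux]|Ux]|Ux]; apply: nx.
    + by left; left.
    + by right; left.
    + by left; right.
    + by right; right.
case: ss1 ss2 sX => [a1 a2 a3] [b1 b2 b3] [c1 c2 c3].
apply: homeo_ext => x; rewrite hmulE.
have [Ux|nUx] := pselect (U x).
  rewrite c1 ?a1 ?b3 //; [|by left].
  by case=> kx; [apply: (disE d4 kx)|apply: (disE2 d5 kx)]; rewrite imE.
have [gUx|ngUx] := pselect (im g U x).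
  by rewrite c1 ?a3 ?b1 //; [case=> // /(disE d4 gUx)|right].
have [/imP[y Uy xE]|nkU] := pselect (im k U x).
  rewrite xE c2 ?a2 ?b3 //; [|by left].
  by case=> gy; [apply: (disE UgU Uy gy)|apply: (disE d3 Uy gy)].
have [/imP[y gUy xE]|nkgU] := pselect (im k (im g U) x).
  by rewrite xE c2 ?a3 ?b2 //; [case=> kx; [apply: (disE d3 kx)|apply: (disE d5 kx)]; rewrite -?xE -?xE ?imE // xE imE|right].
by rewrite c3 ?a3 ?b3 //; [case|case|case=> -[]].
Qed.

End Swaps.

(** * The local subgroups of a vigorous simple group *)

Section LocalGroups.
Variable G : set (homeo C).
Hypothesis sG : subgroup G.
Hypothesis simG : simple_group G.
Hypothesis vigG : vigorous G.
Implicit Types (f g h k s : homeo C) (A B U V W L E K Z : set C) (x y : C).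

Let full := full G.
Let sF : subgroup full := full_subgroup sG.

(** A single n-cycle of copies of [R] may be odd, so that nothing puts it in [G]. A second, disjoint
    n-cycle inside [Q] is built alongside, and at each stage the two new transpositions together
    form an element of [G]. *)
Lemma torsion_mover R Q n : clopen R -> R !=set0 -> clopen Q -> Q !=set0 ->
  R `&` Q = set0 -> ~` (R `|` Q) !=set0 -> (0 < n)%N ->
  exists b, [/\ G b, supp b (R `|` Q), b ^+ n = 1 &
    forall x j, R x -> (0 < j < n)%N -> Q ((b ^+ j) x)].
Proof.
move=> cR R0 cQ Q0 RQ L0 n0.
have [S [S1 S2]] := spots cQ Q0.
have RT : R `<` setT by split=> // H; case: L0 => x nx; apply: nx; left; exact: H.
have QT : Q `<` setT by split=> // H; case: L0 => x nx; apply: nx; right; exact: H.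
have /choice [gam0 Hgam] : forall i, exists g, [/\ G g, forall x, R x -> S i (g x) & supp g setT].
  move=> i; have [cS Si0 SQ] := S1 i.
  by apply: vig => //; [exact: clopenT|split=> // H; apply: QT.2 => x _; apply: SQ; exact: H].
pose gam i := if i is i'.+1 then gam0 i' else 1.
have Fgam i : full (gam i).
  by case: i => [|i]; apply: (G_full (G:=G)); [exact: sg1|case: (Hgam i)].
have gamS i : im (gam i.+1) R `<=` S i.
  by move=> _ /imP[x Rx ->]; case: (Hgam i) => _ + _; apply.
have gamRQ i : im (gam i) R `<=` R `|` Q.
  case: i => [|i]; first by move=> x Rx; left.
  by move=> x /gamS; case: (S1 i) => _ _ SQ /SQ; right.
have gdis i j : i != j -> im (gam i) R `&` im (gam j) R = set0.
  wlog ij : i j / (i < j)%N => [H|_].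
    by rewrite neq_ltn => /orP[ij|ij]; [|rewrite setIC]; apply: H; rewrite // ltn_eqF.
  case: j ij => // j; case: i => [|i] ij.
    by apply: (disS RQ) => // x /gamS; case: (S1 j) => _ _; apply.
  by apply: (disS (S2 i j _)); [rewrite ltn_eqF|exact: gamS|exact: gamS].
(* The two cycles use the copies 0 to n-1 and n to 2n-1. *)
pose U := im (gam n) R.
pose gam' i := (gam n)^-1 * gam (n + i)%N.
have gam'U i : im (gam' i) U = im (gam (n + i)%N) R by rewrite -imM mulVKg.
have Fgam' i : full (gam' i) by apply: (sgM sF) => //; exact: (sgV sF).
have sw i j : i != j -> exists2 s, full s & is_swap (im (gam i) R) ((gam i)^-1 * gam j) s.
  move=> ij; apply: (swap_ex sG) => //.
  - by apply: (sgM sF) => //; exact: (sgV sF).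
  - exact: im_clopen.
  - by rewrite -imM mulVKg; exact: gdis.
pose cyc2 m c c' := [/\ full c, full c', is_cyc gam R m c, is_cyc gam' U m c' & G (c * c')].
have nL x : ~ (R `|` Q) x -> forall a b d, ~ (R `|` im (gam a) R `|` im (gam b) R `|` im (gam d) R) x.
  move=> nx a b d [[[|]|]|]; [by move=> Rx; apply: nx; left|..]; by move=> /gamRQ.
suff [b [b' [Fb Fb' cb cb' Gbb]]] : exists c c', cyc2 n c c'.
  have sb : supp b (R `|` Q).
    by case: cb => _ _ h; apply: (suppW h) => x [i [_ /gamRQ]].
  have sb' : supp b' (R `|` Q).
    by case: cb' => _ _ h; apply: (suppW h) => x [i [_]]; rewrite gam'U => /gamRQ.
  have bb : commute b b'.
    case: cb => _ _ h; case: cb' => _ _ h'; apply: (supp_commute h h').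
    move=> x [[i [li gx]] [j [lj]]]; rewrite gam'U => gx'.
    by apply: (disE (gdis i (n + j)%N _) gx gx'); rewrite ltn_eqF // ltn_addr.
  exists (b * b'); split=> //.
  - exact: suppM.
  - by rewrite expgMn // (cyc_powm _ n0 cb) // (cyc_powm _ n0 cb') ?mulg1 // /gam' addn0 mulVg.
  - move=> x j Rx /andP[j0 jn]; rewrite expgMn // hmulE (cyc_pow _ cb) //.
    have gx : im (gam j) R (gam j x) by rewrite imE.
    rewrite (suppX j (L:=tokens gam' U n)).
    + case: j j0 jn gx => // j _ _ /gamS; case: (S1 j) => _ _; exact.
    + by case: cb'.
    + move=> [i [li]]; rewrite gam'U => gx'.
      by apply: (disE (gdis j (n + i)%N _) gx gx'); rewrite ltn_eqF // ltn_addr.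
suff H m : (m < n)%N -> exists c c', cyc2 m.+1 c c'.
  by have [|c [c']] := H n.-1; rewrite prednK // => Hc; exists c, c'.
elim: m => [|m IH] mn.
  exists 1, 1; split; first [exact: (sg1 sF) | by rewrite mulg1; exact: sg1 | exact: cyc1 | idtac].
  by apply: cyc1; rewrite /gam' addn0 mulVg.
have [c [c' [Fc Fc' cc cc' Gcc]]] := IH (ltnW mn).
have [s Fs ss] := sw 0%N m.+1 isT.
have [s' Fs' ss'] : exists2 s, full s & is_swap U (gam' m.+1) s.
  by apply: sw; rewrite ltn_eqF // addnS ltnS leq_addr.
rewrite /= invg1 mul1g im1 in ss.
exists (c * s), (c' * s'); split.
- exact: (sgM sF).
- exact: (sgM sF).
- by apply: cyc_step => // i j _ _; exact: gdis.
- apply: cyc_step => //; first by rewrite /gam' addn0 mulVg.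
  by move=> i j _ _ ij; rewrite !gam'U; apply: gdis; rewrite eqn_add2l.
have sc : commute s c'.
  case: ss => _ _ h; case: cc' => _ _ h'; apply: (supp_commute h h').
  move=> x [[Rx|gx] [i [li]]]; rewrite gam'U => gx'.
    by apply: (disE (gdis 0%N (n + i)%N _) _ gx') => //=; rewrite ltn_eqF //; lia.
  by apply: (disE (gdis m.+1 (n + i)%N _) gx gx'); rewrite ltn_eqF //; lia.
rewrite mulgA -[c * s * c']mulgA sc mulgA -mulgA.
apply: sgM => //.
have d0 i : (0 < i)%N -> R `&` im (gam i) R = set0.
  by move=> i0; apply: (gdis 0%N i); rewrite ltn_eqF.
apply: (@double_swap G sG simG vigG R (gam m.+1) (gam n) (gam (n + m.+1)%N)) => //.
- exact: (Fgam m.+1).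
- exact: Fgam.
- exact: Fgam.
- exact: d0.
- exact: d0.
- by apply: d0; rewrite addnS.
- by apply: gdis; rewrite ltn_eqF.
- by apply: gdis; rewrite ltn_eqF //; lia.
- by apply: gdis; rewrite ltn_eqF //; lia.
- by case: L0 => x nx; exists x; exact: nL.
Qed.

(* For [K] the whole space this is [G] itself; for smaller clopen [K] it plays
   the role of [G] inside [K]. *)
Definition D K : set (homeo C) := generated [set c | exists f g L,
  [/\ full f, full g, clopen L /\ L `<` K, supp f L /\ supp g L & c = [~ f, g]]].

Lemma D_subgroup K : subgroup (D K).
Proof. exact: generated_subgroup. Qed.

Lemma D_comm K L f g : full f -> full g -> clopen L -> L `<` K ->
  supp f L -> supp g L -> D K [~ f, g].
Proof. by move=> *; apply: sub_generated; exists f, g, L. Qed.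

Lemma D_mono K K' : K `<=` K' -> D K `<=` D K'.
Proof.
move=> KK; apply: generated_min; first exact: D_subgroup.
move=> _ [f [g [L [Ff Fg [cL LK] [sf sg] ->]]]].
by apply: (@D_comm K' L) => //; exact: properWS LK KK.
Qed.

Lemma supp_subgroup K : subgroup [set f | supp f K].
Proof. by apply: subgroup_mk; [exact: supp1|move=> f g; exact: suppM|move=> f; exact: suppV]. Qed.

Lemma D_supp K f : D K f -> supp f K.
Proof.
apply: (generated_min (supp_subgroup K)) => _ [h [g [L [Ff Fg [cL LK] [sf sg] ->]]]].
by apply: suppR; [exact: (suppW sf LK.1)|exact: (suppW sg LK.1)].
Qed.

Lemma D_G K : D K `<=` G.
Proof.
apply: generated_min => // _ [f [g [L [Ff Fg [cL LK] [sf sg'] ->]]]].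
apply: (@full_comm G sG simG vigG f g L) => //.
by have [_ nKL] := LK; apply: contrapT => H; apply: nKL => x _; apply: contrapT => nLx; apply: H; exists x.
Qed.

Lemma D_full K f : D K f -> full f.
Proof. by move=> /D_G; exact: G_full. Qed.

Lemma D_J K h f : full h -> D K f -> D (im h K) (f ^ h).
Proof.
move=> Fh; move: f; apply: (@generated_min _ _ [set f | D (im h K) (f ^ h)]).
  have sD := D_subgroup (im h K).
  apply: subgroup_mk => [|x y Dx Dy|x Dx]; rewrite /= ?conj1g ?conjMg ?conjVg.
  - exact: (sg1 sD).
  - exact: (sgM sD).
  - exact: (sgV sD).
move=> _ [f [g [L [Ff Fg [cL [LK KL]] [sf sg'] ->]]]] /=; rewrite conjRg.
apply: (@D_comm _ (im h L)); try exact: suppJ.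
- by apply: (sgJ sF).
- by apply: (sgJ sF).
- exact: im_clopen.
- split; first exact: imS.
  by move=> /(imS (f:=h^-1)); rewrite !imK.
Qed.

(** The left side is normal in [G], and two elements moving one clopen set to two different places
    have a nontrivial commutator. *)
Lemma D_setT : D setT = G.
Proof.
have [V1 [V2 [c1 c2 V10 V20 [VA VI]]]] := clopen_split clopenT (ex_intro setT point I : [set: C] !=set0).
apply: (simple_normalE simG).
  split; [exact: D_subgroup|exact: D_G|].
  move=> x y Dx Gy; have -> : setT = im y setT by [].
  by apply: D_J => //; exact: G_full.
have [S [S1 S2]] := spots c1 V10.
have [cS0 S00 SV0] := S1 0%N; have [cS1 S10 SV1] := S1 1%N; have [cS2 S20 SV2] := S1 2%N.
have [g1 [Gg1 gS1 sg1]] := vig_disj vigG cS0 S00 cS1 S10 (S2 0%N 1%N isT).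
have [g2 [Gg2 gS2 sg2]] := vig_disj vigG cS0 S00 cS2 S20 (S2 0%N 2%N isT).
exists [~ g1, g2].
  apply: (@D_comm _ V1) => //; try exact: G_full.
  - split=> // /(_ _ I); case: V20 => x V2x /(_ x) V1x.
    exact: (disE VI V1x V2x).
  - by apply: (suppW sg1) => x [/SV0|/SV1].
  - by apply: (suppW sg2) => x [/SV0|/SV2].
case: S00 => x S0x; move=> /eqP/commgP/(congr1 (fun f : homeo C => f x)).
rewrite !hmulE (sg2 (g1 x)) => [|[|]]; last 2 first.
- by move=> /(disE (S2 0%N 1%N isT)); apply; exact: gS1.
- by move=> /(disE (S2 2%N 1%N isT)); apply; exact: gS1.
rewrite (sg1 (g2 x)) => [gg|[|]]; last 2 first.
- by move=> /(disE (S2 0%N 2%N isT)); apply; exact: gS2.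
- by move=> /(disE (S2 1%N 2%N isT)); apply; exact: gS2.
by apply: (disE (S2 1%N 2%N isT)); [exact: gS1 S0x|rewrite gg; exact: gS2].
Qed.

(** The description of [G] by commutators in the full group is invariant under conjugation by the
    full group. *)
Lemma G_normal_full g h : G g -> full h -> G (g ^ h).
Proof.
by rewrite -{1}D_setT => Dg Fh; have := D_J Fh Dg; exact: D_G.
Qed.

End LocalGroups.

(** * Enlarging the clopen set whose local group lies in a given subgroup *)

Section Covering.
Variable G : set (homeo C).
Hypothesis sG : subgroup G.
Hypothesis simG : simple_group G.
Hypothesis vigG : vigorous G.
Implicit Types (f g h k s : homeo C) (A B U V W L E K Z : set C) (x y : C).
Implicit Types (M T : set (homeo C)).

Let full := full G.
Let sF : subgroup full := full_subgroup sG.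
Let D := D G.

(** The commutator of two swaps sharing one copy is a 3-cycle of copies of [B]. The part [S 2] of
    [V] stays untouched, which makes the support a proper subset of [A]. *)
Lemma D_push_disj A B V : clopen B -> clopen V -> V !=set0 -> B `<=` A -> V `<=` A ->
  B `&` V = set0 -> exists2 u, D A u & forall x, B x -> V (u x).
Proof.
move=> cB cV V0 BA VA BV.
have [B0|/set0P B0] := eqVneq B set0.
  by exists 1; [exact: (sg1 (D_subgroup G A))|rewrite B0].
have [S [S1 S2]] := spots cV V0.
have [cS0 S00 SV0] := S1 0%N; have [cS1 S10 SV1] := S1 1%N; have [cS2 S20 SV2] := S1 2%N.
have BS0 : B `&` S 0%N = set0 by apply: (disS BV).
have BS1 : B `&` S 1%N = set0 by apply: (disS BV).
have [g1 [Gg1 gS1 sg1]] := vig_disj vigG cB B0 cS0 S00 BS0.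
have [g2 [Gg2 gS2 sg2]] := vig_disj vigG cB B0 cS1 S10 BS1.
have g1S : im g1 B `<=` S 0%N by move=> _ /imP[x Bx ->]; exact: gS1.
have g2S : im g2 B `<=` S 1%N by move=> _ /imP[x Bx ->]; exact: gS2.
have [|f Ff [f1 f2 f3]] := swap_ex sG (G_full Gg1) cB; first exact: disS BS0 _ _.
have [||g Fg [k1 k2 k3]] := swap_ex sG (g := g1^-1 * g2) (U := im g1 B) _ (im_clopen g1 cB).
- by apply: G_full; apply: sgM => //; exact: sgV.
- by rewrite -imM mulVKg; apply: (disS (S2 0%N 1%N isT)).
rewrite -imM mulVKg in k3.
exists [~ f, g].
  apply: (@D_comm G A (B `|` im g1 B `|` im g2 B)) => //.
  - by do !apply: clopenU => //; exact: im_clopen.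
  - case: S20 => z S2z; apply: (@proper_pick _ _ z).
    + by move=> x [[/BA|/g1S/SV0/VA]|/g2S/SV1/VA].
    + by apply: VA; exact: SV2.
    + move=> [[Bz|/g1S Sz]|/g2S Sz].
      * by apply: (disE BV Bz); exact: SV2.
      * exact: (disE (S2 2%N 0%N isT) S2z Sz).
      * exact: (disE (S2 2%N 1%N isT) S2z Sz).
  - by apply: (suppW f3) => x ?; left.
  - by apply: (suppW k3) => x [?|?]; [left; right|right].
move=> x Bx; rewrite hcommE.
have -> : f^-1 x = g1 x by apply: hinv_eq; exact: f2.
have g12 : g (g1 x) = g2 x by rewrite k1 ?imE // hmulE hinvK.
have -> : g^-1 (g1 x) = g2 x.
  by apply: hinv_eq; have := k2 (g1 x); rewrite imE hmulE hinvK; exact.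
have Sx : S 1%N (g2 x) by exact: gS2.
rewrite (f3 (g2 x)) => [|[Bg|/g1S Sg]].
- by have := k2 (g1 x); rewrite imE hmulE hinvK => -> //; apply: SV0; exact: gS1.
- by apply: (disE BS1 Bg).
- exact: (disE (S2 0%N 1%N isT) Sg Sx).
Qed.

(** As [V] may meet [B], the push is made in two steps between disjoint sets, through a part [O'] of
    [A] outside [B] that does not cover [V]. *)
Lemma D_push A B V : clopen A -> clopen B -> clopen V -> V !=set0 -> B `<` A ->
  V `<=` A -> exists2 u, D A u & forall x, B x -> V (u x).
Proof.
move=> cA cB cV V0 [BA nAB] VA.
have cO : clopen (A `&` ~` B) by exact: clopenD.
have O0 : (A `&` ~` B) !=set0.
  by apply: contrapT => H; apply: nAB => x Ax; apply: contrapT => nBx; apply: H; exists x.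
have [O1 [O2 [c1 c2 O10 O20 [OE OI]]]] := clopen_split cO O0.
have O1O : O1 `<=` A `&` ~` B by rewrite -OE; left.
have O2O : O2 `<=` A `&` ~` B by rewrite -OE; right.
have [O' [cO' O'0 O'O VO]] : exists O', [/\ clopen O', O' !=set0,
    O' `<=` A `&` ~` B & (V `&` ~` O') !=set0].
  have [?|H] := pselect ((V `&` ~` O1) !=set0); first by exists O1.
  exists O2; split=> //; case: V0 => x Vx; exists x; split=> // O2x.
  by apply: H; exists x; split=> // O1x; exact: (disE OI O1x O2x).
have [||u1 Du1 u1B] := D_push_disj (A := A) cB cO' O'0 BA.
- by move=> x /O'O[].
- by apply: disI => x Bx /O'O[].
have [|||u2 Du2 u2B] := D_push_disj (A := A) cO' (clopenD cV cO') VO.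
- by move=> x /O'O[].
- by move=> x [/VA].
- by apply: disI => x Ox [].
exists (u1 * u2); first by apply: (sgM (D_subgroup G A)).
by move=> x /u1B/u2B[].
Qed.

(** It suffices to move the support [L] of a generator properly inside [A]. If [L] misses a point of
    [B], an element for [B] compresses its part in [B] into the intersection; otherwise [L] misses a
    point of [A], and an element for [A] first frees room in [B]. *)
Lemma D_union M A B : subgroup M -> clopen A -> clopen B -> (A `&` B) !=set0 ->
  D A `<=` M -> D B `<=` M -> D (A `|` B) `<=` M.
Proof.
move=> sM cA cB AB0 DAM DBM.
apply: generated_min => // _ [f [g [L [Ff Fg [cL [LAB nABL]] [sf sg'] ->]]]].
suff [u [Mu Fu uL]] : exists u, [/\ M u, full u & im u L `<` A].
  rewrite -[[~ f, g]](conjgK u) conjRg.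
  apply: (sgJ sM); last exact: sgV.
  apply: DAM; apply: (@D_comm G A (im u L)) => //; try exact: suppJ.
  - by apply: (sgJ sF).
  - by apply: (sgJ sF).
  - exact: im_clopen.
have [W [cW W0 [WI nIW]]] := clopen_shrink (clopenI cA cB) AB0.
have WA : W `<=` A by move=> x /WI[].
have WB : W `<=` B by move=> x /WI[].
(* This point is kept out of the pushed sets and witnesses that the inclusions obtained by pushing
   are proper. *)
have [z [[Az Bz] nWz]] : exists z, (A `&` B) z /\ ~ W z.
  by apply: contrapT => H; apply: nIW => x Ix; apply: contrapT => nWx; apply: H; exists x.
have DF K u : D K u -> full u by exact: D_full.
suff [u1 [Mu1 Fu1 uAB BuL]] : exists u, [/\ M u, full u, im u L `<=` A `|` B &
    im u L `&` B `<` B].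
  have cuL : clopen (im u1 L) by exact: im_clopen.
  have [u2 Du2 u2W] := D_push cB (clopenI cuL cB) cW W0 BuL WB.
  have su2 := D_supp Du2.
  exists (u1 * u2); split.
  - by apply: sgM => //; exact: DBM.
  - by apply: (sgM sF) => //; exact: DF Du2.
  - rewrite imM; apply: (@proper_pick _ _ z) => //.
      move=> _ /imP[x ux ->]; have [Bx|nBx] := pselect (B x).
        by apply: WA; apply: u2W.
      by rewrite su2 //; case: (uAB _ ux).
    move=> /imP[x ux zx]; have [Bx|nBx] := pselect (B x).
      by apply: nWz; rewrite zx; exact: u2W.
    by move: Bz; rewrite zx su2.
have [BL|nBL] := pselect (B `<=` L); last first.
  exists 1; split; [exact: sg1|exact: (sg1 sF)|by []|].
  by split=> [x []//|H]; apply: nBL => x /H[].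
have LA : L `&` A `<` A.
  split=> [x []//|H]; apply: nABL => x [/H[]//|]; exact: BL.
have [u Du uW] := D_push cA (clopenI cL cA) cW W0 LA WA.
have su := D_supp Du.
exists u; split; [exact: DAM|exact: DF Du| |].
  move=> _ /imP[x Lx ->]; have [Ax|nAx] := pselect (A x).
    by left; apply: WA; exact: uW.
  by rewrite su //; exact: LAB.
apply: (@proper_pick _ _ z) => // -[/imP[x Lx zx] _].
have [Ax|nAx] := pselect (A x); first by apply: nWz; rewrite zx; exact: uW.
by move: Az; rewrite zx su.
Qed.

(** The clopen sets containing [Z] whose local group lies in [M] are closed under finite unions,
    since any two of them meet. The elements of [M] that carry [Z] into such a set form a subgroup
    containing [T], and compactness of [K] does the rest. *)
Lemma D_cover M T Z K : subgroup M -> M `<=` G -> clopen Z -> D Z `<=` M ->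
  T `<=` M -> (forall t, T t -> (Z `&` im t Z) !=set0) -> clopen K ->
  (forall x, K x -> exists2 h, generated T h & im h Z x) -> D K `<=` M.
Proof.
move=> sM MG cZ DZ TM TZ cK Kcov.
have [K0|/set0P K0] := eqVneq K set0.
  apply: generated_min => // f [_ [_ [L [_ _ [_ [_ nKL]] _ _]]]].
  by case: nKL; rewrite K0.
have Z0 : Z !=set0.
  by case: K0 => x /Kcov[h _ /imP[y Zy _]]; exists y.
have MF h : M h -> full h by move=> /MG; exact: G_full.
pose Fam Z' := [/\ clopen Z', Z `<=` Z' & D Z' `<=` M].
have FamU Z1 Z2 : clopen Z1 -> clopen Z2 -> Z `<=` Z1 -> (Z1 `&` Z2) !=set0 ->
    D Z1 `<=` M -> D Z2 `<=` M -> Fam (Z1 `|` Z2).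
  move=> c1 c2 ZZ Z12 D1 D2; split; [exact: clopenU|by move=> x /ZZ; left|exact: D_union].
have DJ h Z' : M h -> D Z' `<=` M -> D (im h Z') `<=` M.
  move=> Mh DM f Df; rewrite -[f](conjgKV h); apply: (sgJ sM) => //.
  apply: DM; rewrite -[Z'](imK h); apply: D_J => //.
  by apply: (sgV sF); exact: MF.
have {}Kcov x : K x -> exists2 Z', Fam Z' & Z' x.
  move=> /Kcov[h Th hZx]; pose S := [set h | M h /\ exists2 Z', Fam Z' & im h Z `<=` Z'].
  suff : S h by case=> _ [Z' FZ hZ]; exists Z' => //; exact: hZ.
  apply: (Th S); split.
    apply: (@subgroup_mk _ S).
    - by split; [exact: sg1|exists Z; [split|]].
    - move=> h1 h2 [M1 [Z1 [c1 ZZ1 D1] h1Z]] [M2 [Z2 [c2 ZZ2 D2] h2Z]].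
      split; first exact: sgM.
      exists (Z2 `|` im h2 Z1).
        apply: FamU => //; [exact: im_clopen| |exact: DJ].
        case: Z0 => z Zz; exists (h2 z); split; last by rewrite imE; exact: ZZ1.
        by apply: h2Z; rewrite imE.
      by rewrite imM; move=> y hy; right; exact: (imS h1Z).
    - move=> h1 [M1 [Z1 [c1 ZZ1 D1] h1Z]]; split; first exact: sgV.
      exists (im h1^-1 Z1); last exact: imS.
      split; [exact: im_clopen| |by apply: DJ => //; exact: sgV].
      by rewrite -{1}[Z](imK h1); exact: imS.
  move=> t Tt; split; first exact: TM.
  exists (Z `|` im t Z); last by move=> y; right.
  by apply: FamU => //; [exact: im_clopen|exact: TZ|apply: DJ => //; exact: TM].
suff [Z' [cZ' _ DM] KZ] : exists2 Z', Fam Z' & K `<=` Z'.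
  by move=> f /(D_mono KZ)/DM.
apply: (@clopen_ind (fun V => exists2 Z', Fam Z' & V `<=` Z') K) => //.
- by exists Z; [split|].
- move=> V W _ _ _ _ _ [Z1 [c1 ZZ1 D1] VZ] [Z2 [c2 ZZ2 D2] WZ].
  exists (Z1 `|` Z2); last by move=> x [/VZ|/WZ]; [left|right].
  by apply: FamU => //; case: Z0 => z Zz; exists z; split; [exact: ZZ1|exact: ZZ2].
- move=> x /Kcov[Z' FZ Z'x]; exists Z'; split=> //; first by case: FZ.
  by move=> W _ WZ _; exists Z'.
Qed.

End Covering.

(** * Torsion generators and compression *)

Section GeneratingLists.
Variable gT : groupType.
Implicit Types (T X : set gT) (e : seq gT).

Lemma generatedS T X : T `<=` generated X -> generated T `<=` generated X.
Proof. by apply: generated_min; exact: generated_subgroup. Qed.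

Lemma generated_seq T X : finite_set X -> X `<=` generated T ->
  exists e, (forall x, x \in e -> T x) /\ X `<=` generated [set` e].
Proof.
move=> /finite_seqP[s ->]; elim: s => [|x s IH] XT; first by exists [::].
have [|e [eT se]] := IH; first by move=> y ys; apply: XT; rewrite /= inE ys orbT.
pose S := [set x | exists e, (forall y, y \in e -> T y) /\ generated [set` e] x].
have [e' [e'T xe]] : S x.
  apply: (XT x); first by rewrite /= mem_head.
  have genS e1 e2 : generated [set` e1] `<=` generated [set` (e1 ++ e2)] /\
      generated [set` e2] `<=` generated [set` (e1 ++ e2)].
    by split; apply: generatedS => y ye; apply: sub_generated; rewrite /= mem_cat (ye : y \in _) ?orbT.
  split; last by move=> t Tt; exists [:: t]; split; [move=> y; rewrite inE => /eqP->|apply: sub_generated; rewrite /= mem_head].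
  apply: subgroup_mk.
  - by exists [::]; split=> //; exact: (sg1 (generated_subgroup _)).
  - move=> y z [e1 [e1T ye]] [e2 [e2T ze]]; exists (e1 ++ e2); split.
      by move=> u; rewrite mem_cat => /orP[/e1T|/e2T].
    by apply: (sgM (generated_subgroup _)); [exact: (genS e1 e2).1|exact: (genS e1 e2).2].
  - by move=> y [e1 [e1T ye]]; exists e1; split=> //; apply: (sgV (generated_subgroup _)).
exists (e' ++ e); split; first by move=> u; rewrite mem_cat => /orP[/e'T|/eT].
move=> y; rewrite /= inE => /orP[/eqP->|ys].
  by apply: generatedS xe => z ze; apply: sub_generated; rewrite /= mem_cat (ze : z \in _).
have := se y ys; apply: generatedS => z ze; apply: sub_generated.
by rewrite /= mem_cat (ze : z \in _) orbT.
Qed.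

Lemma generated_prod T x : (forall y, T y -> T y^-1) -> generated T x ->
  exists e, (forall y, y \in e -> T y) /\ \big[*%g/1]_(y <- e) y = x.
Proof.
move=> TV; apply: (generated_min (G := [set x | exists e,
  (forall y, y \in e -> T y) /\ \big[*%g/1]_(y <- e) y = x])); last first.
  move=> t Tt; exists [:: t]; split; last by rewrite big_seq1.
  by move=> y; rewrite inE => /eqP->.
apply: subgroup_mk.
- by exists [::]; split=> //; rewrite big_nil.
- move=> y z [e1 [e1T <-]] [e2 [e2T <-]]; exists (e1 ++ e2); split.
    by move=> u; rewrite mem_cat => /orP[/e1T|/e2T].
  by rewrite big_cat.
- move=> y [e [eT <-]]; exists (rev [seq z^-1 | z <- e]); split.
    by move=> u; rewrite mem_rev => /mapP[z /eT/TV Tz ->].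
  elim: e {eT} => [|z e IH]; first by rewrite big_nil invg1.
  by rewrite /= rev_cons -cats1 big_cat /= IH big_seq1 big_cons invgM.
Qed.

End GeneratingLists.

Section Elements.
Variable G : set (homeo C).
Hypothesis sG : subgroup G.
Hypothesis simG : simple_group G.
Hypothesis vigG : vigorous G.
Implicit Types (f g h k s : homeo C) (A B U V W L E K Z Q : set C).

Lemma torsion_generated n : (2 <= n)%N ->
  generated [set f | G f /\ f ^+ n = 1] = G.
Proof.
move=> n2; set T := [set f | _].
apply: (simple_normalE simG).
  split; [exact: generated_subgroup|by apply: generated_min => // f []|].
  move=> x y Tx Gy; move: x Tx.
  apply: (generated_min (G := [set x | generated T (x ^ y)])).
    apply: subgroup_mk => [|u v Du Dv|u Du]; rewrite /= ?conj1g ?conjMg ?conjVg.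
    - exact: (sg1 (generated_subgroup _)).
    - by apply: (sgM (generated_subgroup _)).
    - by apply: (sgV (generated_subgroup _)).
  move=> f [Gf fn]; apply: sub_generated; split; first exact: sgJ.
  by rewrite -conjXg fn conj1g.
have [S [S1 S2]] := spots clopenT (ex_intro setT point I : [set: C] !=set0).
have [c0 S00 _] := S1 0%N; have [c1 S10 _] := S1 1%N; have [c2 [z S2z] _] := S1 2%N.
have [|b [Gb sb bn bS]] := torsion_mover sG simG vigG c0 S00 c1 S10 (S2 0%N 1%N isT) _ (ltnW n2).
  exists z => -[Sz|Sz]; first exact: (disE (S2 0%N 2%N isT) Sz S2z).
  exact: (disE (S2 1%N 2%N isT) Sz S2z).
exists b; first by apply: sub_generated.
move=> b1; have [x S0x] := S00; have := bS x 1%N S0x; rewrite b1 expg1n.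
by move=> /(_ n2); exact: (disE (S2 0%N 1%N isT) S0x).
Qed.

(** The generating list occurs twice so that any two of its entries, even equal ones, can be found
    at different positions of [e1 ++ e1 ++ e2]; the list [e2] corrects the product. *)
Lemma torsion_list n rho : (2 <= n)%N -> finitely_generated G -> G rho ->
  exists e1 e2 : seq (homeo C), [/\ forall f, f \in e1 ++ e2 -> G f /\ f ^+ n = 1,
    generated [set` e1] = G & \big[*%g/1]_(f <- e1 ++ e1 ++ e2) f = rho].
Proof.
move=> n2 [X fX XG] Grho; set T := [set f | G f /\ f ^+ n = 1].
have GT : generated T = G by exact: torsion_generated.
have TV y : T y -> T y^-1.
  by move=> [Gy yn]; split; [exact: sgV|rewrite expVgn yn invg1].
have [|e1 [e1T Xe1]] := generated_seq (T := T) fX.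
  by rewrite GT -XG; exact: sub_generated.
have [|e2 [e2T pe2]] := generated_prod (x := (\big[*%g/1]_(f <- e1 ++ e1) f)^-1 * rho) TV.
  rewrite GT; apply: sgM => //; apply: sgV => //.
  rewrite big_seq; apply: big_ind => //; [exact: sg1|by move=> *; exact: sgM|].
  by move=> y; rewrite mem_cat => /orP[] /e1T[].
exists e1, e2; split.
- by move=> x; rewrite mem_cat => /orP[/e1T|/e2T].
- apply/seteqP; split; first by apply: generated_min => // x /e1T[].
  by rewrite -[X in X `<=` _]XG; exact: generatedS.
- by rewrite catA big_cat /= pe2 mulVKg.
Qed.

(** An element sending [B] into a proper subset [E] never brings a point of [B] outside [E] back to
    itself. *)
Lemma infinite_order A : clopen A -> A !=set0 ->
  exists rho, [/\ G rho, supp rho A & forall N, (0 < N)%N -> rho ^+ N <> 1].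
Proof.
move=> cA A0; have [B [cB B0 BA]] := clopen_shrink cA A0.
have [E [cE E0 EB]] := clopen_shrink cB B0.
have [rho [Gr rB sr]] := vig vigG cA cB B0 BA cE E0 (properWS EB BA.1).
exists rho; split=> // N N0 rN.
have [EB' nEB] := EB.
have [x [Bx nEx]] : exists x, B x /\ ~ E x.
  by apply: contrapT => H; apply: nEB => x Bx; apply: contrapT => nEx; apply: H; exists x.
suff H M : E ((rho ^+ M.+1) x) by apply: nEx; have := H N.-1; rewrite prednK // rN.
elim: M => [|M IH]; first by rewrite expg1; exact: rB.
by rewrite hexpS; apply: rB; exact: EB'.
Qed.

(** An element commuting with a generating set commutes with [G]; but a nontrivial [z] carries some
    nonempty clopen set off itself, and a nontrivial element of [G] supported on that set does not
    commute with [z]. *)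
Lemma centerless z (X : set (homeo C)) : generated X = G -> z <> 1 ->
  exists2 g, X g & [~ z, g] <> 1.
Proof.
move=> XG z1; apply: contrapT => H.
have zX g : G g -> commute z g.
  rewrite -XG; apply; split.
    apply: subgroup_mk => [|u v|u].
    - exact: commute1.
    - exact: commuteM.
    - exact: commuteV.
  move=> g' Xg; apply/commgP/eqP; apply: contrapT => zg; apply: H; by exists g'.
have [x zx] := hmove z1; have [U [cU Uzx nUx]] := clopen_nbhd zx.
pose A := im z^-1 U `&` ~` U.
have imz y : im z^-1 U y = U (z y) by rewrite -[in LHS](hinvK z y) imE.
have cA : clopen A by apply: clopenD => //; exact: im_clopen.
have [|g [Gg g1 sg]] := G_nontrivial vigG cA; first by exists x; split=> //; rewrite imz.
have [y gy] := hmove g1; have Ay : A y by apply: contrapT => nAy; apply: gy; exact: sg.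
have := congr1 (fun f : homeo C => f y) (zX g Gg); rewrite !hmulE => E.
apply: gy; apply: (@hinj z); rewrite -E; apply: sg => -[_].
by case: Ay; rewrite imz.
Qed.

End Elements.

(** * Copying the whole space, and the group with it, into a proper clopen set *)

Section Compression.
Variable G : set (homeo C).
Hypothesis sG : subgroup G.
Hypothesis simG : simple_group G.
Hypothesis vigG : vigorous G.
Implicit Types (f g h k s : homeo C) (A B U V W L E K Z Q S : set C) (x y : C).

(* [phi] is piecewise in [G] and [Phi] is conjugation by [phi]. *)
Lemma compression S : clopen S -> S !=set0 -> (~` S) !=set0 ->
  exists (phi : C -> C) (Y : set C) (Phi : homeo C -> homeo C),
  [/\ [/\ clopen Y, Y `<=` S, injective phi & forall y, Y y <-> exists x, y = phi x],
      forall Q, clopen Q -> clopen (phi @` Q),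
      forall f x, Phi f (phi x) = phi (f x), forall f, supp (Phi f) Y &
      (forall f, G f -> G (Phi f)) /\
      (forall f, D G Y f -> exists2 g, G g & f = Phi g)].
Proof.
move=> cS S0 nS0; have [S1 [S2 [c1 c2 S10 S20 [SE SI]]]] := clopen_split cS S0.
have [A [A' [cA _ A0 A'0 [AE AI]]]] := clopen_split clopenT (ex_intro setT point I : [set: C] !=set0).
have cnA : clopen (~` A) by exact: clopenC.
have prT B : (~` B) !=set0 -> B `<` setT.
  by case=> x nBx; split=> // /(_ x I).
have nA0 : (~` A) !=set0.
  by case: A'0 => x A'x; exists x => Ax; exact: (disE AI Ax A'x).
have S1T : S1 `<` setT.
  by apply: prT; case: S20 => x S2x; exists x => Sx; exact: (disE SI Sx S2x).
have S2T : S2 `<` setT.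
  by apply: prT; case: S10 => x S1x; exists x => Sx; exact: (disE SI S1x Sx).
(* A homeomorphism cannot map the whole space into [S], so the space is cut into two proper clopen
   parts, which are sent to disjoint parts of [S] by two elements of [G]. *)
have [g1 [Gg1 g1S _]] := vig vigG clopenT cA A0 (prT A nA0) c1 S10 S1T.
have [g2 [Gg2 g2S _]] : exists g2, [/\ G g2, forall x, (~` A) x -> S2 (g2 x) & supp g2 setT].
  by apply: vig => //; [exact: clopenT|apply: prT; rewrite setCK].
pose phi x := if `[< A x >] then g1 x else g2 x.
have phi1 x : A x -> phi x = g1 x by move=> Ax; rewrite /phi asboolT.
have phi2 x : ~ A x -> phi x = g2 x by move=> Ax; rewrite /phi asboolF.
pose Y1 := im g1 A; pose Y2 := im g2 (~` A); pose Y := Y1 `|` Y2.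
pose psi y := if `[< Y1 y >] then g1^-1 y else g2^-1 y.
have Y12 : Y1 `&` Y2 = set0.
  by apply: (disS SI) => _ /imP[x Ax ->]; [exact: g1S|exact: g2S].
have psi1 y : Y1 y -> psi y = g1^-1 y by move=> ?; rewrite /psi asboolT.
have psi2 y : Y2 y -> psi y = g2^-1 y.
  by move=> Yy; rewrite /psi asboolF // => /(disE Y12); exact.
have phiY1 x : A x -> Y1 (phi x) by move=> Ax; rewrite phi1 // /Y1 imE.
have phiY2 x : ~ A x -> Y2 (phi x) by move=> Ax; rewrite phi2 // /Y2 imE.
have phiY x : Y (phi x).
  by have [/phiY1|/phiY2] := pselect (A x); [left|right].
have phiK : cancel phi psi.
  move=> x; have [Ax|Ax] := pselect (A x).
    by rewrite psi1 ?phi1 ?hinvK //; rewrite -phi1 //; exact: phiY1.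
  by rewrite psi2 ?phi2 ?hinvK //; rewrite -phi2 //; exact: phiY2.
have psiK y : Y y -> phi (psi y) = y.
  case=> Yy; have [x Ax yE] := imP Yy.
    by rewrite psi1 // yE hinvK phi1.
  by rewrite psi2 // yE hinvK phi2.
have cY1 : clopen Y1 by exact: im_clopen.
have cY2 : clopen Y2 by exact: im_clopen.
have cY : clopen Y by exact: clopenU.
have philoc x : exists g U, [/\ G g, clopen U, U x & forall y, U y -> phi y = g y].
  by have [Ax|Ax] := pselect (A x); [exists g1, A|exists g2, (~` A)].
have psiloc y : Y y -> exists g U, [/\ G g, clopen U, U y & forall z, U z -> psi z = g z /\ Y z].
  case=> Yy.
    exists g1^-1, Y1; split=> //; first exact: sgV.
    by move=> z Yz; split; [exact: psi1|left].
  exists g2^-1, Y2; split=> //; first exact: sgV.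
  by move=> z Yz; split; [exact: psi2|right].
pose F f y := if `[< Y y >] then phi (f (psi y)) else y.
have FY f y : Y y -> F f y = phi (f (psi y)) by move=> Yy; rewrite /F asboolT.
have FnY f y : ~ Y y -> F f y = y by move=> Yy; rewrite /F asboolF.
have FK f : cancel (F f) (F f^-1).
  move=> y; have [Yy|nYy] := pselect (Y y); last by rewrite !FnY.
  by rewrite (FY f) // FY // phiK hinvK psiK.
have im_pre f U x : im f^-1 U x = U (f x) by rewrite -[in LHS](hinvK f x) imE.
have Floc (H : set (homeo C)) f : subgroup H -> G `<=` H ->
   (forall x, exists g U, [/\ H g, clopen U, U x & forall y, U y -> f y = g y]) ->
   forall x, exists g U, [/\ H g, clopen U, U x & forall y, U y -> F f y = g y].
  move=> sH GH floc y; have [Yy|nYy] := pselect (Y y); last first.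
    exists 1, (~` Y); split=> //; [exact: sg1|exact: clopenC|by move=> z; exact: FnY].
  have [p [U1 [Gp cU1 U1y pU]]] := psiloc y Yy.
  have [q [U2 [Gq cU2 U2y qU]]] := floc (psi y).
  have [r [U3 [Gr cU3 U3y rU]]] := philoc (f (psi y)).
  have [py _] := pU y U1y.
  exists (p * q * r), (U1 `&` im p^-1 (U2 `&` im q^-1 U3)); split.
  - by apply: sgM => //; [apply: sgM => //; exact: GH|exact: GH].
  - by do 2 (apply: clopenI => //; apply: im_clopen).
  - by split=> //; rewrite im_pre -py; split=> //; rewrite im_pre -qU.
  - move=> z [U1z]; rewrite im_pre => -[U2z]; rewrite im_pre => U3z.
    have [pz Yz] := pU z U1z.
    by rewrite FY // pz qU // rU.
have /choice [Phi PhiE] : forall f : homeo C, exists h : homeo C, forall x, h x = F f x.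
  move=> f; apply: (@local_homeo _ (F f^-1)); [exact: FK|by have := FK f^-1; rewrite invgK|].
  move=> x; have sT : subgroup [set: homeo C] by exact: subgroup_mk.
  have [|y|g [U [_ ? ? ?]]] := Floc setT f sT _ _ x; first by [].
    by exists f, setT; split=> //; exact: clopenT.
  by exists g, U.
have Phi_phi f x : Phi f (phi x) = phi (f x) by rewrite PhiE FY // phiK.
have Phi_supp f : supp (Phi f) Y by move=> y nYy; rewrite PhiE FnY.
have PhiM f g : Phi (f * g) = Phi f * Phi g.
  apply: homeo_ext => y; rewrite hmulE; have [Yy|nYy] := pselect (Y y).
    by rewrite -(psiK y Yy) !Phi_phi.
  by rewrite !Phi_supp.
have Phi1 : Phi 1 = 1.
  by apply: (@mulgI _ (Phi 1)); rewrite -PhiM !mulg1.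
have PhiV f : Phi f^-1 = (Phi f)^-1.
  by apply: (@mulgI _ (Phi f)); rewrite -PhiM !mulgV.
have Phi_full f : full G f -> full G (Phi f).
  move=> Ff y; have [g [U [Gg cU Uy gU]]] := Floc G f sG (@subset_refl _ G) Ff y.
  by exists g, U; split=> // z Uz; rewrite PhiE gU.
have YS : Y `<=` S.
  move=> y; rewrite -SE => -[/imP[x Ax ->]|/imP[x Ax ->]]; [left; exact: g1S|right; exact: g2S].
have YT : (~` Y) !=set0 by case: nS0 => x nSx; exists x => /YS.
exists phi, Y, Phi; split=> //.
- split=> //; first exact: can_inj phiK.
  by move=> y; split=> [/psiK <-|[x ->]//]; exists (psi y).
- move=> Q cQ; rewrite (_ : _ @` _ = im g1 (Q `&` A) `|` im g2 (Q `&` ~` A)).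
    by apply: clopenU; apply: im_clopen; apply: clopenI.
  apply/seteqP; split=> [_ [x Qx <-]|y [/imP[x [Qx Ax] ->]|/imP[x [Qx Ax] ->]]].
  + have [Ax|Ax] := pselect (A x); [left; rewrite phi1 // imE|right; rewrite phi2 // imE]; by [].
  + by exists x; rewrite // phi1.
  + by exists x; rewrite // phi2.
split=> [f|f Df].
  (* By itself [Phi_full] gives membership in the full group only. Writing [f] by commutators puts
     [Phi f] in [G], since all values of [Phi] are supported on the proper clopen set [Y]. *)
  rewrite -{1}(D_setT sG simG vigG); move: f.
  apply: (generated_min (G := [set f | G (Phi f)])).
    apply: subgroup_mk => [|u v Gu Gv|u Gu]; rewrite /= ?Phi1 ?PhiM ?PhiV.
    - exact: sg1.
    - exact: sgM.
    - exact: sgV.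
  move=> _ [f [g [L [Ff Fg _ _ ->]]]] /=.
  rewrite commgEl conjgE !PhiM !PhiV.
  by apply: (@full_comm G sG simG vigG (Phi f) (Phi g) Y) => //; exact: Phi_full.
move: f Df; apply: (generated_min (G := [set f | exists2 g, G g & f = Phi g])).
  apply: subgroup_mk.
  - by exists 1; [exact: sg1|rewrite Phi1].
  - by move=> _ _ [u Gu ->] [v Gv ->]; exists (u * v); [exact: sgM|rewrite PhiM].
  - by move=> _ [u Gu ->]; exists u^-1; [exact: sgV|rewrite PhiV].
move=> _ [f [g [L [Ff Fg [cL [LY nYL]] [sf sg' ] ->]]]] /=.
pose L' := [set x | L (phi x)].
(* Conversely, an element of the full group supported inside [Y] is pulled back along [phi], and the
   pullback is again piecewise in [G]. *)
have pull h : full G h -> supp h L -> exists2 h', full G h' /\ supp h' L' & h = Phi h'.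
  move=> Fh sh; have shY : supp h Y by exact: suppW sh LY.
  have hloc x : exists g U, [/\ G g, clopen U, U x & forall y, U y -> psi (h (phi y)) = g y].
    have [p [U1 [Gp cU1 U1x pU]]] := philoc x.
    have [q [U2 [Gq cU2 U2x qU]]] := Fh (phi x).
    have [|r [U3 [Gr cU3 U3x rU]]] := psiloc (h (phi x)); first by apply/(supp_stable _ shY).
    exists (p * q * r), (U1 `&` im p^-1 (U2 `&` im q^-1 U3)); split.
    - by do 2 apply: sgM => //.
    - by do 2 (apply: clopenI => //; apply: im_clopen).
    - by split=> //; rewrite im_pre -pU //; split=> //; rewrite im_pre -qU.
    - move=> z [U1z]; rewrite im_pre => -[U2z]; rewrite im_pre => U3z.
      rewrite pU // qU //.
      by have [-> _] := rU _ U3z.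
  have hK k : supp k Y -> cancel (fun x => psi (k (phi x))) (fun x => psi (k^-1 (phi x))).
    by move=> sk x; rewrite psiK ?hinvK ?phiK //; apply/(supp_stable _ sk).
  have [||x|h' h'E] := @local_homeo (fun x => psi (h (phi x))) (fun x => psi (h^-1 (phi x))).
  - exact: hK.
  - by have := hK h^-1 (suppV shY); rewrite invgK.
  - by have [p [U [? ? ? ?]]] := hloc x; exists p, U.
  exists h'.
    split=> [x|x nLx]; last by rewrite h'E sh // phiK.
    by have [p [U [? ? ? pU]]] := hloc x; exists p, U; split=> // y Uy; rewrite h'E pU.
  apply: homeo_ext => y; have [Yy|nYy] := pselect (Y y); last by rewrite Phi_supp // shY.
  rewrite -(psiK y Yy) Phi_phi h'E psiK ?psiK //.
  by apply/(supp_stable _ shY).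
have [f' [Ff' sf'] fE] := pull f Ff sf.
have [g' [Fg' sg''] gE] := pull g Fg sg'.
exists [~ f', g']; last by rewrite fE gE !commgEl !conjgE !PhiM !PhiV.
have cL' : clopen L'.
  by apply: (preimage_clopen cL) => x A0' /=; have [p [U [Gp cU Ux pU]]] := philoc x;
   rewrite pU // => /(@homeo_cts _ p x) pA; have nU : nbhs x U by [apply: open_nbhs_nbhs; split=> //; exact: cU.1];
   apply: filterS2 nU pA => z Uz /=; rewrite pU.
apply: (@full_comm G sG simG vigG f' g' L') => //.
apply: contrapT => H; apply: nYL => y Yy; apply: contrapT => nLy; apply: H.
by exists (psi y); rewrite /L' /= psiK.
Qed.

End Compression.

(** * Sparse sequences *)

Section SparseSequence.
Variables (gT : groupType) (e : seq gT) (d : nat).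
Hypothesis d0 : (0 < d)%N.
Let M := size e.

(** Powers of 3 make the positions a Sidon set, and the factor [d] bounds all gaps from below,
    including the one before the first position. *)
Definition pos i := (d * 3 ^ i)%N.

(** Off the positions [index] returns the length of the list, so the default value 1 of [nth]
    applies. *)
Definition sparse j : gT := nth 1 e (index j [seq pos i | i <- iota 0 (size e)]).

Lemma pos_inj : injective pos.
Proof. by move=> i j /eqP; rewrite eqn_pmul2l // eqn_exp2l // => /eqP. Qed.

Lemma pos_gt0 i : (d <= pos i)%N.
Proof. by rewrite leq_pmulr // expn_gt0. Qed.

Lemma posS i j : (i < j)%N -> (3 * pos i <= pos j)%N.
Proof.
by move=> ij; rewrite mulnCA -expnS leq_pmul2l // leq_pexp2l.
Qed.

Lemma sparse_pos i : (i < M)%N -> sparse (pos i) = nth 1 e i.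
Proof.
move=> iM; rewrite /sparse (index_map pos_inj); congr (nth _ _ _).
have {1}<- : nth 0%N (iota 0 M) i = i by rewrite nth_iota.
by rewrite index_uniq ?size_iota ?iota_uniq.
Qed.

Lemma sparse_neq1 j : sparse j <> 1 -> exists2 i, (i < M)%N & j = pos i.
Proof.
rewrite /sparse; set P := map _ _.
have [/mapP[i] | jP] := boolP (j \in P).
  by rewrite mem_iota /= add0n => iM -> _; exists i.
by rewrite nth_default // memNindex // size_map size_iota.
Qed.

Lemma sparse_prod i : (i <= M)%N ->
  \big[*%g/1]_(0 <= j < pos i) sparse j = \big[*%g/1]_(0 <= j < i) nth 1 e j.
Proof.
have s1 a b : (forall j, (a <= j < b)%N -> forall i, j <> pos i) ->
    \big[*%g/1]_(a <= j < b) sparse j = 1.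
  move=> H; rewrite big_nat big1 // => j jab; apply: contrapT => /sparse_neq1[k _].
  exact: H.
elim: i => [|i IH] iM.
  rewrite [RHS]big_geq // s1 // => j /andP[_ jd] k jk.
  by have := pos_gt0 k; rewrite -jk leqNgt; move: jd; rewrite /pos expn0 muln1 => ->.
have pp : (pos i < pos i.+1)%N by have := posS (ltnSn i); have := pos_gt0 i; lia.
rewrite (big_cat_nat (n := pos i)) /=; [|by []|exact: ltnW].
rewrite IH ?(ltnW iM) // big_ltn // sparse_pos // s1 ?mulg1 ?big_nat_recr //.
move=> j /andP[ij ji] k jk; rewrite {}jk in ij ji.
have [ki|ki|ki] := ltngtP k i.
- by have := posS ki; have := pos_gt0 k; lia.
- have [ik|ik|ik] := ltngtP i.+1 k; [|lia|by rewrite ik ltnn in ji].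
  by have := posS ik; lia.
- by rewrite ki ltnn in ij.
Qed.

Lemma sparse_prodT q : (pos M <= q)%N ->
  \big[*%g/1]_(0 <= j < q) sparse j = \big[*%g/1]_(x <- e) x.
Proof.
move=> Mq; rewrite (big_cat_nat (n := pos M)) //= sparse_prod // [RHS](big_nth 1).
suff -> : \big[*%g/1]_(pos M <= j < q) sparse j = 1 by rewrite mulg1.
rewrite big_nat big1 // => j /andP[Mj _]; apply: contrapT => /sparse_neq1[i iM jE].
by have := posS iM; have := pos_gt0 i; lia.
Qed.

(** In a sequence growing by factors of at least 3, a sum of two terms determines the two terms. *)
Lemma pos_sidon u v a b : (pos u + pos b = pos v + pos a)%N -> a <> b -> u = a.
Proof.
move=> E ab.
have H i j : (i = j \/ (3 * pos i <= pos j)%N \/ (3 * pos j <= pos i)%N).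
  by have [/posS|/posS|] := ltngtP i j; [right; left|right; right|left].
have := pos_gt0 u; have := pos_gt0 v; have := pos_gt0 a; have := pos_gt0 b.
case: (H u a) => [//|ua]; case: (H a b) => [//|{}ab].
case: (H u v) => [uv|uv].
  by move: E ab; rewrite uv; lia.
case: (H b v) => [bv|bv]; first by move: E ua; rewrite bv; lia.
case: (H u b) => [ub|ub]; case: (H v a) => [va|va]; try subst; lia.
Qed.

(** This handles the extra element 0 that [sparse_disjoint] adds to one of the translates. *)
Lemma pos_sidon0 u a b : (pos u + pos b <> pos a)%N.
Proof.
have H i j : (i = j \/ (3 * pos i <= pos j)%N \/ (3 * pos j <= pos i)%N).
  by have [/posS|/posS|] := ltngtP i j; [right; left|right; right|left].
have := pos_gt0 u; have := pos_gt0 a; have := pos_gt0 b.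
by case: (H u a) => [->|ua]; case: (H a b) => [->|ab]; try lia; case: (H u b) => [->|ub]; lia.
Qed.

(* Modulo [q], distinct translates of the set of positions (with [0] added to
   one of them) meet at most in one point. *)
Lemma sparse_disjoint q a b i : (2 * pos M <= q)%N -> (a < M)%N -> (b < M)%N ->
  a <> b -> (i < q)%N -> sparse ((i + pos a) %% q) <> 1 ->
  ((i + pos b) %% q == 0)%N || (sparse ((i + pos b) %% q) != 1) -> i = 0%N.
Proof.
move=> Mq aM bM ab iq /sparse_neq1[u uM ua].
have q0 : (0 < q)%N by lia.
have pa := posS aM; have pb := posS bM; have pu := posS uM.
have lt a' b' : (a' < M)%N -> (i + pos a') %% q = b' ->
    (i + pos a' = b' \/ i + pos a' = b' + q)%N.
  move=> a'M <-; have pa' := posS a'M; have := pos_gt0 a'.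
  have [?|?] := ltnP (i + pos a') q; first by rewrite modn_small //; left.
  by right; rewrite -{2}(subnK (m := q) (n := i + pos a')) // modnDr modn_small; lia.
have {}ua := lt _ _ aM ua.
have gu := pos_gt0 u; have ga := pos_gt0 a; have gb := pos_gt0 b.
case/orP=> [/eqP/(lt _ _ bM) ub|/eqP/sparse_neq1[v vM /(lt _ _ bM) ub]].
  have := @pos_sidon0 u a b; lia.
have pv := posS vM; have gv := pos_gt0 v.
have E : (pos u + pos b = pos v + pos a)%N by lia.
by have := pos_sidon E ab => uE; rewrite uE in ua; lia.
Qed.

End SparseSequence.

(** * A criterion for generation by two torsion elements *)

Section Dynamics.
Variable G : set (homeo C).
Hypothesis sG : subgroup G.
Hypothesis simG : simple_group G.
Hypothesis vigG : vigorous G.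
Variables (phi : C -> C) (Y : set C) (Phi : homeo C -> homeo C).
Hypothesis cY : clopen Y.
Hypothesis YE : forall y, Y y <-> exists x, y = phi x.
Hypothesis Phi_phi : forall f x, Phi f (phi x) = phi (f x).
Hypothesis Phi_supp : forall f, supp (Phi f) Y.
Hypothesis Phi_D : forall f, D G Y f -> exists2 g, G g & f = Phi g.
Variables (e1 e2 : seq (homeo C)) (d m n q : nat) (rho : homeo C) (Q0 : set C).
Let e := e1 ++ e1 ++ e2.
Let c := sparse e d.
Hypothesis d2 : (2 <= d)%N.
Hypothesis m3 : (3 <= m)%N.
Hypothesis n2 : (2 <= n)%N.
Hypothesis qE : q = (2 * pos d (size e))%N.
Hypothesis e1G : generated [set` e1] = G.
Hypothesis prod_e : \big[*%g/1]_(f <- e) f = rho^-1.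
Hypothesis Grho : G rho.
Hypothesis rho_inf : forall N, (0 < N)%N -> rho ^+ N <> 1.
Hypothesis rhoQ0 : forall z, Q0 z -> rho z = z.
Variables (pi s a b : homeo C) (R K : set C).
(* [tok j] identifies the whole space with the j-th copy of [Y], and [tokset] is
   the row X described at the top; [R] and the sets b^i X for 2 <= i < n, which
   complete X and aX to a cycle of [b], are fixed by [a]. *)
Definition tok j z := (pi ^+ j) (phi z).
Definition tokset : set C := [set x | exists j z, (j < q)%N /\ x = tok j z].
Hypothesis tok_inj : forall i j y z, (i < q)%N -> (j < q)%N ->
  tok i y = tok j z -> i = j /\ y = z.
Hypothesis sS : forall j z, (j.+1 < q)%N -> s (tok j z) = tok j.+1 z.
Hypothesis sq : forall z, s (tok q.-1 z) = tok 0 (rho z).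
Hypothesis am : a ^+ m = 1.
Hypothesis bn : b ^+ n = 1.
Hypothesis aX : forall i x, (0 < i < m)%N -> tokset x -> ~ tokset ((a ^+ i) x).
Hypothesis bX : forall x, tokset x -> b (s x) = a x.
Hypothesis aE : forall i x, (2 <= i < n)%N -> tokset x -> a ((b ^+ i) x) = (b ^+ i) x.
(** On the part [Q0] of token 0 of a^2 X the action of [b] is left open: [bR] and [bQ] say that
    [b^-1] maps this part into itself and [R], and maps [R] back into this part at once. *)
Hypothesis bX2 : forall j z, (j < q)%N -> (0 < j)%N \/ ~ Q0 z ->
  b (a (a (tok j z))) = a (a (tok j (c j z))).
Hypothesis bX3 : forall i x, (3 <= i < m)%N -> tokset x -> b ((a ^+ i) x) = (a ^+ i) x.
Hypothesis aR : forall y, R y -> a y = y.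
Hypothesis bR : forall y, R y -> exists2 z, Q0 z & b^-1 y = a (a (tok 0 z)).
Hypothesis bQ : forall z, Q0 z -> R (b^-1 (a (a (tok 0 z)))) \/
  exists2 z', Q0 z' & b^-1 (a (a (tok 0 z))) = a (a (tok 0 z')).
Hypothesis KE : forall y, K y ->
  [\/ exists i x, [/\ (i < m)%N, tokset x & y = (a ^+ i) x],
      exists i x, [/\ (2 <= i < n)%N, tokset x & y = (b ^+ i) x] | R y].
Hypothesis nK : forall y, ~ K y -> a y = y /\ b y = y.

Definition w := a * b^-1.
(** The return time of [w] to a^(m-1) X without the detour: n-1 steps down to aX, one step into a^2
    X and m-3 steps up. *)
Let L := (m + n - 3)%N.
Let top j z := (a ^+ m.-1) (tok j z).

Let d0 : (0 < d)%N. Proof. by lia. Qed.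

Let q0 : (1 < q)%N.
Proof. by rewrite qE; have := @pos_gt0 d (size e); lia. Qed.

Let Xtok j z : (j < q)%N -> tokset (tok j z).
Proof. by move=> jq; exists j, z. Qed.

Let c0 : c 0%N = 1.
Proof.
apply: contrapT => /sparse_neq1[i _ E].
by have := @pos_gt0 d i; lia.
Qed.

Let sX x : tokset x -> tokset (s x).
Proof.
move=> [j [z [jq ->]]]; have [jq'|jq'] := ltnP j.+1 q.
  by rewrite sS //; exact: Xtok.
have -> : j = q.-1 by lia.
by rewrite sq; apply: Xtok; lia.
Qed.

Let sVtok j z : (0 < j < q)%N -> s^-1 (tok j z) = tok j.-1 z.
Proof. by move=> /andP[j0 jq]; apply: hinv_eq; rewrite sS prednK. Qed.

Let sV0 z : s^-1 (tok 0 z) = tok q.-1 (rho^-1 z).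
Proof. by apply: hinv_eq; rewrite sq hKinv. Qed.

Let sVX x : tokset x -> tokset (s^-1 x).
Proof.
move=> [[|j] [z [jq ->]]]; first by rewrite sV0; apply: Xtok; lia.
by rewrite sVtok //; apply: Xtok; lia.
Qed.

Let w_X x : tokset x -> w x = s x.
Proof. by move=> Xx; apply: hinv_eq; exact: bX. Qed.

Let wVX x : tokset (w x) -> tokset x.
Proof.
move=> Xwx; have := sVX Xwx; have -> // : s^-1 (w x) = x.
apply: (@hinj w); rewrite w_X ?hKinv //; exact: sVX.
Qed.

Let wVXi i x : tokset ((w ^+ i) x) -> tokset x.
Proof. by elim: i => [//|i IH]; rewrite hexpS => /wVX. Qed.

Let w_tok i j z : (i + j < q)%N -> (w ^+ i) (tok j z) = tok (i + j) z.
Proof.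
elim: i => [//|i IH] ijq; rewrite hexpS IH; last by lia.
by rewrite w_X ?sS //; apply: Xtok; lia.
Qed.

Let w_tokq j z : (j < q)%N -> (w ^+ q) (tok j z) = tok j (rho z).
Proof.
move=> jq; have -> : q = (q.-1 - j + (1 + j))%N by lia.
rewrite hexpD w_tok; last by lia.
have -> : (q.-1 - j + j)%N = q.-1 by lia.
rewrite hexpD expg1 w_X ?sq; last by apply: Xtok; lia.
by rewrite w_tok ?addn0.
Qed.

Let w_tokqN j z N : (j < q)%N -> (w ^+ (q * N)) (tok j z) = tok j ((rho ^+ N) z).
Proof.
move=> jq; rewrite expgnA; elim: N => [//|N IH].
by rewrite (hexpS (w ^+ q)) IH w_tokq // hexpS.
Qed.

(* Under [w] a point of a^(m-1) X runs down the pieces fixed by [a], enters aX,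
   then a^2 X, from where it may make a detour through [R], and climbs up to
   a^(m-1) X again. *)
Let bVX i x : tokset x -> (0 < i < n)%N ->
  (w ^+ i) ((a ^+ m.-1) x) = (b ^+ (n - i)) x.
Proof.
move=> Xx /andP[]; case: i => // i _; elim: i => [|i IH] i1n.
  rewrite expg1 hmulE -hexpS prednK; last by lia.
  rewrite am hone; apply: hinv_eq; rewrite -hexpS.
  have -> : (n - 1).+1 = n by lia.
  by rewrite bn.
rewrite hexpS IH; last by lia.
rewrite hmulE aE //; last by lia.
apply: hinv_eq; rewrite -hexpS; congr ((b ^+ _) x); lia.
Qed.

Let w_down x : tokset x -> (w ^+ n.-1) ((a ^+ m.-1) x) = a (s^-1 x).
Proof.
move=> Xx; rewrite bVX //; last by lia.
have -> : (n - n.-1)%N = 1%N by lia.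
rewrite expg1 -{1}[x](hKinv s) bX //; exact: sVX.
Qed.

Let w_up i x : tokset x -> (2 <= i < m)%N ->
  (w ^+ (m.-1 - i)) ((a ^+ i) x) = (a ^+ m.-1) x.
Proof.
move=> Xx /andP[i2 im]; have [k] := ubnP (m.-1 - i); elim: k i i2 im => // k IH i i2 im.
move=> ki; have [mi|mi] := eqVneq i m.-1; first by rewrite mi subnn.
have -> : (m.-1 - i)%N = (m.-1 - i.+1).+1 by lia.
rewrite hexpSr hmulE -hexpS; have -> : b^-1 ((a ^+ i.+1) x) = (a ^+ i.+1) x.
  by apply: hinv_eq; apply: bX3 => //; lia.
by apply: IH; lia.
Qed.

Let aaE x : a (a x) = (a ^+ 2) x. Proof. by []. Qed.

Let bX2V j z : (j < q)%N -> (0 < j)%N \/ ~ Q0 z ->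
  b^-1 (a (a (tok j z))) = a (a (tok j ((c j)^-1 z))).
Proof.
move=> jq jz; apply: hinv_eq; rewrite bX2 ?hKinv //.
by case: j jq jz => [|j] jq; [rewrite c0 invg1|left].
Qed.

(** Between two visits to a^(m-1) X, the row is shifted back by [s^-1] on the way down, and the
    inverse of the corresponding entry of [c] is applied on a^2 X. *)
Let w_return j z j' z' : (j < q)%N -> (j' < q)%N -> s^-1 (tok j z) = tok j' z' ->
  (0 < j')%N \/ ~ Q0 z' -> (w ^+ L) (top j z) = top j' ((c j')^-1 z').
Proof.
move=> jq jq' sE jz'.
have -> : L = (n.-1 + (1 + (m.-1 - 2)))%N by rewrite /L; lia.
rewrite hexpD w_down ?sE; last exact: Xtok.
by rewrite hexpD expg1 hmulE bX2V // aaE w_up //; exact: Xtok.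
Qed.

Let w_topS j z : (1 < j < q)%N -> (w ^+ L) (top j z) = top j.-1 ((c j.-1)^-1 z).
Proof.
move=> /andP[j1 jq]; apply: w_return => //; [lia|rewrite sVtok //; lia|left; lia].
Qed.

Let w_tops t j z : (t < j < q)%N ->
  (w ^+ (L * t)) (top j z) = top (j - t) ((\big[*%g/1]_(j - t <= i < j) c i)^-1 z).
Proof.
elim: t => [|t IH] /andP[tj jq].
  by rewrite muln0 subn0 big_geq // invg1.
rewrite mulnS addnC hexpD IH; last by lia.
rewrite w_topS; last by lia.
have -> : (j - t).-1 = (j - t.+1)%N by lia.
rewrite -hmulE -invgM; congr (top _ (homeo_fun _ z)); congr (_^-1).
rewrite [RHS]big_ltn; last by lia.
by congr (_ * \big[_/_]_(_ <= i < _) _); lia.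
Qed.

Let L2 : (1 < L)%N. Proof. by rewrite /L; lia. Qed.

Definition Rt lo hi x y := exists2 k, (lo <= k <= hi)%N & (w ^+ k) x = y.

Let RtM l h l' h' x y z : Rt l h x y -> Rt l' h' y z -> Rt (l + l') (h + h') x z.
Proof.
move=> [k kb <-] [k' kb' <-]; exists (k + k')%N; [lia|by rewrite hexpD].
Qed.

Let p z := a (a (tok 0 z)).

Let pR z : ~ R (p z).
Proof.
move=> /aR; rewrite /p => /hinj/hinj at0.
by apply: (@aX 1 (tok 0 z)); rewrite ?expg1 ?at0 //; [lia|apply: Xtok; lia|apply: Xtok; lia].
Qed.

(** [beta] is the return map of [b^-1] to the part [Q0] of token 0 of a^2 X; a detour visits a
    single point of [R]. *)
Let beta_ex : exists beta : C -> C, forall z, Q0 z -> Q0 (beta z) /\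
  (b^-1 (p z) = p (beta z) \/ R (b^-1 (p z)) /\ b^-1 (b^-1 (p z)) = p (beta z)).
Proof.
suff /choice [beta Hb] : forall z, exists z', Q0 z -> Q0 z' /\
    (b^-1 (p z) = p z' \/ R (b^-1 (p z)) /\ b^-1 (b^-1 (p z)) = p z').
  by exists beta.
move=> z; have [Qz|nQz] := pselect (Q0 z); last by exists z.
case: (bQ Qz) => [Rz|[z' Qz' E]]; last by exists z' => _; split=> //; left.
by have [z' Qz' E] := bR Rz; exists z' => _; split=> //; right.
Qed.

Let tok0_inj y z : tok 0 y = tok 0 z -> y = z.
Proof. by move=> /tok_inj; case=> //; lia. Qed.

(** Each step of [beta] takes one or two steps of [b^-1], and n of the latter lead back to the
    start. *)
Let beta_period (beta : C -> C) :
  (forall z, Q0 z -> Q0 (beta z) /\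
    (b^-1 (p z) = p (beta z) \/ R (b^-1 (p z)) /\ b^-1 (b^-1 (p z)) = p (beta z))) ->
  forall z, Q0 z -> exists2 k, (0 < k <= n)%N & iter k beta z = z.
Proof.
move=> Hb.
suff H i z z' : Q0 z -> (b^-1 ^+ i) (p z) = p z' ->
    exists2 k, (k <= i)%N && ((0 < i)%N ==> (0 < k)%N) & iter k beta z = z'.
  move=> z Qz; have [|k kn E] := H n z z Qz; first by rewrite expVgn bn invg1.
  by exists k => //; lia.
have [k] := ubnP i; elim: k i z => // k IH i z ik Qz.
case: i ik => [|i] ik; first by rewrite hone => /hinj/hinj E; exists 0%N => //; exact: tok0_inj E.
rewrite hexpSr; have [Qbz [bz|[Rbz bbz]]] := Hb z Qz.
  rewrite bz => /IH[||j ji E] //.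
  by exists j.+1; [lia|rewrite iterSr].
case: i ik => [|i] ik; first by move=> E; case: (@pR z'); rewrite -E.
rewrite hexpSr bbz => /IH[||j ji E] //; first exact: ltnW.
by exists j.+1; [lia|rewrite iterSr].
Qed.

Let top_of_p z : (w ^+ (m.-1 - 2)) (p z) = top 0 z.
Proof. by rewrite /p aaE w_up //; apply: Xtok; lia. Qed.

Let step1 (beta : C -> C) :
  (forall z, Q0 z -> Q0 (beta z) /\
    (b^-1 (p z) = p (beta z) \/ R (b^-1 (p z)) /\ b^-1 (b^-1 (p z)) = p (beta z))) ->
  forall z, Q0 z -> Rt 1 L.+1 (top 1 z) (top 0 (beta z)).
Proof.
move=> Hb z Qz; have LE : L = (n.-1 + (1 + (m.-1 - 2)))%N by rewrite /L; lia.
have wd : (w ^+ n.-1) (top 1 z) = a (tok 0 z).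
  by rewrite w_down ?sVtok //; exact: Xtok.
have [Qbz [bz|[Rbz bbz]]] := Hb z Qz.
  exists L; first by lia.
  by rewrite LE hexpD wd hexpD expg1 hmulE -/(p z) bz top_of_p.
exists L.+1; first by lia.
have -> : L.+1 = (n.-1 + (1 + (1 + (m.-1 - 2))))%N by lia.
rewrite hexpD wd hexpD expg1 hmulE -/(p z) hexpD expg1 hmulE aR // bbz.
exact: top_of_p.
Qed.

Let step1' z : ~ Q0 z -> Rt 1 L.+1 (top 1 z) (top 0 z).
Proof.
move=> nQz; exists L; first by lia.
have s1 : s^-1 (tok 1 z) = tok 0 z by rewrite sVtok.
by rewrite (w_return q0 (ltnW q0) s1 (or_intror nQz)) c0 invg1.
Qed.

Let reach_top1 j z : (0 < j < q)%N ->
  Rt 0 (L * q) (top j z) (top 1 ((\big[*%g/1]_(0 <= i < j) c i)^-1 z)).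
Proof.
move=> /andP[j0 jq]; exists (L * j.-1)%N; first by rewrite /= leq_mul2l; lia.
rewrite w_tops; last by lia.
have -> : (j - j.-1)%N = 1%N by lia.
by rewrite [in RHS]big_ltn // c0 mul1g.
Qed.

Let prod_c : \big[*%g/1]_(0 <= i < q) c i = rho^-1.
Proof. by rewrite /c sparse_prodT ?prod_e // qE leq_pmull. Qed.

(** The descent from token 0 around the row to token 1 applies [rho^-1] and then the inverse of the
    product of all the [c i], which is [rho]: the two cancel. This is the purpose of the prescribed
    product [prod_e]. *)
Let loop_top z : Rt 1 (L * q.+1) (top 0 z) (top 1 z).
Proof.
have q1 : q = q.-1.+1 by lia.
have E : (w ^+ L) (top 0 z) = top q.-1 ((c q.-1)^-1 (rho^-1 z)).
  by apply: w_return; [lia|lia|exact: sV0|left; lia].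
have [|k kb kE] := @reach_top1 q.-1 ((c q.-1)^-1 (rho^-1 z)); first by lia.
exists (L + k)%N; first by rewrite mulnS; lia.
have := prod_c; rewrite [in LHS]q1 big_nat_recr //= => PE.
suff PcE : (\big[*%g/1]_(0 <= i < q.-1) c i)^-1 ((c q.-1)^-1 (rho^-1 z)) = z.
  by rewrite hexpD E kE PcE.
by rewrite -hmulE -invgM PE invgK hKinv.
Qed.

Definition Per B y := exists2 k, (0 < k <= B)%N & (w ^+ k) y = y.

(** At most n rounds of [beta], each consisting of one loop of length at most [L * q.+1] and a
    return from token 1 to token 0 of length at most [L.+1]. *)
Let PerB := (n * (L * q.+1 + L.+1))%N.

Let top0_periodic z : Per PerB (top 0 z).
Proof.
have [beta Hb] := beta_ex.
have n0 : (0 < n)%N by lia.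
have [Qz|nQz] := pselect (Q0 z); last first.
  have [k kb kE] := RtM (loop_top z) (step1' nQz).
  by exists k => //; move: kb; rewrite /PerB => /andP[? kb]; rewrite (leq_trans kb) ?leq_pmull //; lia.
have [i ib iE] := beta_period Hb Qz.
have H j : Rt j (j * (L * q.+1 + L.+1))%N (top 0 z) (top 0 (iter j beta z)) /\ Q0 (iter j beta z).
  elim: j => [|j [IH Qj]]; first by split=> //; exists 0%N.
  split; last by case: (Hb _ Qj).
  have := RtM IH (RtM (loop_top _) (step1 Hb Qj)).
  by case=> k kb kE; exists k => //; rewrite mulSn; lia.
have [[k kb kE] _] := H i; rewrite iE in kE; exists k => //.
have : (i * (L * q.+1 + L.+1) <= PerB)%N by rewrite /PerB leq_mul2r; lia.
lia.
Qed.

Let Per_back B k y : Per B ((w ^+ k) y) -> Per B y.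
Proof.
move=> [k' kb E]; exists k' => //; apply: (@hinj (w ^+ k)).
by rewrite -hexpD addnC hexpD.
Qed.

Let reach y := exists k z, (w ^+ k) y = top 0 z.

Let reach_w k y : reach ((w ^+ k) y) -> reach y.
Proof. by move=> [i [z E]]; exists (k + i)%N, z; rewrite hexpD. Qed.

Let reach_top j z : (j < q)%N -> reach (top j z).
Proof.
move=> jq; have [->|j0] := eqVneq j 0%N; first by exists 0%N, z.
have [z' [k _ kE]] : exists z', Rt 0 (L * q) (top j z) (top 1 z').
  by eexists; apply: reach_top1; lia.
apply: (reach_w (k := k)); rewrite kE.
have [beta Hb] := beta_ex.
by have [/(step1 Hb)[i _ iE]|/step1'[i _ iE]] := pselect (Q0 z'); exists i; rewrite iE; [exists (beta z')|exists z'].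
Qed.

Let reach_up i x : tokset x -> (2 <= i < m)%N -> reach ((a ^+ i) x).
Proof.
move=> Xx ib; apply: (reach_w (k := (m.-1 - i)%N)); rewrite w_up //.
by case: Xx => j [z [jq ->]]; exact: reach_top.
Qed.

Let reach_R y : R y -> reach y.
Proof.
move=> Ry; have [z Qz E] := bR Ry; apply: (reach_w (k := 1)).
by rewrite expg1 hmulE aR // E aaE; apply: reach_up; [apply: Xtok; lia|lia].
Qed.

Let reach_aX x : tokset x -> reach (a x).
Proof.
move=> [j [z [jq ->]]]; apply: (reach_w (k := 1)); rewrite expg1 hmulE.
have up j' z' : (j' < q)%N -> reach (a (a (tok j' z'))).
  by move=> j'q; rewrite aaE; apply: reach_up; [exact: Xtok|lia].
have [[j0 Qz]|nj] := pselect (j = 0%N /\ Q0 z).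
  rewrite j0; case: (bQ Qz) => [/reach_R//|[z' _ ->]].
  by apply: up; lia.
rewrite bX2V //; first exact: up.
case: j jq nj => [|j] jq nj; [right=> Qz; exact: nj|by left].
Qed.

Let reach_E i x : (0 < i < n)%N -> tokset x -> reach ((b ^+ i) x).
Proof.
move=> ib Xx; have [i1|i1] := eqVneq i 1%N.
  by rewrite i1 expg1 -[x](hKinv s) bX; [apply: reach_aX|]; exact: sVX.
have {}ib : (1 < i < n)%N by lia.
have {i1} [k ik] := ubnP i; elim: k i ib ik => // k IH i ib ik.
apply: (reach_w (k := 1)); rewrite expg1 hmulE aE //.
have -> : b^-1 ((b ^+ i) x) = (b ^+ i.-1) x.
  by apply: hinv_eq; rewrite -hexpS prednK //; lia.
have [i2|i2] := eqVneq i 2; last by apply: IH; lia.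
by rewrite i2 expg1 -[x](hKinv s) bX; [apply: reach_aX|]; exact: sVX.
Qed.

(** The orbit of a point of [K] outside X reaches the periodic set [top 0]; as [w] is injective, the
    period passes back to the starting point. *)
Let period_out y : ~ tokset y -> Per PerB y.
Proof.
move=> nXy; have [/KE Ky|/nK[ay by_]] := pselect (K y); last first.
  exists 1%N; last by rewrite expg1 hmulE ay; exact: hinv_eq.
  by rewrite /PerB muln_gt0; lia.
suff [k [z E]] : reach y by apply: (@Per_back _ k); rewrite E; exact: top0_periodic.
case: Ky => [[i [x [im Xx yE]]]|[i [x [ib Xx ->]]]|]; last exact: reach_R.
  rewrite yE in nXy *; case: i im nXy yE => [|[|i]] im nXy yE; first by [].
    by rewrite expg1; exact: reach_aX.
  by apply: reach_up.
by apply: reach_E => //; lia.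
Qed.

(** The factorial is a multiple of all periods outside X; with the factor [q], this power of [w]
    acts on each token by a power of [rho]. *)
Definition per := (PerB`! * q)%N.

Lemma per_gt0 : (0 < per)%N.
Proof. by rewrite muln_gt0 fact_gt0 /=; lia. Qed.

Lemma w_per_supp N : (per %| N)%N -> supp (w ^+ N) tokset.
Proof.
move=> /dvdnP[N' ->] y /period_out[k kb kE].
have /dvdnP[u ->] : (k %| N' * per)%N.
  by rewrite dvdn_mull // dvdn_mulr // dvdn_fact.
by rewrite mulnC expgnA; elim: u => [//|u IH]; rewrite hexpS IH.
Qed.

(* This commutation relation separates the factors of a direct product. *)
Lemma per_commute N : (per %| N)%N -> commute (w ^+ N) ((w ^+ N) ^ a).
Proof.
move=> pN; apply: (@supp_commute _ _ tokset (im a tokset)).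
- exact: w_per_supp.
- by apply: suppJ; exact: w_per_supp.
- move=> y [Xy /imP[x Xx yE]]; apply: (@aX 1 x) => //; first by lia.
  by rewrite expg1 -yE.
Qed.

Let sparse_window u l h : (u < size e)%N -> (pos d u < l)%N -> (h <= pos d u + d)%N ->
  \big[*%g/1]_(l <= i < h) c i = 1.
Proof.
move=> uM ul hu; rewrite big_nat big1 // => i /andP[li ih].
apply: contrapT => /sparse_neq1[v vM E].
have gu := @pos_gt0 d u; have gv := @pos_gt0 d v.
have [uv|uv|uv] := ltngtP u v; last by rewrite -uv in E; lia.
  by have := posS d0 uv; lia.
by have := posS d0 uv; lia.
Qed.

Let sparse_window0 u t : (u < size e)%N -> (t < d)%N ->
  \big[*%g/1]_(pos d u + 1 - t.+1 <= i < pos d u + 1) c i = nth 1 e u.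
Proof.
move=> uM td; have gu := @pos_gt0 d u.
have -> : (pos d u + 1 - t.+1 = pos d u - t)%N by lia.
rewrite addn1 big_nat_recr /=; last by lia.
rewrite /c sparse_pos //.
rewrite [X in X * _]big_nat big1 ?mul1g // => i /andP[li ih].
apply: contrapT => /sparse_neq1[v vM E].
have gv := @pos_gt0 d v.
have [uv|uv|uv] := ltngtP u v; last by rewrite -uv in E; lia.
  by have := posS d0 uv; lia.
by have := posS d0 uv; lia.
Qed.

Let a_top j z : a (top j z) = tok j z.
Proof. by rewrite /top -hexpS prednK ?am //; lia. Qed.

(** On the row, the power of [w] shifts up by [N], while its conjugate by [a] shifts down by t+1 and
    collects the inverses of the entries of [c] that it passes. Started just above a position, the
    conjugate collects the entry there if it acts first, and nothing if it acts after the shift,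
    since the gaps exceed [N]. Commutation would thus make every entry of [e] trivial, and with them
    [rho]. *)
Lemma not_commute t : (L * t.+1 < d)%N ->
  ~ commute (w ^+ (L * t.+1)) ((w ^+ (L * t.+1)) ^ a).
Proof.
set N := (L * t.+1)%N => Nd.
have NL : (t.+1 <= N)%N by rewrite /N leq_pmull // ltnW.
have [u uM eu1] : exists2 u, (u < size e)%N & nth 1 e u <> 1.
  apply: contrapT => nu; have : rho^-1 = 1.
    rewrite -prod_e (big_nth 1) big_nat big1 // => i /andP[_ iM].
    by apply: contrapT => ei; apply: nu; exists i.
  by move=> r1; apply: (rho_inf (N := 1)) => //; rewrite expg1 -[rho]invgK r1 invg1.
move=> comm; apply: eu1; apply: homeo_ext => z.
have pu := posS d0 uM; have gu := @pos_gt0 d u.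
have jq : (pos d u + 1 + N < q)%N by rewrite qE; lia.
have B j y : (t.+1 < j < q)%N -> ((w ^+ N) ^ a) (tok j y) =
    tok (j - t.+1) ((\big[*%g/1]_(j - t.+1 <= i < j) c i)^-1 y).
  move=> jb; rewrite hconjE.
  have -> : a^-1 (tok j y) = top j y by apply: hinv_eq; exact: a_top.
  by rewrite w_tops ?a_top //; lia.
have : ((w ^+ N) ^ a) ((w ^+ N) (tok (pos d u + 1) z)) =
    (w ^+ N) (((w ^+ N) ^ a) (tok (pos d u + 1) z)).
  exact: (congr1 (fun f : homeo C => f (tok (pos d u + 1) z)) comm).
rewrite w_tok; last by lia.
rewrite B; last by lia.
rewrite B; last by lia.
rewrite sparse_window0 //; last by lia.
rewrite (@sparse_window u) //; [|lia|lia].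
rewrite w_tok; last by lia.
move=> /tok_inj[||_]; [lia|lia|rewrite invg1 hone => zE].
by rewrite [in LHS]zE hKinv.
Qed.

(** * Commutators isolating one token *)

Let good j z := (0 < j)%N \/ ~ Q0 z.

Let h := a * a * b * a^-1 * a^-1.

Let h_tok j z : (j < q)%N -> good j z -> h (tok j z) = tok j (c j z).
Proof. by move=> jq gjz; rewrite /h !hmulE bX2 // !hinvK. Qed.

Let rhoN := rho ^+ PerB`!.
Let r := w ^+ per.

Let rhoN1 : rhoN <> 1.
Proof. by apply: rho_inf; exact: fact_gt0. Qed.

Let rhoNQ0 z : Q0 z -> rhoN z = z.
Proof. by move=> Qz; rewrite /rhoN; elim: PerB`! => [//|i IH]; rewrite hexpS IH rhoQ0. Qed.

Let r_tok j z : (j < q)%N -> r (tok j z) = tok j (rhoN z).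
Proof. by move=> jq; rewrite /r /per mulnC w_tokqN. Qed.

Let r_out : supp r tokset.
Proof. exact: w_per_supp. Qed.

(** At these points [h] is not controlled, but [h^-1] preserves them and [r] fixes them, because
    [rho] is trivial on [Q0]. Hence the commutator [kap] is trivial there. *)
Let bad y := ~ exists j z, [/\ (j < q)%N, good j z & y = tok j z].

Let r_bad y : bad y -> r y = y.
Proof.
move=> By; have [[j [z [jq yE]]]|/r_out//] := pselect (tokset y).
rewrite yE r_tok //; congr tok; apply: rhoNQ0.
by apply: contrapT => nQz; apply: By; exists j, z; split=> //; right.
Qed.

Let goodc j z f : good j z -> (forall y, ~ Q0 y -> ~ Q0 (f y)) -> good j (f z).
Proof. by move=> [j0|nQ] fQ; [left|right; exact: fQ]. Qed.

Let goodcj j z : good j z -> good j (c j z).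
Proof. by case: j => [|j] gz; [rewrite c0|left]. Qed.

Let h_bad y : bad y -> bad (h^-1 y).
Proof.
move=> By [j [z [jq gjz E]]]; apply: By; exists j, (c j z); split=> //.
  exact: goodcj.
by rewrite -[y](hKinv h) E h_tok.
Qed.

Let kap := [~ r, h].

Let kap_bad y : bad y -> kap y = y.
Proof.
move=> By; rewrite hcommE.
have -> : r^-1 y = y by apply: hinv_eq; exact: r_bad.
by rewrite r_bad ?hKinv //; exact: h_bad.
Qed.

Let kap_tok j z : (j < q)%N -> kap (tok j z) = tok j ([~ rhoN, c j] z).
Proof.
move=> jq; have [gjz|ngjz] := pselect (good j z); last first.
  have j0 : j = 0%N by case: j jq ngjz => // j jq []; left.
  rewrite kap_bad ?j0 ?c0 ?commg1 // => -[i [y [iq giy E]]].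
  by apply: ngjz; have [-> ->] := tok_inj jq iq (etrans (congr1 (tok^~ z) j0) E).
rewrite !hcommE.
have nQr y : ~ Q0 y -> ~ Q0 (rhoN^-1 y).
  move=> nQy Qy; apply: nQy; rewrite -[y](hKinv rhoN) rhoNQ0 //.
have g1 := goodc gjz nQr.
have -> : r^-1 (tok j z) = tok j (rhoN^-1 z).
  by apply: hinv_eq; rewrite r_tok // hKinv.
set z1 := rhoN^-1 z in g1 *.
have g2 : good j ((c j)^-1 z1).
  by case: (j) g1 => [|i] g1; [rewrite c0 invg1|left].
have -> : h^-1 (tok j z1) = tok j ((c j)^-1 z1).
  by apply: hinv_eq; rewrite h_tok // hKinv.
set z2 := (c j)^-1 z1 in g2 *.
rewrite r_tok // h_tok //; apply: goodc g2 _ => y nQy Qy; apply: nQy.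
by rewrite -(@hinj rhoN _ _ (rhoNQ0 Qy)).
Qed.

Let conjw f j : f ^ (w ^+ j)^-1 = (w ^+ j) * (f * (w ^+ j)^-1).
Proof. by rewrite conjgE invgK. Qed.

Let wj_tok i j : (i < q)%N -> (j < q)%N ->
  exists u : homeo C, forall z, (w ^+ j) (tok i z) = tok ((i + j) %% q) (u z).
Proof.
move=> iq jq; have [ijq|ijq] := ltnP (i + j) q.
  by exists 1 => z; rewrite w_tok addnC ?modn_small // addnC.
exists rho => z; have -> : ((i + j) %% q = i + j - q)%N.
  by rewrite -{1}(subnK ijq) modnDr modn_small; lia.
have jE : j = (q.-1 - i + (1 + (i + j - q)))%N by lia.
rewrite {1}jE hexpD w_tok; last by lia.
have -> : (q.-1 - i + i)%N = q.-1 by lia.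
rewrite hexpD expg1 w_X ?sq; last by apply: Xtok; lia.
by rewrite w_tok ?addn0 //; lia.
Qed.

(** The conjugation shifts the row back, so that the action on token j is seen on token 0. *)
Let kapj j := kap ^ (w ^+ j)^-1.
Let hj j := h ^ (w ^+ j)^-1.

Let conjw_eq (f : homeo C) j y y' : f ((w ^+ j) y) = (w ^+ j) y' ->
  (f ^ (w ^+ j)^-1) y = y'.
Proof. by move=> fE; rewrite conjw !hmulE fE hinvK. Qed.

Let conjw_tok (f : homeo C) i j z k y : (w ^+ j) (tok i z) = y ->
  f y = (w ^+ j) (tok i k) -> (f ^ (w ^+ j)^-1) (tok i z) = tok i k.
Proof. by move=> <-; exact: conjw_eq. Qed.

Let kapj_tok0 j z : (j < q)%N -> kapj j (tok 0 z) = tok 0 ([~ rhoN, c j] z).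
Proof.
move=> jq; apply: conjw_tok; first by rewrite w_tok ?addn0.
by rewrite kap_tok // w_tok ?addn0.
Qed.

Let hj_tok0 j z : (0 < j < q)%N -> hj j (tok 0 z) = tok 0 (c j z).
Proof.
move=> /andP[j0 jq]; apply: conjw_tok; first by rewrite w_tok ?addn0.
by rewrite h_tok ?w_tok ?addn0 //; left.
Qed.

Let hj_fix i j z : (i < q)%N -> (j < q)%N -> ((i + j) %% q != 0)%N ->
  c ((i + j) %% q) = 1 -> hj j (tok i z) = tok i z.
Proof.
move=> iq jq ij0 cij; have [u uE] := wj_tok iq jq.
apply: (conjw_tok (uE z)); rewrite h_tok ?cij ?uE //; first by rewrite ltn_mod; lia.
by left; rewrite lt0n.
Qed.

Let S j : set C := [set x | exists i z, [/\ (i < q)%N, c ((i + j) %% q) <> 1 & x = tok i z]].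

Let kapj_supp j : (j < q)%N -> supp (kapj j) (S j).
Proof.
move=> jq y nSy; have [[i [z [iq yE]]]|nXy] := pselect (tokset y).
  have cij : c ((i + j) %% q) = 1.
    by apply: contrapT => cij; apply: nSy; exists i, z.
  have [u uE] := wj_tok iq jq.
  rewrite yE; apply: (conjw_tok (uE z)).
  by rewrite kap_tok ?cij ?commg1 ?uE // ltn_mod; lia.
apply: conjw_eq; apply: kap_bad => -[i [z [iq _ E]]].
by apply: nXy; apply: (wVXi (i := j)); rewrite E; exact: Xtok.
Qed.

Let Y0 y : Y y -> exists z, y = tok 0 z.
Proof. by move=> /YE[z ->]; exists z. Qed.

Let Y_tok0 z : Y (tok 0 z).
Proof. by apply/YE; exists z. Qed.

Let Phi_tok0 f z : Phi f (tok 0 z) = tok 0 (f z).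
Proof. by rewrite /tok !hone Phi_phi. Qed.

(* Since the positions of the nontrivial entries of [c] form a Sidon set, only
   the token [0] survives in this commutator. *)
Let isolate_token i j : (i < size e)%N -> (j < size e)%N -> i <> j ->
  [~ kapj (pos d i), hj (pos d j)] = Phi [~ [~ rhoN, c (pos d i)], c (pos d j)].
Proof.
move=> iM jM ij.
have pi_ := posS d0 iM; have pj_ := posS d0 jM.
have gi := @pos_gt0 d i; have gj := @pos_gt0 d j.
have iq : (pos d i < q)%N by lia.
have jq : (pos d j < q)%N by lia.
have hY y : Y y -> Y (hj (pos d j) y).
  by move=> /Y0[z ->]; rewrite hj_tok0 ?Y_tok0 //; lia.
have hVY z : (hj (pos d j))^-1 (tok 0 z) = tok 0 ((c (pos d j))^-1 z).
  by apply: hinv_eq; rewrite hj_tok0 ?hKinv //; lia.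
have kVY z : (kapj (pos d i))^-1 (tok 0 z) = tok 0 ([~ rhoN, c (pos d i)]^-1 z).
  by apply: hinv_eq; rewrite kapj_tok0 ?hKinv.
(* By [sparse_disjoint], on the support of the first conjugate outside token 0 the second one acts
   through a trivial entry of [c], and never through the token 0 where [h] is uncontrolled. *)
have hS y : S (pos d i) y -> ~ Y y -> hj (pos d j) y = y.
  move=> [k [z [kq ck yE]]] nYy.
  have k0 : k <> 0%N by move=> k0; apply: nYy; rewrite yE k0.
  rewrite yE; apply: hj_fix => //.
    apply/negP => E; apply: k0; apply: (@sparse_disjoint _ e d d0 q i j k) => //.
      by rewrite qE.
    by rewrite E.
  apply: contrapT => /eqP E; apply: k0.
  apply: (@sparse_disjoint _ e d d0 q i j k) => //; first by rewrite qE.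
  by rewrite -/c E orbT.
apply: homeo_ext => y; have [/Y0[z ->]|nYy] := pselect (Y y).
  by rewrite Phi_tok0 !hcommE kVY hVY kapj_tok0 // hj_tok0 //; lia.
rewrite Phi_supp // hcommE.
have sk := kapj_supp iq.
set k := kapj (pos d i) in sk *; set g := hj (pos d j) in hY hVY hS *.
have kY x : Y x -> Y (k x) by move=> /Y0[z ->]; rewrite /k kapj_tok0.
have hVYs x : Y (g x) -> Y x.
  by move=> /Y0[z E]; have := hinvK g x; rewrite E hVY => <-.
have [Sy|nSy] := pselect (S (pos d i) y).
  have Sky : S (pos d i) (k^-1 y) by apply/(supp_stable _ (suppV sk)).
  have nYky : ~ Y (k^-1 y) by move=> /kY; rewrite hKinv.
  have -> : g^-1 (k^-1 y) = k^-1 y by apply: hinv_eq; exact: hS.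
  by rewrite hKinv hS.
rewrite (suppV sk) // (sk (g^-1 y)) ?hKinv // => Sg.
apply: nSy; have nYg : ~ Y (g^-1 y) by move=> /hY; rewrite hKinv.
by move: (hS _ Sg nYg); rewrite hKinv => ->.
Qed.

Section Subgroup.
Variable H : set (homeo C).
Hypotheses (sH : subgroup H) (HG : H `<=` G) (Ha : H a) (Hb : H b).

Let Hw : H w. Proof. by apply: sgM => //; exact: sgV. Qed.
Let Hh : H h. Proof. by rewrite /h; do !apply: sgM => //; exact: sgV. Qed.
Let Hhj j : H (hj j).
Proof. by apply: sgJ => //; apply: sgV => //; exact: sgX. Qed.
Let Hkapj j : H (kapj j).
Proof. by apply: sgJ; [|apply: sgR => //; exact: sgX|apply: sgV => //; exact: sgX]. Qed.

Let PhiM f g : Phi (f * g) = Phi f * Phi g.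
Proof.
apply: homeo_ext => y; have [/YE[x ->]|nYy] := pselect (Y y).
  by rewrite hmulE !Phi_phi.
by rewrite hmulE !Phi_supp.
Qed.

Let Phi1 : Phi 1 = 1.
Proof. by apply: (@mulgI _ (Phi 1)); rewrite -PhiM !mulg1. Qed.

Let PhiV f : Phi f^-1 = (Phi f)^-1.
Proof. by apply: (@mulgI _ (Phi f)); rewrite -PhiM !mulgV. Qed.

Let Phi_c i f : (i < size e)%N -> (Phi f) ^ (hj (pos d i)) = Phi (f ^ c (pos d i)).
Proof.
move=> iM; have pi_ := posS d0 iM; have gi := @pos_gt0 d i.
have ib : (0 < pos d i < q)%N by lia.
apply: homeo_ext => y; have [/Y0[z ->]|nYy] := pselect (Y y).
  have {1}-> : tok 0 z = hj (pos d i) (tok 0 ((c (pos d i))^-1 z)).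
    by rewrite hj_tok0 // hKinv.
  by rewrite hconj !Phi_tok0 hj_tok0.
rewrite Phi_supp // hconjE Phi_supp ?hKinv // => /Y0[z E].
by apply: nYy; rewrite -[y](hKinv (hj (pos d i))) E hj_tok0.
Qed.

(** The elements of [G] whose copy on token 0 lies in [H] form a normal subgroup, as the conjugates
    [hj] act on this token by the entries of [e1], which generate [G]. It is nontrivial by
    [isolate_token], applied to one position in the first copy of [e1] and one in the second, so
    that they differ. *)
Lemma Phi_sub f : G f -> H (Phi f).
Proof.
pose N := [set g | G g /\ H (Phi g)].
have cE i : (i < size e)%N -> c (pos d i) = nth 1 e i.
  by move=> iM; rewrite /c sparse_pos.
have Ge1 x : x \in e1 -> G x by move=> xe; rewrite -e1G; exact: sub_generated.
have sz : size e = (size e1 + (size e1 + size e2))%N by rewrite !size_cat.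
have sN : subgroup N.
  apply: subgroup_mk.
  - by split; [exact: sg1|rewrite Phi1; exact: sg1].
  - by move=> x y [Gx Hx] [Gy Hy]; split; [exact: sgM|rewrite PhiM; exact: sgM].
  - by move=> x [Gx Hx]; split; [exact: sgV|rewrite PhiV; exact: sgV].
have Nc i x : (i < size e1)%N -> N x -> N (x ^ nth 1 e i) /\ N (x ^ (nth 1 e i)^-1).
  move=> ie [Gx Hx]; have iM : (i < size e)%N by lia.
  have Gi : G (nth 1 e i) by rewrite nth_cat ie; apply: Ge1; exact: mem_nth.
  rewrite -cE //; split; split; try by apply: (sgJ sG); rewrite ?cE //; exact: sgV.
    by rewrite -Phi_c //; exact: sgJ.
  rewrite (_ : Phi _ = (Phi x) ^ (hj (pos d i))^-1); first by apply: sgJ => //; exact: sgV.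
  by apply: (canRL (conjgK _)); rewrite Phi_c // conjgKV.
suff NG : N = G by rewrite -{1}NG => -[].
apply: (simple_normalE simG).
  split=> //; first by move=> x [].
  move=> x y Nx Gy.
  suff : [set y | forall x, N x -> N (x ^ y) /\ N (x ^ y^-1)] y by move=> /(_ x Nx)[].
  move: y Gy; rewrite -{1}e1G; apply: generated_min.
    apply: subgroup_mk.
    - by move=> u Nu; rewrite invg1 conjg1.
    - move=> u v Hu Hv t Nt; rewrite invgM !conjgM; split.
        by have [/Hv[]] := Hu _ Nt.
      by have [_ /Hu[]] := Hv _ Nt.
    - by move=> u Hu t Nt; rewrite invgK; have [] := Hu _ Nt.
  move=> u /= ue t Nt; have ie : (index u e1 < size e1)%N by rewrite index_mem.
  have <- : nth 1 e (index u e1) = u by rewrite nth_cat ie nth_index.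
  exact: Nc.
have e1_index z : z <> 1 -> exists2 i, (i < size e1)%N & [~ z, nth 1 e1 i] <> 1.
  move=> z1; have [g' ge zg] := centerless vigG e1G z1.
  by exists (index g' e1); rewrite ?index_mem // nth_index.
have [i ie ki] := e1_index _ rhoN1.
have [j je kj] := e1_index _ ki.
have iM : (i < size e)%N by lia.
have jM : (size e1 + j < size e)%N by lia.
have ci : c (pos d i) = nth 1 e1 i by rewrite cE // nth_cat ie.
have cj : c (pos d (size e1 + j)) = nth 1 e1 j.
  by rewrite cE // nth_cat ltnNge leq_addr /= addKn nth_cat je.
exists [~ [~ rhoN, nth 1 e1 i], nth 1 e1 j] => //; split.
  have GrN : G rhoN by exact: sgX.
  by apply: sgR; [|apply: sgR|]; rewrite //; apply: Ge1; exact: mem_nth.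
rewrite -ci -cj -isolate_token //; last by lia.
exact: sgR.
Qed.

Hypothesis cK : clopen K.
Hypothesis R0 : R !=set0.
Hypothesis nQ0 : (~` Q0) !=set0.

Lemma D_sub : D G K `<=` H.
Proof.
have HDY : D G Y `<=` H by move=> f /Phi_D[g Gg ->]; exact: Phi_sub.
have Fa x : G x -> full G x by exact: G_full.
have DJ h' Z : H h' -> D G Z `<=` H -> D G (im h' Z) `<=` H.
  move=> Hh' DZ f Df; rewrite -[f](conjgKV h'); apply: sgJ => //.
  apply: DZ; rewrite -[Z](imK h'); apply: D_J => //.
  by apply: G_full; apply: sgV => //; exact: HG.
(* [Z1] is token 0 of a^2 X. Its image under [b] contains [R], whose points [a] fixes, and meets
   [Z1] in the points [p z] with z outside [Q0], which [b] fixes. These are the intersections needed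
   by [D_union] and [D_cover]. *)
pose Z1 := im (a * a) Y; pose Z := Z1 `|` im b Z1.
have pE z : Z1 (p z) by apply: (eq_ind_r id (Y_tok0 z)); rewrite /Z1 -[p z]/((a * a) (tok 0 z)) imE.
have D1 : D G Z1 `<=` H by apply: DJ => //; exact: sgM.
have D2 : D G (im b Z1) `<=` H by exact: DJ.
have c1 : clopen Z1 by exact: im_clopen.
have [z nQz] := nQ0.
have bpz : b (p z) = p z by rewrite /p bX2 ?c0 //; [lia|right].
have DZ : D G Z `<=` H.
  apply: D_union => //; first exact: im_clopen.
  by exists (p z); split=> //; rewrite -bpz imE.
have RZ y : R y -> Z y.
  move=> Ry; have [z' _ E] := bR Ry; right.
  by rewrite -[y](hKinv b) imE E; exact: pE.
have cZ : clopen Z by apply: clopenU => //; exact: im_clopen.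
apply: (@D_cover G sG simG vigG H [set x | x = a \/ x = b] Z) => //.
- by move=> x [->|->].
- move=> x [->|->].
    by case: R0 => y Ry; exists y; split; [exact: RZ|rewrite -[y]aR // imE; exact: RZ].
  by exists (p z); split; [left|rewrite -bpz imE; left].
set T := generated _.
have sT : subgroup T by exact: generated_subgroup.
have Ta : T a by apply: sub_generated; left.
have Tb : T b by apply: sub_generated; right.
have XZ x : tokset x -> exists2 h', T h' & im h' Z x.
  move=> [j [y [jq ->]]]; exists (a^-1 * a^-1 * w ^+ j).
    apply: (sgM sT); last by apply: (sgX _ sT); apply: (sgM sT) => //; exact: (sgV sT).
    by apply: (sgM sT); exact: (sgV sT).
  have <- : (a^-1 * a^-1 * w ^+ j) (p y) = tok j y.
    by rewrite !hmulE /p !hinvK w_tok addn0.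
  by rewrite imE; left.
have XZ' x g : T g -> tokset x -> exists2 h', T h' & im h' Z (g x).
  move=> Tg /XZ[h2 Th2 hx]; exists (h2 * g); first exact: (sgM sT).
  by rewrite imM imE.
move=> y /KE[[i [x [_ Xx ->]]]|[i [x [_ Xx ->]]]|/RZ Zy].
- by apply: XZ' => //; exact: (sgX _ sT).
- by apply: XZ' => //; exact: (sgX _ sT).
- by exists 1; [exact: (sg1 sT)|].
Qed.

End Subgroup.

Lemma two_generators_criterion : clopen K -> R !=set0 -> (~` Q0) !=set0 ->
  [/\ forall H, subgroup H -> H `<=` G -> H a -> H b -> D G K `<=` H,
      exists2 N0, (0 < N0)%N &
        forall N, (N0 %| N)%N -> commute (w ^+ N) ((w ^+ N) ^ a) &
      forall t, (L * t.+1 < d)%N ->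
        ~ commute (w ^+ (L * t.+1)) ((w ^+ (L * t.+1)) ^ a)].
Proof.
move=> cK R0 nQ0; split; last exact: not_commute.
  by move=> H sH HG Ha Hb; exact: D_sub.
by exists per; [exact: per_gt0|exact: per_commute].
Qed.

End Dynamics.

(** * Construction of the generators *)

Section Rows.
Variable G : set (homeo C).
Hypothesis sG : subgroup G.
Hypothesis simG : simple_group G.
Hypothesis vigG : vigorous G.

Lemma clopen_tokens gam U k : clopen U -> clopen (tokens gam U k).
Proof.
move=> cU; elim: k => [|k IH].
  by rewrite (_ : tokens _ _ _ = set0); [exact: clopen0|apply/seteqP; split=> // x [i []]].
rewrite (_ : tokens _ _ _ = tokens gam U k `|` im (gam k) U).
  by apply: clopenU => //; exact: im_clopen.
apply/seteqP; split=> [x [i [ik gx]]|x [[i [ik gx]]|gx]].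
- have [ik'|ik'] := ltnP i k; first by left; exists i.
  by right; have <- : i = k by lia.
- by exists i; split=> //; exact: leqW.
- by exists k.
Qed.

Lemma token_row S q' : clopen S -> S !=set0 -> (~` S) !=set0 -> (0 < q')%N ->
  let q := (2 * q')%N in
  exists (phi : C -> C) (Y : set C) (Phi : homeo C -> homeo C) (pi : homeo C),
  [/\ [/\ clopen Y, injective phi & forall y, Y y <-> exists x, y = phi x],
      [/\ forall Q, clopen Q -> clopen (phi @` Q),
          forall f x, Phi f (phi x) = phi (f x), forall f, supp (Phi f) Y,
          forall f, G f -> G (Phi f) &
          forall f, D G Y f -> exists2 g, G g & f = Phi g],
      [/\ full G pi, pi ^+ q = 1, supp pi (tokset phi q pi) & tokset phi q pi `<=` S],
      [/\ clopen (tokset phi q pi), forall i j y z, (i < q)%N -> (j < q)%N ->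
          tok phi pi i y = tok phi pi j z -> i = j /\ y = z &
          forall i, (0 < i < q)%N -> Y `&` im (pi ^+ i) Y = set0] &
      exists U g, [/\ full G g, clopen U, U `&` im g U = set0 &
        U `|` im g U = tokset phi q pi]].
Proof.
move=> cS S0 nS0 q'0 q.
have q0 : (0 < q)%N by rewrite /q; lia.
have [T [T1 T2]] := spots cS S0.
have [cT0 T00 TS0] := T1 0%N.
have nT0 : (~` T 0%N) !=set0.
  by have [_ [x T1x] _] := T1 1%N; exists x => Tx; exact: (disE (T2 0%N 1%N isT) Tx T1x).
have [phi [Y [Phi [[cY YT phi_inj YE] Phi_cl Phi_phi Phi_supp [Phi_G Phi_D]]]]] :=
  compression sG simG vigG cT0 T00 nT0.
have Y0 : Y !=set0 by exists (phi point); apply/YE; exists point.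
have /choice [gam0 Hg] : forall i, exists g, G g /\ forall x, Y x -> T i.+1 (g x).
  move=> i; have [cTi Ti0 _] := T1 i.+1.
  have YTi : Y `&` T i.+1 = set0 by apply: (disS (T2 0%N i.+1 isT)).
  by have [g [Gg gY _]] := vig_disj vigG cY Y0 cTi Ti0 YTi; exists g.
pose gam i := if i is i'.+1 then gam0 i' else 1.
have gG i : G (gam i) by case: i => [|i]; [exact: sg1|case: (Hg i)].
have gT i : im (gam i) Y `<=` T i.
  by case: i => [//|i] _ /imP[x Yx ->]; case: (Hg i) => _; exact.
have gdis i j : i != j -> im (gam i) Y `&` im (gam j) Y = set0.
  by move=> ij; apply: (disS (T2 i j ij)).
have [pi Fpi cpi] : exists2 c, full G c & is_cyc gam Y q c.
  apply: cyc_ex => //; first exact: full_subgroup.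
  - by move=> i j _ _; exact: gdis.
  - move=> i /andP[i0 _]; apply: swap_ex => //; first exact: G_full.
    by apply: (gdis 0%N i); rewrite ltn_eqF.
have g0 : gam 0%N = 1 by [].
have Yphi z : Y (phi z) by apply/YE; exists z.
have tokE i z : (i < q)%N -> tok phi pi i z = gam i (phi z).
  by move=> iq; rewrite /tok (cyc_pow g0 cpi).
have piY i : (i < q)%N -> im (pi ^+ i) Y = im (gam i) Y.
  move=> iq; apply/seteqP; split=> _ /imP[x Yx ->].
    by rewrite (cyc_pow g0 cpi) // imE.
  by rewrite -(cyc_pow g0 cpi) // imE.
have XE : tokset phi q pi = tokens gam Y q.
  apply/seteqP; split=> [x [i [z [iq ->]]]|x [i [iq /imP[y /YE[z ->] ->]]]].
    by exists i; split=> //; rewrite tokE // imE.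
  by exists i, z; rewrite tokE.
exists phi, Y, Phi, pi; split=> //.
- rewrite XE; split=> //; first exact: cyc_powm cpi.
    by case: cpi.
  by move=> x [i [_ /gT Tx]]; case: (T1 i) => _ _; exact.
- split; first by rewrite XE; exact: clopen_tokens.
  + move=> i j y z iq jq; rewrite !tokE // => E.
    have [ij|ij] := eqVneq i j; first by rewrite ij in E *; split=> //; apply: phi_inj; exact: hinj E.
    have := gdis i j ij => /(disE (x := gam i (phi y))); rewrite imE => /(_ (Yphi y)) [].
    by rewrite E imE.
  + move=> i /andP[i0 iq]; rewrite piY //; apply: (gdis 0%N i); by rewrite ltn_eqF.
(* The number of tokens is even: the first half of the row is carried to the second by [pi ^+ q'],
   the form that [even_swap] asks for. *)
pose U := tokens gam Y q'.
have UE : im (pi ^+ q') U = [set x | exists i, (q' <= i < q)%N /\ im (gam i) Y x].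
  apply/seteqP; split=> [_ /imP[x [i [iq' /imP[y Yy ->]]] ->]|x [i [/andP[qi iq] /imP[y Yy ->]]]].
    exists (i + q')%N; split; first by rewrite /q; lia.
    rewrite -(cyc_pow g0 cpi) // -?hexpD ?(cyc_pow g0 cpi) ?imE //; rewrite /q; lia.
  have iE : i = (i - q' + q')%N by rewrite subnK.
  rewrite -(cyc_pow g0 cpi) // iE hexpD imE (cyc_pow g0 cpi) //; last by rewrite /q in iq; lia.
  by exists (i - q')%N; rewrite imE; split=> //; rewrite /q in iq; lia.
exists U, (pi ^+ q'); split.
- by apply: (sgX _ (full_subgroup sG)).
- exact: clopen_tokens.
- rewrite UE; apply: disI => x [i [iq gx]] [j [/andP[qj jq] gx']].
  by apply: (disE (gdis i j _) gx gx'); rewrite ltn_eqF // (leq_trans iq).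
- rewrite UE XE; apply/seteqP; split=> [x [[i [iq gx]]|[i [/andP[_ iq] gx]]]|x [i [iq gx]]].
  + by exists i; split=> //; rewrite /q; lia.
  + by exists i.
  + by have [iq'|iq'] := ltnP i q'; [left|right]; exists i; rewrite ?iq'.
Qed.

(** The factor for each token is a conjugate of a copy of [c j] by a power of [pi]; it lies in [G]
    because [G] is normalized by its full group. *)
Lemma lamp_homeo (phi : C -> C) (Y : set C) (Phi : homeo C -> homeo C) pi q n (c : nat -> homeo C) :
  (forall y, Y y <-> exists x, y = phi x) ->
  (forall f x, Phi f (phi x) = phi (f x)) -> (forall f, supp (Phi f) Y) ->
  (forall f, G f -> G (Phi f)) -> full G pi ->
  (forall i j y z, (i < q)%N -> (j < q)%N ->
          tok phi pi i y = tok phi pi j z -> i = j /\ y = z) ->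
  (forall j, G (c j)) -> (forall j, c j ^+ n = 1) -> c 0%N = 1 ->
  exists t, [/\ G t, t ^+ n = 1,
    forall j z, (j < q)%N -> t (tok phi pi j z) = tok phi pi j (c j z) &
    supp t [set x | exists j z, (0 < j < q)%N /\ x = tok phi pi j z]].
Proof.
move=> YE Phi_phi Phi_supp Phi_G Fpi tok_inj Gc cn c0.
have Phi1 f : f = 1 -> Phi f = 1.
  move=> ->; apply: homeo_ext => y; have [/YE[x ->]|nYy] := pselect (Y y).
    by rewrite Phi_phi.
  by rewrite Phi_supp.
have PhiX f k : Phi f ^+ k = Phi (f ^+ k).
  elim: k => [|k IH]; first by rewrite !expg0 Phi1.
  apply: homeo_ext => y; have [/YE[x ->]|nYy] := pselect (Y y).
    by rewrite hexpS IH !Phi_phi hexpS.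
  by rewrite hexpS IH !Phi_supp.
suff H k : (k <= q)%N -> exists t, [/\ G t, t ^+ n = 1,
    forall j z, (j < k)%N -> t (tok phi pi j z) = tok phi pi j (c j z) &
    supp t [set x | exists j z, (0 < j < k)%N /\ x = tok phi pi j z]] by exact: H.
elim: k => [|k IH] kq.
  by exists 1; split=> //; [exact: sg1|rewrite expg1n].
have [t [Gt tn tt st]] := IH (ltnW kq).
pose u := Phi (c k) ^ (pi ^+ k).
have utok z : u (tok phi pi k z) = tok phi pi k (c k z).
  by rewrite /u /tok hconj Phi_phi.
have su : supp u [set x | exists z, (0 < k)%N /\ x = tok phi pi k z].
  have [k0|k0] := eqVneq k 0%N; first by rewrite /u k0 Phi1 // conj1g.
  apply: (suppW (suppJ (g := pi ^+ k) (Phi_supp (c k)))) => _ /imP[y /YE[z ->] ->].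
  by exists z; rewrite lt0n.
have tu : commute t u.
  apply: (supp_commute st su) => x [[j [z [jk ->]]] [z' [_ E]]].
  by have [||jE _] := tok_inj _ _ _ _ _ _ E; lia.
exists (t * u); split.
- apply: sgM => //; apply: G_normal_full => //; first exact: Phi_G.
  by apply: (sgX _ (full_subgroup sG)).
- by rewrite expgMn // tn mul1g /u -conjXg PhiX cn Phi1 // conj1g.
- move=> j z jk; rewrite hmulE; have [jk'|jk'] := ltnP j k.
    rewrite tt // su // => -[z' [_ E]].
    by have [||jE _] := tok_inj _ _ _ _ _ _ E; lia.
  have -> : j = k by lia.
  rewrite st ?utok // => -[i [z' [ik E]]].
  by have [||jE _] := tok_inj _ _ _ _ _ _ E; lia.
- apply: suppM; [apply: (suppW st)|apply: (suppW su)].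
    by move=> x [j [z [/andP[j0 jk] ->]]]; exists j, z; rewrite j0 ltnW.
  by move=> x [z [k0 ->]]; exists k, z; rewrite k0 /=.
Qed.

Lemma is_cyc_uniq gam U k c c' : (0 < k)%N ->
  is_cyc gam U k c -> is_cyc gam U k c' -> c = c'.
Proof.
move=> k0 [c1 c2 c3] [c1' c2' c3']; apply: homeo_ext => x.
have [[i [ik /imP[y Uy ->]]]|nx] := pselect (tokens gam U k x); last by rewrite c3 ?c3'.
have [ik'|ik'] := ltnP i.+1 k; first by rewrite c1 ?c1'.
have -> : i = k.-1 by lia.
by rewrite c2 ?c2'.
Qed.

End Rows.

(** * The two generators on a clopen set *)

Section Core.
Variable G : set (homeo C).
Hypothesis sG : subgroup G.
Hypothesis simG : simple_group G.
Hypothesis vigG : vigorous G.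
Hypothesis fgG : finitely_generated G.
Implicit Types (f : homeo C) (Z K R : set C) (x y : C).

Definition stable (f : homeo C) (Z : set C) := forall x, Z (f x) <-> Z x.

(** Such a set stays invariant under the generators added later, which move only points outside [K]
    or in [R]. *)
Definition blocked (K R : set C) (P : set (homeo C)) :=
  exists Z, [/\ Z !=set0, Z `<=` K, Z `&` R = set0 & forall f, P f -> stable f Z].

Lemma stable_periodic f Z k : (0 < k)%N -> f ^+ k = 1 ->
  (forall x, Z x -> Z (f x)) -> stable f Z.
Proof.
move=> k0 fk fZ x; split=> [Zfx|]; last exact: fZ.
have fi i y : Z y -> Z ((f ^+ i) y).
  by move=> Zy; elim: i => [//|i IH]; rewrite hexpS; exact: fZ.
have <- : (f ^+ k.-1) (f x) = x by rewrite -hexpSr prednK // fk.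
exact: fi.
Qed.

Lemma stable_fixes f Z : (forall x, Z x -> f x = x) -> stable f Z.
Proof.
move=> fZ x; split=> [Zfx|Zx]; last by rewrite fZ.
by have /hinj E := fZ _ Zfx; rewrite -E.
Qed.

Lemma two_generators m n d K : (3 <= m)%N -> (2 <= n)%N -> (2 <= d)%N ->
  clopen K -> K !=set0 ->
  exists (a b : homeo C) (R : set C),
  [/\ [/\ G a /\ G b, a ^+ m = 1 /\ b ^+ n = 1, supp a K /\ supp b K,
          forall j, (0 < j < m)%N -> a ^+ j <> 1 &
          forall j, (0 < j < n)%N -> b ^+ j <> 1],
      [/\ clopen R, R !=set0, R `<=` K & fixes a R],
      blocked K R [set a] /\ blocked K R [set b],
      [/\ forall H, subgroup H -> H `<=` G -> H a -> H b -> D G K `<=` H,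
          exists2 N0, (0 < N0)%N &
            forall N, (N0 %| N)%N -> commute (w a b ^+ N) ((w a b ^+ N) ^ a) &
          forall t, ((m + n - 3) * t.+1 < d)%N ->
            ~ commute (w a b ^+ ((m + n - 3) * t.+1)) ((w a b ^+ ((m + n - 3) * t.+1)) ^ a)] &
      m = 3 -> n = 2 -> exists a1 a2, [/\ G a1 /\ G a2, a = a1 * a2,
        [/\ a1 <> 1, a2 <> 1, a1 ^+ 2 = 1 & a2 ^+ 2 = 1],
        supp a1 K /\ supp a2 K &
        [/\ blocked K R [set a2; b], blocked K R [set a1; b] & blocked K R [set a1; a2]]]].
Proof.
move=> m3 n2 d2 cK K0.
have sF := full_subgroup sG.
have [A [Q0 [cA cQ0 A0 Q00 [AQ AI]]]] :=
  clopen_split clopenT (ex_intro setT point I : [set: C] !=set0).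
have [rho [Grho srho rho_inf]] := infinite_order vigG cA A0.
have rhoQ0 z : Q0 z -> rho z = z by move=> Qz; apply: srho => Az; exact: (disE AI Az Qz).
have nQ0 : (~` Q0) !=set0 by case: A0 => x Ax; exists x => Qx; exact: (disE AI Ax Qx).
have [e1 [e2 [eT e1G pe]]] := torsion_list sG simG vigG n2 fgG (sgV sG Grho).
pose e := e1 ++ e1 ++ e2; pose c := sparse e d.
have d0 : (0 < d)%N by lia.
have c_e j : c j = 1 \/ c j \in e.
  have [?|cj] := pselect (c j = 1); [by left|right].
  by have [i ie jE] := sparse_neq1 cj; rewrite jE /c sparse_pos // mem_nth.
have eT' f : f \in e -> G f /\ f ^+ n = 1.
  by rewrite !mem_cat => fe; apply: eT; rewrite mem_cat; case/or3P: fe => ->; rewrite ?orbT.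
have Gc j : G (c j) by case: (c_e j) => [->|/eT'[]//]; exact: sg1.
have cn j : c j ^+ n = 1 by case: (c_e j) => [->|/eT'[]//]; rewrite expg1n.
have csmall j : (j < d)%N -> c j = 1.
  move=> jd; apply: contrapT => /sparse_neq1[i _ E].
  by have := @pos_gt0 d i; rewrite -E; lia.
pose q' := pos d (size e); pose q := (2 * q')%N.
have q'd : (d <= q')%N by exact: pos_gt0.
have [S [S1 S2]] := spots cK K0.
have dS i j x : i != j -> S i x -> S j x -> False by move=> /S2; exact: disE.
have SK i x : S i x -> K x by case: (S1 i) => _ _; exact.
have [cS0 S00 _] := S1 0%N.
have nS i : (~` S i) !=set0.
  have [_ [x Sx] _] := S1 i.+1; exists x => Sx'; apply: (dS i i.+1 x) => //.
  by rewrite ltn_eqF.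
have q'0 : (0 < q')%N by lia.
have [phi [Y [Phi [pi [[cY phi_inj YE] [Phi_cl Phi_phi Phi_supp Phi_G Phi_D]
  [Fpi piq spi XS] [cX tok_inj piY] [U [g [Fg cU UgU UX]]]]]]]] :=
  token_row sG simG vigG cS0 S00 (nS 0%N) q'0.
rewrite -/q in piq spi XS cX tok_inj piY UX.
pose X := tokset phi q pi; rewrite -/X in spi XS cX UX.
pose tk := tok phi pi.
have Xtok j z : (j < q)%N -> X (tk j z) by move=> jq; exists j, z.
have qgt1 : (1 < q)%N by rewrite /q; lia.
have X0 : X !=set0 by exists (tk 0 point); apply: Xtok; lia.
have /choice [gam0 Hg] : forall i, exists g, G g /\ forall x, X x -> S i.+1 (g x).
  move=> i; have [cSi Si0 _] := S1 i.+1.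
  have XSi : X `&` S i.+1 = set0 by apply: (disS (S2 0%N i.+1 isT)).
  by have [h [Gh hX _]] := vig_disj vigG cX X0 cSi Si0 XSi; exists h.
pose gam i := if i is i'.+1 then gam0 i' else 1.
have gG i : G (gam i) by case: i => [|i]; [exact: sg1|case: (Hg i)].
have gS i x : X x -> S i (gam i x).
  by move=> Xx; case: i => [|i]; [exact: XS|case: (Hg i) => _; exact].
have gIm i x : im (gam i) X x -> S i x by move=> /imP[y Xy ->]; exact: gS.
have gdis i j : i != j -> im (gam i) X `&` im (gam j) X = set0.
  by move=> ij; apply: disI => x /gIm Si /gIm Sj; exact: (dS i j x).
have swG i : (0 < i)%N -> exists2 s, G s & is_swap X (gam i) s.
  move=> i0; have di : X `&` im (gam i) X = set0.
    by apply: (gdis 0%N i); rewrite ltn_eqF.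
  have [s Fs ss] := swap_ex sG (G_full (gG i)) cX di; exists s => //.
  apply: (even_swap sG simG vigG Fg (G_full (gG i)) cU UgU); rewrite UX //.
  have [_ [x Sx] _] := S1 i.+1; exists x => -[/XS Sx'|/gIm Sx'].
    by apply: (dS 0%N i.+1 x).
  by apply: (dS i i.+1 x) => //; rewrite ltn_eqF.
(* The cycle of [b] shares only X and aX with that of [a]; the offset m puts its other copies into
   sets [S] that the cycle of [a] does not use. *)
pose gB i := if (i <= 1)%N then gam i else gam (m + i)%N.
have gBS i x : X x -> exists2 k, S k (gB i x) & k = i /\ (i <= 1)%N \/ k = (m + i)%N /\ (1 < i)%N.
  move=> Xx; rewrite /gB; case: ifP => i1.
    by exists i; [exact: gS|left].
  by exists (m + i)%N; [exact: gS|right; split=> //; lia].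
have gBdis i j : i != j -> im (gB i) X `&` im (gB j) X = set0.
  by move=> ij; rewrite /gB; case: ifP => i1; case: ifP => j1; apply: gdis; lia.
have [a Ga ca] : exists2 a, G a & is_cyc gam X m a.
  apply: cyc_ex => //; first by lia.
  - by move=> i j _ _; exact: gdis.
  - by move=> i /andP[i0 _]; exact: swG.
have [cB GcB ccB] : exists2 a, G a & is_cyc gB X n a.
  apply: cyc_ex => //; first by lia.
  - by move=> i j _ _; exact: gBdis.
  - by move=> i /andP[i0 _]; rewrite /gB; case: ifP => _; apply: swG; lia.
have g00 : gam 0%N = 1 by [].
have gB0 : gB 0%N = 1 by [].
have aE i x : (i < m)%N -> X x -> (a ^+ i) x = gam i x by exact: cyc_pow.
have am : a ^+ m = 1 by apply: cyc_powm ca => //; lia.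
pose TA := tokens gam X m; pose TB := tokens gB X n.
have sa : supp a TA by case: ca.
have TAS x : TA x -> exists2 i, (i < m)%N & S i x.
  by move=> [i [im_ /gIm Si]]; exists i.
have TBS x : TB x -> exists2 k, S k x & (k <= 1)%N \/ (m + 1 < k)%N.
  move=> [i [im_ /imP[y Xy ->]]]; have [k Sk kE] := gBS i y Xy.
  by exists k => //; lia.
have XTB x : X x -> TB x by move=> Xx; exists 0%N; split=> //; lia.
pose s := pi * Phi rho.
have Fs : full G s by apply: (sgM sF) => //; apply: G_full; exact: Phi_G.
have YX x : Y x -> X x.
  by move=> /YE[z ->]; apply: (Xtok 0%N z); lia.
have ss : supp s X by apply: suppM => //; exact: suppW (Phi_supp rho) YX.
have Xs x : X (s x) <-> X x by exact: supp_stable.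
(* As [s] is supported on X, the conjugation changes the cycle only where it enters and leaves X; in
   particular [b1] sends [s x] to [a x]. *)
pose b1 := cB ^ s.
have Gb1 : G b1 by exact: (G_normal_full sG simG vigG).
have sb1 : supp b1 TB.
  have <- : im s TB = TB by apply: supp_im; exact: suppW ss XTB.
  by apply: suppJ; case: ccB.
have b1n : b1 ^+ n = 1.
  by rewrite /b1 -conjXg (cyc_powm gB0 _ ccB) ?conj1g //; lia.
have b1i i x : X x -> (0 < i < n)%N -> (b1 ^+ i) (s x) = gB i x.
  move=> Xx /andP[i0 in_]; rewrite /b1 -conjXg hconj (cyc_pow gB0 ccB) // ss // => /XS S0.
  have [k Sk kE] := gBS i x Xx; apply: (dS k 0%N _ _ Sk S0).
  by apply/eqP; lia.
have [t [Gt tn tt st]] := lamp_homeo sG simG vigG YE Phi_phi Phi_supp Phi_G Fpi tok_inj Gc cn (csmall 0%N d0).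
pose T3 := im (a * a) [set x | exists j z, (0 < j < q)%N /\ x = tk j z].
pose b3 := t ^ (a * a).
have Gb3 : G b3 by apply: sgJ => //; exact: sgM.
have sb3 : supp b3 T3 by exact: suppJ.
have b3n : b3 ^+ n = 1 by rewrite /b3 -conjXg tn conj1g.
have aa x : X x -> (a * a) x = gam 2 x by move=> Xx; rewrite -expg2 aE.
have T3S x : T3 x -> S 2 x /\ TA x.
  move=> /imP[y [j [z [/andP[_ jq] ->]]] ->]; rewrite aa; last exact: Xtok.
  split; first by apply: gS; exact: Xtok.
  by exists 2; split=> //; rewrite imE; exact: Xtok.
have cTA : clopen TA by exact: clopen_tokens.
have cTB : clopen TB by exact: clopen_tokens.
pose R := K `&` ~` TA `&` ~` TB.
have cR : clopen R by do 2 apply: clopenD => //.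
(* The set [S m] is used by neither cycle: that of [a] ends at m-1, and that of [b] jumps from 1 to
   m+2. *)
have R0 : R !=set0.
  have [_ [x Sx] _] := S1 m; exists x; split; first split; first exact: SK Sx.
    by move=> /TAS[i im_ Si]; apply: (dS i m x) => //; rewrite ltn_eqF.
  by move=> /TBS[k Sk kE]; apply: (dS k m x _ Sk Sx); apply/eqP; lia.
have RK : R `<=` K by move=> x [[]].
pose Q' := im (a * a) (phi @` Q0).
have cQ' : clopen Q' by apply: im_clopen; exact: Phi_cl.
have Q'E x : Q' x <-> exists2 z, Q0 z & x = a (a (tk 0 z)).
  split=> [/imP[_ [z Qz <-] ->]|[z Qz ->]]; first by exists z.
  by rewrite -[a (a _)]/((a * a) (phi z)) /Q' imE; exists z.
have X00 z : X (tk 0 z) by apply: Xtok; lia.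
have Q'S x : Q' x -> S 2 x /\ TA x.
  move=> /Q'E[z _ ->]; rewrite -hmulE aa //; split; first exact: gS.
  by exists 2; split=> //; rewrite imE.
have Q'0 : Q' !=set0.
  by case: Q00 => z Qz; exists (a (a (tk 0 z))); apply/Q'E; exists z.
have RQ' : R `&` Q' = set0 by apply: disI => x [[_ nTA] _] /Q'S[_].
have XR x : X x -> R x -> False by move=> Xx [_ nTB]; exact/nTB/XTB.
have [|b2 [Gb2 sb2 b2n b2R]] := torsion_mover sG simG vigG cR R0 cQ' Q'0 RQ' _ (ltnW n2).
  case: X0 => x Xx; exists x => -[|/Q'S[Sx _]]; first exact: XR.
  by apply: (dS 0%N 2 x) => //; exact: XS.
have TBR : TB `&` (R `|` Q') = set0.
  apply: disI => x Tx [[_ //]|/Q'S[Sx _]].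
  by have [k Sk kE] := TBS x Tx; apply: (dS k 2 x _ Sk Sx); apply/eqP; lia.
have TB3 : TB `&` T3 = set0.
  apply: disI => x Tx /T3S[Sx _].
  by have [k Sk kE] := TBS x Tx; apply: (dS k 2 x _ Sk Sx); apply/eqP; lia.
have R3 : (R `|` Q') `&` T3 = set0.
  apply: disI => x [[[_ nTA] _] /T3S[_]//|/Q'E[z _ xE]] /imP[y [j [z' [jq yE]]] xE'].
  have /hinj E : (a * a) (tk 0 z) = (a * a) y by rewrite -xE'.
  by rewrite yE in E; have [||] := tok_inj _ _ _ _ _ _ E; lia.
have c12 : commute b1 b2 by apply: supp_commute sb1 sb2 _; rewrite TBR.
have c13 : commute b1 b3 by apply: supp_commute sb1 sb3 _; rewrite TB3.
have c23 : commute b2 b3 by apply: supp_commute sb2 sb3 _; rewrite R3.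
pose b := b1 * b2 * b3.
have bX_ k : b ^+ k = b1 ^+ k * b2 ^+ k * b3 ^+ k.
  rewrite /b expgMn; first by rewrite expgMn.
  by apply: commute_sym; apply: commuteM; apply: commute_sym.
have bn : b ^+ n = 1 by rewrite bX_ b1n b2n b3n !mulg1.
have bTB k x : TB x -> (b ^+ k) x = (b1 ^+ k) x.
  move=> Tx; have Tx' : TB ((b1 ^+ k) x) by apply/(supp_stable _ (suppX k sb1)).
  rewrite bX_ !hmulE (suppX k sb2) => [|]; last exact: disE TBR Tx'.
  by rewrite (suppX k sb3) //; exact: disE TB3 Tx'.
have bRQ x : (R `|` Q') x -> b x = b2 x.
  move=> Tx; have Tx' : (R `|` Q') (b2 x) by apply/(supp_stable _ sb2).
  rewrite -[b x]/(b3 (b2 (b1 x))) (sb1 x) => [|Tx'']; last exact: (disE TBR Tx'' Tx).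
  by rewrite sb3 //; exact: disE R3 Tx'.
have bV x : (R `|` Q') x -> b^-1 x = b2^-1 x.
  move=> Tx; apply: hinv_eq; rewrite bRQ ?hKinv //.
  by apply/(supp_stable _ (suppV sb2)).
have b3E x : ~ TB x -> ~ (R `|` Q') x -> b x = b3 x.
  by move=> n1 n2_; rewrite -[b x]/(b3 (b2 (b1 x))) sb1 // sb2.
have Gb : G b by apply: sgM => //; exact: sgM.
have sbK : supp b K.
  have TBK : TB `<=` K by move=> x /TBS[k /SK].
  apply: suppM; first apply: suppM.
  - exact: suppW sb1 TBK.
  - by apply: (suppW sb2) => x [/RK|/Q'S[/SK]].
  - by apply: (suppW sb3) => x /T3S[/SK].
have saK : supp a K by apply: (suppW sa) => x /TAS[i _ /SK].
have bi i x : X x -> (0 < i < n)%N -> (b ^+ i) (s x) = gB i x.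
  by move=> Xx ib; rewrite bTB ?b1i //; apply: XTB; apply/Xs.
have sV x : X x -> exists2 y, X y & x = s y.
  by move=> Xx; exists (s^-1 x); rewrite ?hKinv //; apply/(supp_stable _ (suppV ss)).
have aX i x : (0 < i < m)%N -> X x -> ~ X ((a ^+ i) x).
  move=> /andP[i0 im_] Xx; rewrite aE // => /XS S0.
  by apply: (dS i 0%N _ _ (gS i x Xx) S0); rewrite -lt0n.
have bsX x : X x -> b (s x) = a x.
  by move=> Xx; have := bi 1%N x Xx; rewrite expg1 n2 => -> //; have := aE 1%N x; rewrite expg1 => -> //; lia.
have aEb i x : (2 <= i < n)%N -> X x -> a ((b ^+ i) x) = (b ^+ i) x.
  move=> /andP[i2 in_] /sV[y Xy ->]; rewrite bi //; last by lia.
  apply: sa => /TAS[k km Sk]; have [k' Sk' kE] := gBS i y Xy.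
  by apply: (dS k k' _ _ Sk Sk'); apply/eqP; lia.
have nTB2 x : S 2 x -> ~ TB x.
  by move=> Sx /TBS[k Sk kE]; apply: (dS k 2 x _ Sk Sx); apply/eqP; lia.
have nRTA x : TA x -> ~ R x by move=> Tx [[]].
have gTA i x : (i < m)%N -> X x -> TA (gam i x) by move=> im_ Xx; exists i; rewrite imE.
have bX2 j z : (j < q)%N -> (0 < j)%N \/ ~ Q0 z ->
    b (a (a (tk j z))) = a (a (tk j (c j z))).
  move=> jq jz; have Xj := Xtok j z jq.
  rewrite b3E; first by rewrite -[a (a _)]/((a * a) (tk j z)) hconj tt.
  - by apply: nTB2; rewrite -hmulE aa //; exact: gS.
  - case; first by apply: nRTA; rewrite -hmulE aa //; apply: gTA.
    move=> /Q'E[z' Qz' /hinj/hinj E]; have [|j0 zE] := tok_inj _ _ _ _ jq _ E; first by lia.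
    by case: jz => [|nQ]; [rewrite j0|apply: nQ; rewrite zE].
have bX3 i x : (3 <= i < m)%N -> X x -> b ((a ^+ i) x) = (a ^+ i) x.
  move=> /andP[i3 im_] Xx; rewrite aE // b3E.
  - by apply: sb3 => /T3S[Sx _]; apply: (dS i 2 _ _ (gS i x Xx) Sx); apply/eqP; lia.
  - move=> /TBS[k Sk kE]; apply: (dS k i _ _ Sk (gS i x Xx)); apply/eqP; lia.
  - case; first by apply: nRTA; apply: gTA.
    by move=> /Q'S[Sx _]; apply: (dS i 2 _ _ (gS i x Xx) Sx); apply/eqP; lia.
have aR y : R y -> a y = y by move=> [[_ nTA] _]; exact: sa.
have bR y : R y -> exists2 z, Q0 z & b^-1 y = a (a (tk 0 z)).
  move=> Ry; rewrite bV; last by left.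
  apply/Q'E; have -> : b2^-1 y = (b2 ^+ n.-1) y.
    by apply: hinv_eq; rewrite -hexpS prednK ?b2n //; lia.
  by apply: b2R => //; lia.
have bQ z : Q0 z -> R (b^-1 (a (a (tk 0 z)))) \/
    exists2 z', Q0 z' & b^-1 (a (a (tk 0 z))) = a (a (tk 0 z')).
  move=> Qz; have Qx : Q' (a (a (tk 0 z))) by apply/Q'E; exists z.
  rewrite bV; last by right.
  have : (R `|` Q') (b2^-1 (a (a (tk 0 z)))) by apply/(supp_stable _ (suppV sb2)); right.
  by case=> [?|/Q'E ?]; [left|right].
have KE y : K y -> [\/ exists i x, [/\ (i < m)%N, X x & y = (a ^+ i) x],
    exists i x, [/\ (2 <= i < n)%N, X x & y = (b ^+ i) x] | R y].
  move=> Ky; have [[i [im_ /imP[x Xx ->]]]|nTA] := pselect (TA y).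
    by constructor 1; exists i, x; rewrite aE.
  have [[i [in_ /imP[x Xx yE]]]|nTB] := pselect (TB y); last by constructor 3.
  have [i1|i1] := leqP i 1.
    by case: nTA; rewrite yE /gB i1; apply: gTA => //; lia.
  by constructor 2; exists i, (s x); rewrite i1 in_ bi ?(ltnW i1) //; split=> //; apply/Xs.
have nK y : ~ K y -> a y = y /\ b y = y by move=> nKy; rewrite saK // sbK.
have sS j z : (j.+1 < q)%N -> s (tk j z) = tk j.+1 z.
  move=> jq; rewrite hmulE -hexpS Phi_supp // => Yj.
  have D := piY j.+1; rewrite jq in D; apply: (disE (D isT) Yj).
  by rewrite imE; apply/YE; exists z.
have sq z : s (tk q.-1 z) = tk 0 (rho z).
  by rewrite hmulE -hexpS prednK ?piq ?hone ?Phi_phi //; lia.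
exists a, b, R; split.
- split=> //.
  + move=> j jm aj1; case: X0 => x Xx; apply: (aX j x jm Xx); rewrite aj1; exact: Xx.
  + move=> j jn bj1; case: X0 => x Xx.
    have := bi j x Xx jn; rewrite bj1 hone => E.
    have [k Sk kE] := gBS j x Xx; have Ss : S 0%N (s x) by apply: XS; apply/Xs.
    by rewrite E in Ss; apply: (dS k 0%N _ _ Sk Ss); apply/eqP; lia.
- by split.
- have x0 : X (tk 1%N point) by exact: Xtok.
  have TAK : TA `<=` K by move=> x /TAS[i _ /SK].
  split.
    exists TA; split=> //; first by exists (tk 1%N point); exists 0%N; split=> //; lia.
      by apply: disI => x; exact: nRTA.
    by move=> f -> x; exact: supp_stable.
  (* Token 1 of a^2 X is fixed by [b]: since [d] is at least 2, the entry [c 1] is trivial. *)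
  exists [set x | exists z, x = a (a (tk 1%N z))]; split.
  + by exists (a (a (tk 1%N point))), point.
  + move=> x [z ->]; have Xz : X (tk 1%N z) by exact: Xtok.
    by apply: TAK; rewrite -hmulE aa //; exact: gTA.
  + apply: disI => x [z ->]; have Xz : X (tk 1%N z) by exact: Xtok.
    by apply: nRTA; rewrite -hmulE aa //; exact: gTA.
  + move=> f ->; apply: stable_fixes => x [z ->].
    by rewrite bX2 ?csmall //; left.
- exact: (two_generators_criterion sG simG vigG cY YE Phi_phi Phi_supp Phi_D d2 m3 n2 (erefl q) e1G pe Grho
    rho_inf rhoQ0 tok_inj sS sq am bn aX bsX aEb bX2 bX3 aR bR bQ KE nK cK R0 nQ0).
move=> mE nE; have [a1 Ga1 sa1] := swG 1%N isT; have [a2 Ga2 sa2] := swG 2 isT.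
have aE12 : a = a1 * a2.
  rewrite mE in ca; apply: (is_cyc_uniq _ ca) => //.
  apply: cyc_step => //; first by move=> i j _ _; exact: gdis.
  rewrite -[a1]mul1g; apply: cyc_step => //; by move=> i j _ _; exact: gdis.
have [a11 a12 a13] := sa1; have [a21 a22 a23] := sa2.
have a1TA : supp a1 TA.
  apply: (suppW a13) => x [Xx|gx]; first by exists 0%N; split=> //; lia.
  by exists 1%N; split=> //; lia.
have a2TA : supp a2 TA.
  apply: (suppW a23) => x [Xx|gx]; first by exists 0%N; split=> //; lia.
  by exists 2; split=> //; lia.
have TAK : TA `<=` K by move=> x /TAS[i _ /SK].
have sq1 f h : is_swap X h f -> f ^+ 2 = 1.
  by move=> /is_swap_inv fV; rewrite expg2 -{1}fV mulVg.
have ne1 i f : (0 < i)%N -> is_swap X (gam i) f -> f <> 1.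
  move=> i0 [f1 _ _] fE; case: X0 => x Xx.
  have := f1 x Xx; rewrite fE hone => E.
  by apply: (dS i 0%N x) => //; [rewrite -lt0n|rewrite E; exact: gS|exact: XS].
have b2_ x : b (b x) = x by rewrite -hmulE -expg2 -nE bn.
have a_1 x : X x -> a x = gam 1%N x.
  by move=> Xx; have := aE 1%N x; rewrite expg1 => -> //; lia.
have bX x : X x -> exists2 y, X y & b x = gam 1%N y.
  by move=> /sV[y Xy ->]; exists y; rewrite // bsX // a_1.
exists a1, a2; split=> //.
- by split; [exact: ne1 sa1|exact: ne1 sa2|exact: sq1 sa1|exact: sq1 sa2].
- by split; [exact: suppW a1TA TAK|exact: suppW a2TA TAK].
have bg x : X x -> b (gam 1%N x) = s x.
  by move=> Xx; rewrite -a_1 // -bsX // b2_.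
have X01 : X (tk 0 point) by [].
have X11 z : X (tk 1%N z) by exact: Xtok.
split.
(* [a2] exchanges token 1 of X with token 1 of a^2 X, [b] exchanges token 1 of X with token 0 of aX,
   and each fixes the remaining piece. *)
- exists [set x | exists z, [\/ x = gam 2 (tk 1%N z), x = tk 1%N z | x = gam 1%N (tk 0 z)]]; split.
  + by exists (tk 1%N point), point; constructor 2.
  + move=> x [z [->|->|->]]; apply: TAK.
    * exact: (gTA 2 _ m3 (X11 z)).
    * exact: (gTA 0%N _ (ltnW (ltnW m3)) (X11 z)).
    * exact: (gTA 1%N _ (ltnW m3) (X00 z)).
  + apply: disI => x [z [->|->|->]]; apply: nRTA.
    * exact: (gTA 2 _ m3 (X11 z)).
    * exact: (gTA 0%N _ (ltnW (ltnW m3)) (X11 z)).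
    * exact: (gTA 1%N _ (ltnW m3) (X00 z)).
  + move=> f [->|->].
      apply: (stable_periodic (k := 2)) => //; first exact: sq1 sa2.
      move=> x [z [->|->|->]]; exists z.
      * by constructor 2; exact: a22.
      * by constructor 1; exact: a21.
      * constructor 3; apply: a23 => -[/XS Sx|/gIm Sx].
          by apply: (dS 1%N 0%N _ _ (gS 1%N _ (X00 z)) Sx).
        by apply: (dS 1%N 2 _ _ (gS 1%N _ (X00 z)) Sx).
    apply: (stable_periodic (k := 2)) => //; first by rewrite -nE.
    have s0 z : s (tk 0 z) = tk 1%N z by exact: sS.
    move=> x [z [->|->|->]]; exists z.
    * constructor 1; rewrite -aa // -[(a * a) _]/(a (a _)) bX2 //; last by left.
      by rewrite csmall.
    * by constructor 3; rewrite -s0 bsX // a_1.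
    * by constructor 2; rewrite bg.
- exists (X `|` im (gam 1%N) X); split.
  + by case: X0 => x Xx; exists x; left.
  + move=> x [Xx|/imP[y Xy ->]]; apply: TAK.
      exact: (gTA 0%N _ (ltnW (ltnW m3)) Xx).
    exact: (gTA 1%N _ (ltnW m3) Xy).
  + apply: disI => x [Xx|/imP[y Xy ->]]; apply: nRTA.
      exact: (gTA 0%N _ (ltnW (ltnW m3)) Xx).
    exact: (gTA 1%N _ (ltnW m3) Xy).
  + move=> f [->|->]; first by move=> x; exact: supp_stable.
    apply: (stable_periodic (k := 2)) => //; first by rewrite -nE.
    move=> x [/bX[y Xy ->]|/imP[y Xy ->]]; first by right; rewrite imE.
    by left; rewrite bg //; apply/Xs.
- exists TA; split.
  + by case: X0 => x Xx; exists x; exists 0%N; split=> //; lia.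
  + exact: TAK.
  + by apply: disI => x; exact: nRTA.
  + by move=> f [->|->] x; exact: supp_stable.
Qed.

End Core.

(** * The remaining generators and irredundancy *)

Section Extension.
Variable G : set (homeo C).
Hypothesis sG : subgroup G.
Hypothesis simG : simple_group G.
Hypothesis vigG : vigorous G.
Variables (k : nat) (m : 'I_k -> nat).
Hypothesis hm : forall i, (2 <= m i)%N.
Implicit Types (i j : 'I_k) (x y : C) (Z K R V : set C).

(* [Z] being invariant under all the generators except one shows that this
   generator is not redundant. *)
Definition irredundant (alpha : 'I_k -> homeo C) := forall i, exists Z V,
  [/\ Z !=set0, clopen V /\ V !=set0, Z `&` V = set0 &
      forall j, j != i -> stable (alpha j) Z].

(** Each new generator moves its own set [T i], outside [K], into a proper subset [R'] of [R]. So
    the translates of [K] cover the space, and each generator keeps some point of [K] in [K], for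
    the new ones a point of [R] outside [R']. The other generators fix [T i], and the new ones fix
    the blocking sets inside [K]. *)
Lemma extend_generators (sp : pred 'I_k) (beta : 'I_k -> homeo C) K R (T : 'I_k -> set C) :
  (forall i, clopen (T i) /\ T i !=set0) ->
  (forall i j, i != j -> T i `&` T j = set0) ->
  K = ~` [set x | exists2 i, ~~ sp i & T i x] -> clopen K ->
  [/\ clopen R, R !=set0 & R `<=` K] ->
  (forall i, sp i -> [/\ G (beta i), supp (beta i) K & has_order (beta i) (m i)]) ->
  (forall H, subgroup H -> H `<=` G -> (forall i, sp i -> H (beta i)) -> D G K `<=` H) ->
  (forall i, sp i -> blocked K R [set f | exists j, [/\ sp j, j != i & f = beta j]]) ->
  exists alpha : 'I_k -> homeo C, [/\ forall i, sp i -> alpha i = beta i,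
    forall i, G (alpha i), generated (range alpha) = G,
    forall i, has_order (alpha i) (m i) & irredundant alpha].
Proof.
move=> T1 T2 KE cK [cR R0 RK] spP spD spB.
have [R' [cR' R'0 R'R]] := clopen_shrink cR R0.
have TK i x : ~~ sp i -> T i x -> ~ K x.
  by move=> ni Tx; rewrite KE; apply; exists i.
have TR' i : ~~ sp i -> T i `&` R' = set0.
  by move=> ni; apply: disI => x Tx /(R'R.1)/RK; exact: TK Tx.
have [r [Rr nR'r]] : exists r, R r /\ ~ R' r.
  by have [_ nRR] := R'R; apply: contrapT => H; apply: nRR => x Rx; apply: contrapT => nx; apply: H; exists x.
have Kr : K r by exact: RK.
have /choice [gam Hg] : forall i, exists b, ~~ sp i -> [/\ G b, supp b (T i `|` R'),
    b ^+ m i = 1 & forall x u, T i x -> (0 < u < m i)%N -> R' ((b ^+ u) x)].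
  move=> i; have [si|ni] := boolP (sp i); first by exists 1.
  have [cT T0] := T1 i.
  have [||b Hb] := torsion_mover sG simG vigG cT T0 cR' R'0 (TR' i ni) (n := m i).
  - by exists r => -[/(TK i r ni)|].
  - exact: ltnW (hm i).
  - exists b => _; exact: Hb.
pose alpha i := if sp i then beta i else gam i.
have asp i : sp i -> alpha i = beta i by move=> si; rewrite /alpha si.
have ansp i : ~~ sp i -> alpha i = gam i by move=> /negPf si; rewrite /alpha si.
have aG i : G (alpha i).
  by have [si|ni] := boolP (sp i); [rewrite asp //; case: (spP i si)|rewrite ansp //; case: (Hg i ni)].
have KnT x : ~ K x -> exists2 i, ~~ sp i & T i x.
  by rewrite KE => nK; apply: contrapT => H; exact: nK.
exists alpha; split=> //.
- apply/seteqP; split; first by apply: generated_min => // _ [i _ <-].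
  have sH := generated_subgroup (range alpha).
  have Ha i : generated (range alpha) (alpha i) by apply: sub_generated; exists i.
  have HG : generated (range alpha) `<=` G by apply: generated_min => // _ [i _ <-].
  rewrite -{1}(D_setT sG simG vigG).
  apply: (@D_cover G sG simG vigG _ (range alpha) K) => //.
  + by apply: spD => // i si; rewrite -asp.
  + by move=> _ [i _ <-].
  + move=> _ [i _ <-]; exists r; split=> //; have [si|ni] := boolP (sp i).
      by rewrite asp // supp_im //; case: (spP i si).
    have [_ sg _ _] := Hg i ni; rewrite -[r](sg r) ?ansp ?imE // => -[/(TK i r ni)|//].
    exact.
  + exact: clopenT.
  + move=> x _; have [Kx|/KnT[i ni Tx]] := pselect (K x).
      by exists 1; [exact: (sg1 sH)|].
    exists (alpha i) => //; rewrite -[x](hKinv (alpha i)) imE.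
    have [_ _ gm gR] := Hg i ni; apply/RK/R'R.1.
    have -> : (alpha i)^-1 x = (gam i ^+ (m i).-1) x.
      rewrite ansp //; apply: hinv_eq; rewrite -hexpS prednK ?gm //.
      exact: ltnW (hm i).
    by apply: gR => //; have := hm i; lia.
- move=> i; have [si|ni] := boolP (sp i); first by rewrite asp //; case: (spP i si).
  rewrite ansp //; have [_ _ gm gR] := Hg i ni; split=> //; first exact: ltnW (hm i).
  move=> j jm gj; have [_ [x Tx]] := T1 i; have := gR x j Tx jm; rewrite gj.
  exact: (disE (TR' i ni) Tx).
move=> i; have [si|ni] := boolP (sp i).
  have [Z [Z0 ZK ZR sZ]] := spB i si; exists Z, R; split=> // j ji.
  have [sj|nj] := boolP (sp j); first by apply: sZ; exists j; rewrite asp.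
  apply: stable_fixes => x Zx; rewrite ansp //; have [_ sg _ _] := Hg j nj.
  by apply: sg => -[Tx|/(R'R.1)]; [exact: (TK j x nj Tx (ZK x Zx))|exact: disE ZR Zx].
have [cT T0] := T1 i; exists (T i), R; split=> //.
  by apply: disI => x Tx /RK; exact: TK Tx.
move=> j ji; apply: stable_fixes => x Tx; have [sj|nj] := boolP (sp j).
  by rewrite asp //; have [_ sb _] := spP j sj; apply: sb; exact: TK Tx.
rewrite ansp //; have [_ sg _ _] := Hg j nj; apply: sg => -[Tx'|R'x].
  exact: (disE (T2 j i ji) Tx' Tx).
exact: (disE (TR' i ni) Tx R'x).
Qed.

End Extension.

(** * Words separating the factors *)

Section Words.
Variables (k : nat) (o : option 'I_k) (i1 i2 : 'I_k).

(** The value [Some] is for the case where all orders are 2 and the element a is a product of two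
    generators. *)
Definition word_a (gT : groupType) (alpha : 'I_k -> gT) : gT :=
  if o is Some i then alpha i1 * alpha i else alpha i1.

Definition test_word N (gT : groupType) (alpha : 'I_k -> gT) : gT :=
  let v := (word_a alpha * (alpha i2)^-1) ^+ N in [~ v, v ^ word_a alpha].

End Words.

Lemma blockedS K R P P' : P `<=` P' -> blocked K R P' -> blocked K R P.
Proof. by move=> PP [Z [Z0 ZK ZR sZ]]; exists Z; split=> // f /PP; exact: sZ. Qed.

Lemma clopen_union (I : finType) (P : pred I) (T : I -> set C) :
  (forall i, clopen (T i)) -> clopen [set x | exists2 i, P i & T i x].
Proof.
move=> cT; suff H (r : seq I) : clopen [set x | exists2 i, (i \in r) && P i & T i x].
  rewrite (_ : [set x | _] = [set x | exists2 i, (i \in enum I) && P i & T i x]) //.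
  by apply/seteqP; split=> x [i Pi Tx]; exists i; rewrite ?mem_enum //; rewrite ?mem_enum in Pi.
elim: r => [|j r IH].
  by rewrite (_ : [set x | _] = set0); [exact: clopen0|apply/seteqP; split=> // x [i]].
rewrite (_ : [set x | _] = (if P j then T j else set0) `|`
    [set x | exists2 i, (i \in r) && P i & T i x]).
  by apply: clopenU => //; case: ifP => _; [exact: cT|exact: clopen0].
apply/seteqP; split=> [x [i]|x].
  rewrite inE => /andP[/orP[/eqP ->|ir] Pi] Tx; first by left; rewrite Pi.
  by right; exists i; rewrite ?ir.
case=> [|[i /andP[ir Pi] Tx]]; last by exists i; rewrite // inE ir orbT.
by case: ifP => // Pj Tx; exists j; rewrite // mem_head.
Qed.

(** The word and [L] are chosen before the group, so that the same word can be evaluated in all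
    factors; the parameter [d] is what distinguishes them. *)
Lemma one_factor_generators k (m : 'I_k -> nat) : (2 <= k)%N -> (forall i, (2 <= m i)%N) ->
  (k = 2 -> range m <> [set 2%N]) ->
  exists o i1 i2 L, (0 < L)%N /\ forall G : set (homeo C), subgroup G ->
    simple_group G -> vigorous G -> finitely_generated G -> forall d,
    exists (alpha : 'I_k -> homeo C) N0,
    [/\ forall i, G (alpha i), generated (range alpha) = G,
        forall i, has_order (alpha i) (m i), irredundant alpha &
        [/\ (0 < N0)%N, forall N, (N0 %| N)%N -> test_word o i1 i2 N alpha = 1 &
            forall t, (L * t.+1 < d)%N -> test_word o i1 i2 (L * t.+1) alpha <> 1]].
Proof.
move=> k2 hm hm2.
have [S [S1 S2]] := spots clopenT (ex_intro setT point I : [set: C] !=set0).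
pose T (i : 'I_k) := S i.+1.
have T1 i : clopen (T i) /\ T i !=set0 by case: (S1 i.+1).
have T2 i j : i != j -> T i `&` T j = set0 by move=> ij; apply: S2.
pose K (sp : pred 'I_k) := ~` [set x | exists2 i, ~~ sp i & T i x].
have cK sp : clopen (K sp).
  by apply: (clopenC setT); apply: clopen_union => i; case: (T1 i).
have K0 sp : K sp !=set0.
  have [_ [x Sx] _] := S1 0%N; exists x => -[i _ Tx].
  exact: (disE (S2 0%N i.+1 isT) Sx Tx).
have [[i1 mi1]|no3] := pselect (exists i, (3 <= m i)%N).
  have [i2 i21] : exists i2, i2 != i1.
    pose j0 : 'I_k := Ordinal (ltnW k2); pose j1 : 'I_k := Ordinal k2.
    have [E|?] := eqVneq j0 i1; last by exists j0.
    by exists j1; rewrite -E.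
  exists None, i1, i2, (m i1 + m i2 - 3)%N; split.
    by have := hm i2; lia.
  move=> G sG simG vigG fgG d; pose sp : pred 'I_k := pred2 i1 i2.
  have [a [b [R [[[Ga Gb] [am bn] [saK sbK] aj bj] [cR R0 RK aR] [Ka Kb]
    [Hgen [N0 N00 Hc] Hnc] _]]]] :=
    two_generators sG simG vigG fgG mi1 (hm i2) (isT : 2 <= d.+2)%N (cK sp) (K0 sp).
  pose beta (i : 'I_k) := if i == i1 then a else b.
  have b1 : beta i1 = a by rewrite /beta eqxx.
  have b2 : beta i2 = b by rewrite /beta (negPf i21).
  have spE i : sp i -> i = i1 \/ i = i2 by move=> /orP[/eqP|/eqP]; [left|right].
  have [||||alpha [aE aG agen aord airr]] :=
      @extend_generators G sG simG vigG k m hm sp beta (K sp) R T T1 T2 erefl (cK sp).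
  - by [].
  - move=> i /spE[->|->]; rewrite ?b1 ?b2; split=> //.
      by split=> //; exact: ltnW (ltnW mi1).
    by split=> //; exact: ltnW (hm i2).
  - move=> H sH HG Hb; apply: Hgen => //.
      by rewrite -b1; apply: Hb; rewrite /sp /= eqxx.
    by rewrite -b2; apply: Hb; rewrite /sp /= eqxx orbT.
  - move=> i /spE[->|->].
      by apply: blockedS Kb => f [j [/spE[->|->] ji ->]]; [rewrite eqxx in ji|rewrite b2].
    by apply: blockedS Ka => f [j [/spE[->|->] ji ->]]; [rewrite b1|rewrite eqxx in ji].
  have a1 : alpha i1 = a by rewrite aE ?b1 // /sp /= eqxx.
  have a2 : alpha i2 = b by rewrite aE ?b2 // /sp /= eqxx orbT.
  exists alpha, N0; split=> //; split=> //.
    move=> N NN; apply/eqP/commgP; rewrite /word_a a1 a2; exact: Hc.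
  move=> t td; rewrite /test_word /word_a a1 a2 => /eqP/commgP; apply: Hnc.
  by apply: leq_trans td _; lia.
have m2 i : m i = 2.
  have := hm i; have [/(ex_intro (fun i => 3 <= m i)%N i)/no3[]|] := leqP 3 (m i).
  by lia.
have k3 : (3 <= k)%N.
  have [k3|k3] := leqP 3 k; first by [].
  have kE : k = 2 by lia.
  case: (hm2 kE); apply/seteqP; split=> [_ [i _ <-]|_ ->]; first exact: m2.
  by exists (Ordinal k2).
pose j1 : 'I_k := Ordinal (ltnW k2); pose j2 : 'I_k := Ordinal k2.
pose j3 : 'I_k := Ordinal k3.
(* The core has orders 3 and 2, so the return time m + n - 3 is 2. *)
exists (Some j2), j1, j3, 2; split=> // G sG simG vigG fgG d.
pose sp : pred 'I_k := pred3 j1 j2 j3.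
have [a [b [R [[[Ga Gb] [am bn] [saK sbK] aj bj] [cR R0 RK aR] [Ka Kb]
    [Hgen [N0 N00 Hc] Hnc] /(_ erefl erefl)]]]] :=
    two_generators sG simG vigG fgG (isT : 3 <= 3)%N (isT : 2 <= 2)%N (isT : 2 <= d.+2)%N (cK sp) (K0 sp).
case=> a1 [a2 [[Ga1 Ga2] aE [a11 a21 a1n a2n] [sa1 sa2] [B1 B2 B3]]].
pose beta (i : 'I_k) := if i == j1 then a1 else if i == j2 then a2 else b.
have b1 : beta j1 = a1 by [].
have b2 : beta j2 = a2 by [].
have b3 : beta j3 = b by [].
have spE i : sp i -> [\/ i = j1, i = j2 | i = j3].
  by case/or3P => /eqP; [constructor 1|constructor 2|constructor 3].
have ord2 f : f ^+ 2 = 1 -> f <> 1 -> has_order (f : homeo C) 2.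
  move=> f2 f1; split=> // j jb; have -> : j = 1%N by lia.
  by rewrite expg1.
have [||||alpha [alE aG agen aord airr]] :=
    @extend_generators G sG simG vigG k m hm sp beta (K sp) R T T1 T2 erefl (cK sp).
- by [].
- move=> i /spE[->|->|->]; rewrite ?b1 ?b2 ?b3 m2; split=> //; exact: ord2.
- move=> H sH HG Hb; apply: Hgen => //.
    by rewrite aE; apply: sgM => //; [rewrite -b1|rewrite -b2]; exact: Hb.
  by rewrite -b3; exact: Hb.
- move=> i /spE[->|->|->].
  + apply: blockedS B1 => f [j [/spE[->|->|->] ji ->]] //; [by left|by right].
  + apply: blockedS B2 => f [j [/spE[->|->|->] ji ->]] //; [by left|by right].
  + apply: blockedS B3 => f [j [/spE[->|->|->] ji ->]] //; [by left|by right].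
have al1 : alpha j1 = a1 by rewrite alE.
have al2 : alpha j2 = a2 by rewrite alE.
have al3 : alpha j3 = b by rewrite alE.
exists alpha, N0; split=> //; split=> //.
  by move=> N NN; apply/eqP/commgP; rewrite /word_a al1 al2 al3 -aE; exact: Hc.
move=> t td; rewrite /test_word /word_a al1 al2 al3 -aE => /eqP/commgP; apply: Hnc.
by apply: leq_trans td _; lia.
Qed.

(** * Direct products *)

Section Products.
Variables (I : finType) (gT : groupType).
Implicit Types (f g : {ffun I -> gT}).

Lemma ffun_mulE f g i : (f * g) i = f i * g i. Proof. by rewrite ffunE. Qed.
Lemma ffun_oneE i : (1 : {ffun I -> gT}) i = 1. Proof. by rewrite ffunE. Qed.
Lemma ffun_invE f i : f^-1 i = (f i)^-1. Proof. by rewrite ffunE. Qed.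
Lemma ffun_expE f n i : (f ^+ n) i = f i ^+ n.
Proof. by elim: n => [|n IH]; rewrite ?expg0 ?ffun_oneE // !expgS ffun_mulE IH. Qed.
Lemma ffun_conjE f g i : (f ^ g) i = f i ^ g i.
Proof. by rewrite !conjgE !ffun_mulE ffun_invE. Qed.
Lemma ffun_commE f g i : [~ f, g] i = [~ f i, g i].
Proof. by rewrite !commgEl ffun_mulE ffun_invE ffun_conjE. Qed.

Lemma test_wordE k o (i1 i2 : 'I_k) N (alpha : 'I_k -> {ffun I -> gT}) i :
  (test_word o i1 i2 N alpha) i = test_word o i1 i2 N (fun j => alpha j i).
Proof.
have aE : (word_a o i1 alpha) i = word_a o i1 (fun j => alpha j i).
  by rewrite /word_a; case: o => // j; rewrite ffun_mulE.
by rewrite /test_word ffun_commE ffun_conjE !ffun_expE ffun_mulE ffun_invE aE.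
Qed.

End Products.

Lemma subgroup_product (I : finType) (gT : groupType) (G : I -> set gT) :
  (forall i, subgroup (G i)) -> subgroup (direct_product G).
Proof.
move=> sG; apply: subgroup_mk => [i|f g Gf Gg i|f Gf i].
- by rewrite ffun_oneE; exact: sg1.
- by rewrite ffun_mulE; apply: sgM.
- by rewrite ffun_invE; apply: sgV.
Qed.

Lemma test_word_in k o (i1 i2 : 'I_k) N (gT : groupType) (alpha : 'I_k -> gT) H :
  subgroup H -> (forall i, H (alpha i)) -> H (test_word o i1 i2 N alpha).
Proof.
move=> sH Ha; have Hw : H (word_a o i1 alpha).
  by rewrite /word_a; case: o => // j; exact: sgM.
have Hv : H ((word_a o i1 alpha * (alpha i2)^-1) ^+ N).
  by apply: sgX => //; apply: sgM => //; exact: sgV.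
by apply: sgR => //; exact: sgJ.
Qed.

(* By simplicity, the elements of [H] that are trivial in the factors before the
   i-th take all values in [G i]; the factors are then cleared one by one. *)
Lemma triangular_product l (gT : groupType) (G : 'I_l -> set gT)
    (H : set {ffun 'I_l -> gT}) :
  (forall i, subgroup (G i)) -> (forall i, simple_group (G i)) -> subgroup H -> H `<=` direct_product G ->
  (forall i g, G i g -> exists2 h, H h & h i = g) ->
  (forall i : 'I_l, exists h, [/\ H h, forall j : 'I_l, (j < i)%N -> h j = 1 & h i <> 1]) ->
  H = direct_product G.
Proof.
move=> sG simG sH HG Hproj Htri.
have Htri' i g : G i g -> exists h, [/\ H h, forall j : 'I_l, (j < i)%N -> h j = 1 & h i = g].
  pose N := [set g | exists h, [/\ H h, forall j : 'I_l, (j < i)%N -> h j = 1 & h i = g]].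
  suff <- : N = G i by [].
  apply: (simple_normalE (simG i)); last first.
    by have [h [Hh h1 hi]] := Htri i; exists (h i) => //; exists h.
  split.
  - apply: subgroup_mk.
    + by exists 1; split=> [|j _|]; rewrite ?ffun_oneE //; exact: (sg1 sH).
    + move=> _ _ [h [Hh h1 <-]] [h' [Hh' h1' <-]]; exists (h * h').
      split=> [|j ji|]; [exact: (sgM sH)| |exact: ffun_mulE].
      by rewrite ffun_mulE h1 // h1' // mulg1.
    + move=> _ [h [Hh h1 <-]]; exists h^-1.
      split=> [|j ji|]; [exact: (sgV sH)| |exact: ffun_invE].
      by rewrite ffun_invE h1 // invg1.
  - by move=> _ [h [/HG Gh _ <-]].
  - move=> _ y [h [Hh h1 <-]] /Hproj[h' Hh' <-]; exists (h ^ h').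
    split=> [|j ji|]; [exact: (sgJ sH)| |exact: ffun_conjE].
    by rewrite ffun_conjE h1 // conj1g.
apply/seteqP; split=> // f Gf.
suff agree n : (n <= l)%N -> exists2 h, H h & forall j : 'I_l, (j < n)%N -> h j = f j.
  have [h Hh hf] := agree l (leqnn l).
  by have -> : f = h by apply/ffunP => j; rewrite hf.
elim: n => [|n IH] nl; first by exists 1; [exact: (sg1 sH)|].
have [h Hh hf] := IH (ltnW nl).
pose i : 'I_l := Ordinal nl.
have Gi : G i ((h i)^-1 * f i).
  by apply: (sgM (sG i)); [apply: (sgV (sG i)); exact: HG|exact: Gf].
have [h' [Hh' h1' hi']] := Htri' i _ Gi.
exists (h * h'); first exact: (sgM sH).
move=> j; rewrite ltnS leq_eqVlt => /orP[/eqP jn|jn]; rewrite ffun_mulE.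
  have -> : j = i by exact: val_inj.
  by rewrite hi' mulVKg.
by rewrite h1' // mulg1 hf.
Qed.

Theorem theorem9 (l : nat) (hl : (1 <= l)%N)
    (G : 'I_l -> set (homeo cantor_space))
    (hsub : forall i, subgroup (G i))
    (hfg : forall i, finitely_generated (G i))
    (hsimple : forall i, simple_group (G i))
    (hvig : forall i, vigorous (G i))
    (k : nat) (hk : (2 <= k)%N)
    (m : 'I_k -> nat) (hm : forall i, (2 <= m i)%N)
    (hm2 : k = 2%N -> range m <> [set 2%N]) :
  exists alpha : 'I_k -> {ffun 'I_l -> homeo cantor_space},
    [/\ injective alpha,
        minimal_generating_set (direct_product G) (range alpha) &
        forall i, has_order (alpha i) (m i)].
Proof.
have [o [i1 [i2 [L [L0 Hone]]]]] := one_factor_generators hk hm hm2.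
pose good (G : set (homeo C)) d (r : ('I_k -> homeo C) * nat) :=
  [/\ forall i, G (r.1 i), generated (range r.1) = G,
      forall i, has_order (r.1 i) (m i), irredundant r.1 &
      [/\ (0 < r.2)%N, forall N, (r.2 %| N)%N -> test_word o i1 i2 N r.1 = 1 &
          forall t, (L * t.+1 < d)%N -> test_word o i1 i2 (L * t.+1) r.1 <> 1]].
have /choice [F HF] : forall p : nat * nat, exists r, forall hp : (p.1 < l)%N,
    good (G (Ordinal hp)) p.2 r.
  move=> [i d]; have [hi|hi] := pselect (i < l)%N; last by exists ((fun=> 1), 0%N).
  have [al [N0 H]] := Hone _ (hsub (Ordinal hi)) (hsimple _) (hvig _) (hfg _) d.
  by exists (al, N0) => /= hi'; rewrite (_ : Ordinal hi' = Ordinal hi) //; exact: val_inj.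
(* [B i] is a period of the test words of the factors before the i-th, and
   [L * B i] is not a period for the i-th. *)
pose B := fix B i := if i is i'.+1 then (B i' * (F (i', (L * B i').+1)).2)%N else 1%N.
pose al (i : 'I_l) := (F (val i, (L * B i).+1)).1.
have goodF (i : 'I_l) : good (G i) (L * B i).+1 (F (val i, (L * B i).+1)).
  by have := HF (val i, (L * B i).+1) (ltn_ord i); congr (good (G _) _ _); exact: val_inj.
have B0 i : (i <= l)%N -> (0 < B i)%N.
  elim: i => // i IH il; rewrite /= muln_gt0 IH ?(ltnW il) //.
  by have [_ _ _ _ []] := HF (i, (L * B i).+1) il.
have Bdvd (j i : nat) : (j < i)%N -> ((F (j, (L * B j).+1)).2 %| B i)%N.
  elim: i => // i IH; rewrite ltnS leq_eqVlt => /orP[/eqP ->|/IH ji] /=.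
    by rewrite dvdn_mull.
  by rewrite dvdn_mulr.
pose alpha (j : 'I_k) : {ffun 'I_l -> homeo C} := [ffun i => al i j].
have alphaE j i : alpha j i = al i j by rewrite ffunE.
have Galpha j : direct_product G (alpha j).
  by move=> i; rewrite alphaE; have [+ _ _ _ _] := goodF i; apply.
have sP := subgroup_product hsub.
have genE : generated (range alpha) = direct_product G.
  have sH := generated_subgroup (range alpha).
  have Ha j : generated (range alpha) (alpha j) by apply: sub_generated; exists j.
  apply: triangular_product => //.
  - by apply: generated_min => // _ [j _ <-].
  - move=> i g; have [_ <- _ _ _] := goodF i.
    apply: (generated_min (G := [set g | exists2 h, generated (range alpha) h & h i = g])).
      apply: subgroup_mk.
      + by exists 1; [exact: (sg1 sH)|rewrite ffun_oneE].
      + by move=> _ _ [h Hh <-] [h' Hh' <-]; exists (h * h'); [exact: (sgM sH)|rewrite ffun_mulE].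
      + by move=> _ [h Hh <-]; exists h^-1; [exact: (sgV sH)|rewrite ffun_invE].
    by move=> _ [j _ <-]; exists (alpha j); rewrite ?alphaE.
  - move=> i; exists (test_word o i1 i2 (L * B i) alpha); split.
    + exact: test_word_in.
    + move=> j ji; rewrite test_wordE; have [_ _ _ _ [_ Hper _]] := goodF j.
      rewrite (_ : (fun j' => alpha j' j) = al j); last by apply/funext => j'; rewrite alphaE.
      by apply: Hper; rewrite dvdn_mull // Bdvd.
    + rewrite test_wordE; have [_ _ _ _ [_ _ Hnp]] := goodF i.
      rewrite (_ : (fun j' => alpha j' i) = al i); last by apply/funext => j'; rewrite alphaE.
      have := Hnp (B i).-1; rewrite prednK ?B0 //; last exact: ltnW.
      by apply; exact: ltnSn.
pose z : 'I_l := Ordinal hl.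
(* One factor suffices: the element equal to [g] in the factor [z] and trivial elsewhere carries the
   invariant set into [V], off itself. *)
have missing (X : set {ffun 'I_l -> homeo C}) i :
    X `<=` [set f | exists2 j, j != i & f = alpha j] -> generated X <> direct_product G.
  move=> XS XG; have [_ _ _ irr _] := goodF z.
  have [Z [V [[x Zx] [cV V0] ZV sZ]]] := irr i.
  have nVx : ~ V x by exact: disE ZV Zx.
  have [g [Gg gV _]] := vig_disj (hvig z) (clopenC setT cV) (ex_intro _ x nVx) cV V0 (setICl V).
  pose f : {ffun 'I_l -> homeo C} := [ffun j => if j == z then g else 1].
  have fz : f z = g by rewrite ffunE eqxx.
  have : generated X f.
    rewrite XG => j; rewrite ffunE; case: eqP => [->//|_]; exact: (sg1 (hsub j)).
  suff H : generated X `<=` [set f | stable (f z) Z].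
    by move=> /H /(_ x); rewrite fz => -[_ /(_ Zx)] /(disE ZV); apply; exact: gV.
  apply: generated_min.
    apply: subgroup_mk.
    - by move=> y; rewrite ffun_oneE.
    - by move=> f1 f2 s1 s2 y; rewrite ffun_mulE hmulE s2 s1.
    - by move=> f1 s1 y; rewrite ffun_invE -[in X in _ <-> X](hKinv (f1 z) y) s1.
  by move=> f1 /XS[j ji ->] /=; rewrite alphaE; exact: sZ.
(* If two generators coincided, the whole range would be attained without one of the two indices,
   against [missing]. *)
have inj : injective alpha.
  move=> i j aij; apply: contrapT => /eqP ij.
  apply: (missing (range alpha) i) genE => _ [j' _ <-].
  have [->|j'i] := eqVneq j' i; last by exists j'.
  by exists j; rewrite // eq_sym.
exists alpha; split=> //.
  split=> // X [XS nXS]; have [i nXi] : exists i, ~ X (alpha i).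
    by apply: contrapT => H; apply: nXS => _ [i _ <-]; apply: contrapT => nX; apply: H; exists i.
  apply: (missing X i) => f Xf; have [j _ jf] := XS f Xf.
  by exists j => //; apply/eqP => ji; apply: nXi; rewrite -ji jf.
move=> i; have [_ _ /(_ i)[m0 ami amj] _ _] := goodF z.
split=> //.
  apply/ffunP => j; rewrite ffun_expE ffun_oneE alphaE.
  by have [_ _ /(_ i)[]] := goodF j.
move=> j jm /(congr1 (fun f : {ffun 'I_l -> homeo C} => f z)).
by rewrite ffun_expE ffun_oneE alphaE; exact: amj.
Qed.
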